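(* Let $P$ be a Markov kernel on a general measurable state space $\mathcal X$ with stationary probability measure $\mu$ and with $\lambda:=\lambda(P)<1$. Let $s_1,\dots,s_n$ be a Markov chain with transition kernel $P$ and initial distribution $s_1\sim\mu$. Let $F_1,\dots,F_n:\mathcal X\to\mathbb R^{d\times d}$ be measurable functions with values in the real symmetric $d\times d$ matrices such that for every $j$ one has $\mathbb E_\mu[F_j(x)]=0$ and $a_jI\preceq F_j(x)\preceq b_jI$ for all $x\in\mathcal X$, where $a_j,b_j\in\mathbb R$. Put $\alpha(\lambda)=\frac{1+\lambda}{1-\lambda}$. Then for every $\theta>0$, $$\mathbb E_\mu\left[\left\|\prod_{j=1}^n\exp\left(\tfrac{\theta}{2}F_j(s_j)\right)\right\|_F^2\right]\le d\,\exp\left(\frac{\theta^2}{2}\cdot\alpha(\lambda)\cdot\frac{\sum_{j=1}^n(b_j-a_j)^2}{4}\right),$$ and for every $t>0$, $$\Pr_\mu\left(\lambda_{\max}\Big(\sum_{j=1}^nF_j(s_j)\Big)\ge t\right)\le d^{2-\pi/4}\exp\left(\frac{-t^2/(8/\pi^2)}{\alpha(\lambda)\cdot\sum_{j=1}^n(b_j-a_j)^2}\right).$$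
   Context: For a Markov kernel $P$ on $\mathcal X$ with stationary probability measure $\mu$, $P$ acts on $L^2(\mu)$ by $(Ph)(x)=\int h(y)\,P(x,dy)$, and $\Pi$ is the projection $\Pi h=\mathbb E_\mu[h]\,\mathbf 1$ onto constants. Define $\lambda(P):=\sup\{\|Ph\|_{L^2(\mu)}/\|h\|_{L^2(\mu)}: h\ne0,\ \Pi h=0\}=\|P-\Pi\|_{L^2(\mu)\to L^2(\mu)}$; $P$ admits absolute spectral gap $1-\lambda(P)$ if $\lambda(P)<1$. No reversibility is assumed. The subscript $\mu$ on $\mathbb E$, $\Pr$ for chain quantities means the chain starts from $\mu$. $\prod_{j=1}^nA_j=A_1A_2\cdots A_n$ (ordered product), $\|\cdot\|_F$ is the Frobenius norm, $\lambda_{\max}$ the largest eigenvalue, $\preceq$ the positive semidefinite order. *)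

(* Defs.v *)
From HB Require Import structures.
From mathcomp Require Export all_boot all_order all_algebra.
From mathcomp Require Export all_classical all_reals all_analysis.
Export Order.TTheory GRing.Theory Num.Theory.
Export numFieldNormedType.Exports.

Set Implicit Arguments.
Unset Strict Implicit.
Unset Printing Implicit Defensive.

Local Open Scope classical_set_scope.
Local Open Scope ring_scope.

Section matrices.
Context {R : realType} {m : nat}.
Implicit Types A B : 'M[R]_m.

Definition expmx A : 'M[R]_m :=
  limn (series (fun k => (k`!%:R)^-1 *: A ^+ k)).

Definition frobenius_norm A : R := Num.sqrt (\sum_i \sum_j A i j ^+ 2).

(* Only meaningful for symmetric A and m > 0, when the set of (real)
   eigenvalues is finite and nonempty, so that the sup is a maximum. *)
Definition lambda_max A : R := sup [set a | eigenvalue A a].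

Definition psd A : Prop :=
  A \is symmetricmx /\ forall v : 'rV[R]_m, 0 <= (v *m A *m v^T) 0 0.

Definition loewner_le A B : Prop := psd (B - A).

End matrices.

Section markov.
Context {R : realType} {d : measure_display} {T : measurableType d}.

Definition stationary (P : R.-pker T ~> T) (mu : probability T R) : Prop :=
  forall A, measurable A -> (\int[mu]_x P x A = mu A)%E.

Definition markov_op (P : R.-pker T ~> T) (h : T -> R) : T -> R :=
  fun x => \int[P x]_y h y.

(* 'h != 0' is meant in L^2(mu), i.e. as nonvanishing of the norm.  If
   L^2(mu) has no nonzero centred element, the set is empty and its sup is 0,
   the operator norm of P - Pi. *)
Definition lambda (P : R.-pker T ~> T) (mu : probability T R) : R :=
  sup [set r | exists h : T -> R,
    [/\ h \in Lfun mu 2%:E,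
        Lnorm mu 2%:E (EFin \o h) != 0%E,
        ('E_mu[h] = 0)%E
      & r = fine (Lnorm mu 2%:E (EFin \o markov_op P h))
              / fine (Lnorm mu 2%:E (EFin \o h))]].

Context {d' : measure_display} {Omega : measurableType d'}
  {Pr : probability Omega R} {n : nat}.

Definition history (s : 'I_n -> {RV Pr >-> T}) (i : 'I_n) : set (set Omega) :=
  <<s \bigcup_(k in [set k : 'I_n | (k <= i)%N])
        preimage_set_system setT (s k) measurable >>.

(* The last clause says that P (s_i, A) is a version of the conditional
   probability of {s_{i+1} \in A} given the sigma-algebra of s_0, .., s_i. *)
Definition markov_chain (P : R.-pker T ~> T) (mu : probability T R)
    (s : 'I_n -> {RV Pr >-> T}) : Prop :=
  (forall (i : 'I_n) A, i = 0 :> nat -> measurable A ->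
     Pr (s i @^-1` A) = mu A) /\
  (forall (i j : 'I_n) E A, j = i.+1 :> nat -> history s i E ->
     measurable A ->
     (Pr (E `&` s j @^-1` A) = \int[Pr]_(w in E) P (s i w) A)%E).

End markov.

Definition alpha {R : realType} (l : R) : R := (1 + l) / (1 - l).

(* Main.v *)
(* The squared Frobenius norm of A_1 ... A_n is a trace, and conditioning
   backwards along the chain turns its expectation into E tr H_1 with
   H_j = A_j (P H_(j+1)) A_j^T.  In the norm |E G|^2 + lambda E |G - E G|^2 each
   step costs at most a constant factor: bounding exp by its chord on [a_j, b_j]
   (through the spectral theorem) leaves a two-state problem, solved by
   Hoeffding's two-point inequality and the weighted AM-GM inequality.  Only the
   contraction of P on centred functions is used, so P need not be reversible.

   For the tail bound let v be a unit top eigenvector of S = sum_j F_j and put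
   q(z) = v prod_j exp(z theta/2 F_j) v^T exp(- tau p(z)) with p odd, p'(0) = 1 and
   tau = theta t / 2.  On the event lambda_max S >= t one has q(0) = 1 and
   q'(0) >= 0, while |q| <= 1 on the imaginary axis, hence the mean of |q|^2 over
   the right half circle, with weight cos(phi)/2, is at least 1.  Taking
   expectations, the factors at e^(i phi) are exp(cos(phi) theta/2 F_j) times a
   unitary matrix, so the first part applies for each phi, with complex d x d
   matrices written as real 2d x 2d blocks.  Choosing p, with a Cesaro
   mean, so that 2 Re p(e^(i phi)) approximates
   3/2 cos(phi) + 1/(4 cos(phi)) >= cos(phi)^2 + 3/4 gives d exp(- 3 tau / 4),
   and pi^2 <= 12. *)
From HB Require Import structures.
Require Import Defs.
From mathcomp Require Import ring lra complex measurable_realfun.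

Set Implicit Arguments.
Unset Strict Implicit.
Unset Printing Implicit Defensive.

Local Open Scope classical_set_scope.
Local Open Scope ring_scope.

(** * Scalar inequalities *)

Section scalar.
Context {R : realType}.
Implicit Types a b l p s : R.

(** A backward step is estimated by duality. With S = A (P G) A^T and R = E S + lambda (S - E S),
    the squared norm of S is E<R, S>. Since A = exp(F/4) U exp(F/4), the two outer exponentials of S
    can be moved onto R, which leaves the same kind of product on both sides. P shrinks variances by
    lambda^2 and R carries lambda in front of its fluctuation, so on either side the variance is at
    most lambda times the weighted variance in the norm. One lemma bounds both sides, and
    Cauchy-Schwarz joins them without an adjoint of P. In the tail bound, exponentials are replaced
    by powers (1 + H z^e / m)^m. These are polynomials in z, so a mean over the half circle is a
    finite sum of cosine moments, comparable with an integral along the imaginary axis; m tends to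
    infinity afterwards. The function 1 / cos is singular at the ends of the half circle, where no
    polynomial follows it; there the weight is small and a nonpositive exponent suffices. The
    condition c theta <= 4 t, with c = alpha sum_j (b_j - a_j)^2, keeps the moment exponent below
    tau cos^2. *)

Lemma derive_ge0_homo (f df : R -> R) a b : a <= b ->
  (forall x, a <= x <= b -> is_derive x 1 f (df x)) ->
  (forall x, a < x < b -> 0 <= df x) -> f a <= f b.
Proof.
move=> ab fd dge0.
have fd' x : x \in `]a, b[%R -> is_derive x 1 f (df x).
  by rewrite in_itv/= => /andP[/ltW ax /ltW xb]; apply: fd; rewrite ax.
have fc : {within `[a, b], continuous f}.
  apply: derivable_within_continuous => y; rewrite in_itv/= => yab.
  by have [] := fd y yab.
case: (ltgtP a b) ab => // [ab _|-> _]; last by rewrite lexx.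
have [x xab fE] := MVT ab fd' fc.
rewrite -subr_ge0 fE mulr_ge0 ?subr_ge0 ?(ltW ab)//; apply: dge0.
by move: xab; rewrite in_itv.
Qed.

Lemma two_point_pos p s : 0 <= p <= 1 -> 0 < 1 - p + p * expR s.
Proof.
move=> /andP[p0 p1]; have := expR_gt0 s; case: (ltgtP p 0) p0 => // [p0 _ e|-> _ _]; nra.
Qed.

Lemma is_derive_two_point p (x : R) :
  is_derive x 1 (fun x : R => 1 - p + p * expR x) (p * expR x).
Proof.
have -> : (fun x : R => 1 - p + p * expR x) = cst (1 - p) + p \*: expR by [].
by apply: is_derive_eq; rewrite add0r.
Qed.

(** The tilted weight q on the left satisfies q' = q (1 - q) <= 1/4 and q(0) = p. *)
Lemma two_point_logit_le p s : 0 <= p <= 1 -> 0 <= s ->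
  p * expR s / (1 - p + p * expR s) <= p + s / 4.
Proof.
move=> p01 s0.
pose D (x : R) := 1 - p + p * expR x.
have D0 x : D x != 0 by rewrite gt_eqF// two_point_pos.
have dD (x : R) : is_derive x 1 D (p * expR x) by exact: is_derive_two_point.
(* [g] is p + x/4 - q(x), with 1 - q written as (1 - p) / D so that a single inverse has to be
   differentiated. *)
pose g (x : R) := (1 - p) / D x + (4^-1 * x + p - 1).
have gE x : g x = p + x / 4 - p * expR x / D x.
  by rewrite /g; have := D0 x; rewrite /D => Dx; field.
suff : g 0 <= g s.
  by rewrite !gE /D expR0 !mul0r !mulr1 subrK divr1 !addr0 subrr subr_ge0.
pose q x := p * expR x / D x.
have dV (x : R) := is_deriveV (D0 x) (dD x).
have dg (x : R) : is_derive x 1 g (4^-1 - q x * (1 - q x)).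
  have -> : g = (1 - p) \*: (fun x => (D x)^-1) + (4^-1 \*: id + cst (p - 1)).
    by apply/funext => y; rewrite /g /= -[_ + p - 1]addrA.
  apply: (is_derive_eq (is_deriveD (is_deriveZ _ (dV x))
    (is_deriveD (is_deriveZ _ (is_derive_id x 1)) (is_derive_cst _ x 1)))).
  rewrite /GRing.scale/= mulr1 addr0 addrC /q; congr (_ + _).
  by have := D0 x; rewrite /D => Dx; field.
apply: (derive_ge0_homo s0 (fun x _ => dg x)) => x _.
by have := sqr_ge0 (2^-1 - q x); lra.
Qed.

(** Hoeffding's lemma for a two-point law: the logarithm of the left-hand side vanishes at 0, and
    its derivative is the tilted weight of [two_point_logit_le]. *)
Lemma hoeffding_two_point_half p s : 0 <= p <= 1 -> 0 <= s ->
  1 - p + p * expR s <= expR (p * s + s ^+ 2 / 8).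
Proof.
move=> p01 s0.
rewrite -[leLHS]lnK ?posrE ?two_point_pos// ler_expR -subr_ge0.
pose D (x : R) := 1 - p + p * expR x.
pose f (x : R) := p * x + x ^+ 2 / 8 - ln (D x).
suff : f 0 <= f s.
  by rewrite {1}/f /D expR0 mulr1 subrK ln1 mulr0 expr0n/= mul0r !addr0 subr0.
have df (x : R) : is_derive x 1 f (p + x / 4 - p * expR x / D x).
  have dl := is_derive1_ln (two_point_pos x p01).
  have dD : is_derive x 1 D (p * expR x) by exact: is_derive_two_point.
  have dlD : is_derive x 1 (@ln R \o D) ((D x)^-1 * (p * expR x)).
    exact: is_derive1_comp.
  have -> : f = p \*: id + (8^-1 \*: (id ^+ 2) - (@ln R \o D)).
    by apply/funext => y; rewrite /f !fctE/= addrA [_ / 8]mulrC.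
  apply: (is_derive_eq (is_deriveD (is_deriveZ _ (is_derive_id x 1))
    (is_deriveB (is_deriveZ _ (is_deriveX _ (is_derive_id x 1))) dlD))).
  by rewrite /GRing.scale/=; field; rewrite gt_eqF// two_point_pos.
apply: (derive_ge0_homo s0 (fun x _ => df x)) => x /andP[/ltW x0 _].
by rewrite subr_ge0 two_point_logit_le.
Qed.

Lemma hoeffding_two_point p a b : 0 <= p <= 1 -> a <= b ->
  (1 - p) * expR a + p * expR b <=
  expR ((1 - p) * a + p * b + (b - a) ^+ 2 / 8).
Proof.
move=> p01 ab; have := @hoeffding_two_point_half p (b - a) p01.
rewrite subr_ge0 => /(_ ab); rewrite -(ler_pM2l (expR_gt0 a)) -expRD.
rewrite mulrDr mulrCA -expRD (mulrC (expR a)) subrKC.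
by congr (_ <= expR _); ring.
Qed.

(** The tangent of exp at the weighted mean [m] lies below exp; summed with weights 1 and [l], the
    linear terms cancel. *)
Lemma weighted_amgm l x y : 0 <= l ->
  (1 + l) * expR ((x + l * y) / (1 + l)) <= expR x + l * expR y.
Proof.
move=> l0; set m := _ / _.
have tangent z : expR m * (1 + (z - m)) <= expR z.
  by rewrite -[z in leRHS](subrKC m) expRD ler_pM2l ?expR_gt0// expR_ge1Dx.
apply: le_trans (lerD (tangent x) (ler_wpM2l l0 (tangent y))).
have xE : x = m * (1 + l) - l * y by rewrite /m; field; rewrite gt_eqF// ltr_wpDr.
by rewrite xE le_eqVlt; apply/orP; left; apply/eqP; ring.
Qed.

(* Multiplied by [K = expR (alpha l * (b - a) ^+ 2 / 8)], this says that [K] is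
   at least the larger root of x^2 - (c0 + l c0') x + l e^(a + b), the
   characteristic polynomial of the exponentially tilted two-state kernel with
   second eigenvalue [l]. *)
Lemma leon_perron_root l a b : 0 <= l < 1 -> a <= 0 <= b -> a < b ->
  (b * expR a - a * expR b) / (b - a) + l * ((b * expR b - a * expR a) / (b - a))
    <= expR (alpha l * (b - a) ^+ 2 / 8) +
       l * (expR (a + b) / expR (alpha l * (b - a) ^+ 2 / 8)).
Proof.
move=> /andP[l0 l1] /andP[a0 b0] ab; set K := expR (alpha l * _ / _).
have s0 : b - a != 0 by rewrite subr_eq0 gt_eqF.
have s_gt0 : 0 < b - a by rewrite subr_gt0.
have l1n : 1 + l != 0 by rewrite gt_eqF// ltr_wpDr.
have l1n' : 1 - l != 0 by rewrite subr_eq0 gt_eqF.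
rewrite /K -expRB; apply: le_trans (weighted_amgm _ _ l0).
(* [p] is the weight for which the left-hand side is 1 + l times the two-point mean of exp at a and
   b. The mean of that law is l (a + b) / (1 + l), so Hoeffding's exponent agrees with the AM-GM
   exponent exactly when (1 - l) alpha = 1 + l. This is the origin of [alpha]. *)
pose p := (- a + l * b) / ((1 + l) * (b - a)).
have p01 : 0 <= p <= 1.
  apply/andP; split.
    by apply: divr_ge0; [nra|apply: mulr_ge0; lra].
  have den : 0 < (1 + l) * (b - a) by apply: mulr_gt0 => //; lra.
  rewrite /p ler_pdivrMr// mul1r; have := mulr_ge0_le0 l0 a0; lra.
have := hoeffding_two_point p01 (ltW ab).
rewrite -(ler_pM2l (_ : 0 < 1 + l)) ?ltr_wpDr//.
set x := expR a; set y := expR b.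
have -> : (1 + l) * ((1 - p) * x + p * y) = (b * x - a * y) / (b - a) + l * ((b * y - a * x) / (b - a)).
  by rewrite /p; field; apply/andP.
move=> /le_trans; apply; rewrite ler_pM2l ?ltr_wpDr//.
by rewrite le_eqVlt; apply/orP; left; apply/eqP; rewrite /p /alpha; congr expR; field; rewrite l1n s0 l1n'.
Qed.

(** The numerical core of half a backward step: U = |u|^2, y = E|w|^2, V = |v|^2 and z = <u, v> for
    v the mean of [symmul F w], while the number [w] is E<w, symmul F w>. AM-GM with weight k = K -
    c0 absorbs z, the bound V <= - a b y removes V, and what remains for y is the Perron root
    inequality. *)
Lemma leon_perron_scalar (l a b U V y z w Y : R) : 0 <= l < 1 -> a < 0 < b ->
  let K := expR (alpha l * (b - a) ^+ 2 / 8) in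
  let c0 := (b * expR a - a * expR b) / (b - a) in
  let c1 := (expR b - expR a) / (b - a) in
  0 <= U -> 0 <= V -> 0 <= y -> 0 <= Y -> y <= l * Y ->
  z ^+ 2 <= U * V -> V <= - (a * b) * y -> b * w <= b ^+ 2 * y - V ->
  K < expR b ->
  c0 * (U + y) + c1 * (2 * z + w) <= K * (U + Y).
Proof.
move=> l01 /andP[a0 b0] K c0 c1 U0 V0 y0 Y0 yY zUV Vy wy Kb.
have ab : a < b by exact: lt_trans b0.
have s0 : 0 < b - a by rewrite subr_gt0.
have [l0 l1] := andP l01.
have alpha_ge1 : 1 <= alpha l by rewrite /alpha ler_pdivlMr ?subr_gt0// mul1r lerD2l; lra.
have c0_le : c0 <= expR ((b - a) ^+ 2 / 8).
  have p01 : 0 <= - a / (b - a) <= 1.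
    rewrite divr_ge0 ?oppr_ge0 ?(ltW s0) ?(ltW a0)//= ler_pdivrMr// mul1r; lra.
  have := hoeffding_two_point p01 (ltW ab); rewrite /c0.
  set x := expR a; set u := expR b.
  have -> : (1 - - a / (b - a)) * x + - a / (b - a) * u = (b * x - a * u) / (b - a).
    by field; rewrite gt_eqF.
  have -> // : (1 - - a / (b - a)) * a + - a / (b - a) * b + (b - a) ^+ 2 / 8 = (b - a) ^+ 2 / 8.
    by field; rewrite gt_eqF.
have q0 : 0 < (b - a) ^+ 2 / 8 by rewrite divr_gt0 ?exprn_gt0.
have c0K : c0 <= K.
  apply: le_trans c0_le _; rewrite ler_expR ler_pM2r ?invr_gt0// ler_peMl//.
  by rewrite exprn_ge0 ?ltW.
have c1_gt0 : 0 < c1 by rewrite divr_gt0// subr_gt0 ltr_expR.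
have c0_ge0 : 0 <= c0.
  by rewrite divr_ge0 ?(ltW s0)// subr_ge0 (le_trans (y:=0))// ?mulr_ge0 ?expR_ge0 ?(ltW b0)// mulr_le0_ge0 ?expR_ge0 ?ltW.
have K0 : 0 < K by exact: expR_gt0.
have w_le : w <= b * y - V / b.
  by rewrite -(ler_pM2l b0) (le_trans wy)//; rewrite le_eqVlt; apply/orP; left; apply/eqP; field; rewrite gt_eqF.
have c01b : c0 + c1 * b = expR b by rewrite /c0 /c1; field; rewrite gt_eqF.
(* The strict inequality c0 < K is drawn from alpha > 1, that is from l > 0. For l = 0 the numbers
   y, V and z vanish and w <= 0, so that c0 <= K is enough. *)
have [l_eq0|l_neq0] := eqVneq l 0.
  have y_eq0 : y = 0 by apply/eqP; rewrite eq_le y0 andbT (le_trans yY)// l_eq0 mul0r.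
  have V_eq0 : V = 0 by apply/eqP; rewrite eq_le V0 andbT (le_trans Vy)// y_eq0 mulr0.
  have z_eq0 : z = 0.
    by apply/eqP; rewrite -sqrf_eq0 eq_le sqr_ge0 andbT (le_trans zUV)// V_eq0 mulr0.
  have w_le0 : w <= 0 by rewrite (le_trans w_le)// y_eq0 V_eq0 mulr0 mul0r subr0.
  rewrite y_eq0 z_eq0 mulr0 add0r addr0; nra.
have l_gt0 : 0 < l by rewrite lt_def l_neq0.
have c0_lt : c0 < K.
  apply: le_lt_trans c0_le _; rewrite ltr_expR ltr_pM2r ?invr_gt0//.
  rewrite ltr_pMl ?exprn_gt0// /alpha ltr_pdivlMr ?subr_gt0// mul1r; lra.
set k := K - c0; have k_gt0 : 0 < k by rewrite subr_gt0.
(* This is K < exp b, since c0 + c1 b = exp b. It makes the coefficient of V in [coefV] nonnegative,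
   so that V may be replaced by its upper bound. *)
have k_le : k <= c1 * b by rewrite /k; lra.
pose c0' := (b * expR b - a * expR a) / (b - a).
have c0'E : c0' = c0 + c1 * (a + b) by rewrite /c0' /c0 /c1; field; rewrite gt_eqF.
have detE : c0 * c0' + c1 ^+ 2 * (a * b) = expR (a + b).
  rewrite expRD /c0' /c0 /c1; field; rewrite gt_eqF//.
(* The characteristic polynomial of [leon_perron_root], evaluated at K and factored with the help of
   the determinant [detE]. *)
have root : l * (c1 ^+ 2 * - (a * b)) <= k * (K - l * c0').
  have := leon_perron_root l01 (_ : a <= 0 <= b) ab.
  rewrite (ltW a0) (ltW b0) => /(_ isT) /=; rewrite -/K -/c0 -/c0'.
  rewrite -(ler_pM2r K0).
  have -> : (K + l * (expR (a + b) / K)) * K = K ^+ 2 + l * expR (a + b).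
    by field; rewrite gt_eqF.
  have := congr1 ( *%R l) detE; rewrite /k; lra.
have zk : 2 * c1 * z <= k * U + c1 ^+ 2 * V / k.
  rewrite -subr_ge0 -(pmulr_rge0 _ k_gt0).
  have -> : k * (k * U + c1 ^+ 2 * V / k - 2 * c1 * z) =
            k ^+ 2 * U + c1 ^+ 2 * V - k * (2 * c1 * z) by field; rewrite gt_eqF.
  rewrite subr_ge0.
  have h : (k * (2 * c1 * z)) ^+ 2 <= (k ^+ 2 * U + c1 ^+ 2 * V) ^+ 2.
    apply: (@le_trans _ _ (4 * (k ^+ 2 * U) * (c1 ^+ 2 * V))).
      have -> : (k * (2 * c1 * z)) ^+ 2 = 4 * (k ^+ 2) * c1 ^+ 2 * z ^+ 2 by ring.
      have -> : 4 * (k ^+ 2 * U) * (c1 ^+ 2 * V) = 4 * (k ^+ 2) * c1 ^+ 2 * (U * V) by ring.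
      rewrite ler_wpM2l//; apply: mulr_ge0; last exact: sqr_ge0.
      by rewrite mulr_ge0// sqr_ge0.
    by have := sqr_ge0 (k ^+ 2 * U - c1 ^+ 2 * V); lra.
  have s_ge0 : 0 <= k ^+ 2 * U + c1 ^+ 2 * V.
    by apply: addr_ge0; apply: mulr_ge0 => //; exact: sqr_ge0.
  rewrite (le_trans (ler_norm _))// -(ger0_norm s_ge0).
  by rewrite -ler_sqr ?nnegrE// !real_normK ?num_real.
have cw : c1 * w <= c1 * (b * y - V / b) by rewrite ler_pM2l.
have coefV : 0 <= c1 ^+ 2 / k - c1 / b.
  rewrite subr_ge0 ler_pdivrMr// mulrAC ler_pdivlMr//.
  by have := ler_wpM2l (ltW c1_gt0) k_le; lra.
have Vcoef : (c1 ^+ 2 / k - c1 / b) * V <= (c1 ^+ 2 / k - c1 / b) * (- (a * b) * y).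
  by rewrite ler_wpM2l.
have main : (c0' + c1 ^+ 2 * - (a * b) / k) * y <= K * Y.
  have pos : 0 <= c0' + c1 ^+ 2 * - (a * b) / k.
    apply: addr_ge0.
      rewrite /c0' divr_ge0 ?(ltW s0)// subr_ge0 (@le_trans _ _ 0)// ?mulr_ge0 ?expR_ge0 ?(ltW b0)//.
      by rewrite mulr_le0_ge0 ?expR_ge0 ?ltW.
    by rewrite divr_ge0 ?(ltW k_gt0)// mulr_ge0 ?sqr_ge0// oppr_ge0 mulr_le0_ge0 ?ltW.
  apply: le_trans (ler_wpM2l pos yY) _; rewrite mulrA ler_wpM2r//.
  rewrite -(ler_pM2l k_gt0).
  have -> : k * ((c0' + c1 ^+ 2 * - (a * b) / k) * l) =
            l * (c1 ^+ 2 * - (a * b)) + k * (l * c0') by field; rewrite gt_eqF.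
  by move: root; rewrite mulrBr; lra.
have e1 : c1 * (b * y - V / b) + c1 ^+ 2 * V / k = c1 * b * y + (c1 ^+ 2 / k - c1 / b) * V.
  by field; rewrite !gt_eqF.
have e2 : c0 * y + (c1 * b * y + (c1 ^+ 2 / k - c1 / b) * (- (a * b) * y)) =
    (c0' + c1 ^+ 2 * - (a * b) / k) * y.
  by rewrite c0'E; field; rewrite !gt_eqF.
have -> : K * (U + Y) = c0 * U + k * U + K * Y by rewrite /k; ring.
lra.
Qed.

(** * Taylor bounds for sine and cosine, and an upper bound for pi *)

Lemma sin_le_id (x : R) : 0 <= x -> sin x <= x.
Proof.
move=> x0; have dF (y : R) : is_derive y 1 (id - @sin R) (1 - cos y).
  exact: is_derive_eq.
have := derive_ge0_homo x0 (fun y _ => dF y).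
rewrite !fctE sin0 subr0 subr_ge0; apply=> y _.
by rewrite subr_ge0 cos_le1.
Qed.

Lemma cos_ge_taylor2 (x : R) : 0 <= x -> 1 - x ^+ 2 / 2 <= cos x.
Proof.
move=> x0; pose F : R -> R := @cos R + 2^-1 \*: (id ^+ 2).
have dF (y : R) : is_derive y 1 F (y - sin y).
  apply: is_derive_eq; rewrite /GRing.scale/= expr1; lra.
have := derive_ge0_homo x0 (fun y _ => dF y).
have FE y : F y = cos y + 2^-1 * y ^+ 2 by [].
rewrite !FE cos0 expr0n/= mulr0 addr0.
suff h : forall y, 0 < y < x -> 0 <= y - sin y by move/(_ h); lra.
by move=> y /andP[/ltW y0 _]; rewrite subr_ge0 sin_le_id.
Qed.

Lemma sin_ge_taylor3 (x : R) : 0 <= x -> x - x ^+ 3 / 6 <= sin x.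
Proof.
move=> x0; pose F : R -> R := @sin R - id + 6^-1 \*: (id ^+ 3).
have dF (y : R) : is_derive y 1 F (cos y - (1 - y ^+ 2 / 2)).
  apply: is_derive_eq; rewrite /GRing.scale/=; lra.
have := derive_ge0_homo x0 (fun y _ => dF y).
have FE y : F y = sin y - y + 6^-1 * y ^+ 3 by [].
rewrite !FE sin0 expr0n/= mulr0 subr0 addr0.
suff h : forall y, 0 < y < x -> 0 <= cos y - (1 - y ^+ 2 / 2) by move/(_ h); lra.
by move=> y /andP[/ltW y0 _]; rewrite subr_ge0 cos_ge_taylor2.
Qed.

Lemma cos_le_taylor4 (x : R) : 0 <= x ->
  cos x <= 1 - x ^+ 2 / 2 + x ^+ 4 / 24.
Proof.
move=> x0; pose F : R -> R := 24^-1 \*: (id ^+ 4) - 2^-1 \*: (id ^+ 2) - @cos R.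
have dF (y : R) : is_derive y 1 F (sin y - (y - y ^+ 3 / 6)).
  apply: is_derive_eq; rewrite /GRing.scale/= expr1; lra.
have := derive_ge0_homo x0 (fun y _ => dF y).
have FE y : F y = 24^-1 * y ^+ 4 - 2^-1 * y ^+ 2 - cos y by [].
rewrite !FE cos0 !expr0n/= !mulr0.
suff h : forall y, 0 < y < x -> 0 <= sin y - (y - y ^+ 3 / 6) by move/(_ h); lra.
by move=> y /andP[/ltW y0 _]; rewrite subr_ge0 sin_ge_taylor3.
Qed.

(** cos (sqrt 3) <= 1 - 3/2 + 9/24 < 0, whereas cos is positive on [0, pi/2). *)
Lemma pi_sqr_le12 : (@pi R) ^+ 2 <= 12.
Proof.
rewrite leNgt; apply/negP => h.
pose r : R := Num.sqrt 3.
have r2 : r ^+ 2 = 3 by rewrite sqr_sqrtr.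
have r0 : 0 <= r by exact: sqrtr_ge0.
have rpi : r < pi / 2.
  by rewrite -ltr_sqr ?nnegrE ?divr_ge0 ?pi_ge0// r2 expr_div_n; lra.
have : 0 < cos r.
  by apply: cos_gt0_pihalf; rewrite rpi andbT; have := @pi_gt0 R; lra.
have := cos_le_taylor4 r0; rewrite (_ : r ^+ 4 = 9) ?r2; first lra.
by rewrite -[4%N]/(2 * 2)%N exprM r2; ring.
Qed.

(** * Cesaro means for the reciprocal of the cosine *)

Lemma cosM2 (x y : R) : 2 * cos x * cos y = cos (y + x) + cos (y - x).
Proof. by rewrite cosD cosB; ring. Qed.

(** Formally 1 / (2 cos phi) = sum_k (-1)^k cos ((2k+1) phi). The partial sums oscillate; their
    averages, taken here, converge at rate 1/N wherever cos phi > 0. *)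
Definition cesaro_cos (N : nat) (phi : R) : R :=
  \sum_(k < N) (-1) ^+ k * (1 - k%:R / N%:R) * cos (k.*2.+1%:R * phi).

(** Multiplication by 2 cos phi makes the alternating sum telescope. *)
Lemma sum_alt_cos_odd n (phi : R) :
  2 * cos phi * \sum_(k < n) (-1) ^+ k * cos (k.*2.+1%:R * phi) =
  1 - (-1) ^+ n * cos (n.*2%:R * phi).
Proof.
elim: n => [|n IH]; first by rewrite big_ord0 mulr0 expr0 mul1r mul0r cos0 subrr.
rewrite big_ord_recr/= mulrDr IH mulrCA cosM2.
have -> : n.*2.+1%:R * phi + phi = n.+1.*2%:R * phi.
  by rewrite doubleS -[in RHS]natr1; ring.
have -> : n.*2.+1%:R * phi - phi = n.*2%:R * phi.
  by rewrite -natr1; ring.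
by rewrite exprS; ring.
Qed.

Lemma sum_alt_cos_even n (phi : R) :
  2 * cos phi * \sum_(k < n) (-1) ^+ k.+1 * cos (k.+1.*2%:R * phi) =
  (-1) ^+ n * cos (n.*2.+1%:R * phi) - cos phi.
Proof.
elim: n => [|n IH]; first by rewrite big_ord0 mulr0 expr0 !mul1r subrr.
rewrite big_ord_recr/= mulrDr IH mulrCA cosM2.
have -> : n.+1.*2%:R * phi + phi = n.+1.*2.+1%:R * phi.
  by rewrite -[in RHS]natr1; ring.
have -> : n.+1.*2%:R * phi - phi = n.*2.+1%:R * phi.
  by rewrite doubleS -natr1; ring.
by rewrite exprS; ring.
Qed.

(** N (1 - k/N) = N - k is the number of partial sums that contain the term k. *)
Lemma cesaro_cosE N (phi : R) : (0 < N)%N ->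
  N%:R * cesaro_cos N phi =
  \sum_(n < N) \sum_(k < n.+1) (-1) ^+ k * cos (k.*2.+1%:R * phi).
Proof.
move=> N0; have N0' : N%:R != 0 :> R by rewrite pnatr_eq0 -lt0n.
transitivity (\sum_(k < N) (N - k)%:R * ((-1) ^+ k * cos (k.*2.+1%:R * phi))).
  rewrite /cesaro_cos mulr_sumr; apply: eq_bigr => k _.
  by rewrite natrB ?(ltnW (ltn_ord k))//; field.
elim: N {N0 N0'} => [|N IH]; first by rewrite !big_ord0.
rewrite [RHS]big_ord_recr/= -IH [in RHS]big_ord_recr/= [LHS]big_ord_recr/=.
rewrite subSnn mul1r addrA -big_split/=; congr (_ + _); apply: eq_bigr => k _.
by rewrite subSn ?(ltnW (ltn_ord k))// -natr1; ring.
Qed.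

(** With x = cos phi, the bound 0 uses only C >= 0 and x^2 <= 3/2 x; the other one uses C >= 1/(2x)
    - 1/(2 N x^2) and explodes as x tends to 0, whence the minimum. *)
Lemma cesaro_cos_weight N (phi : R) : (0 < N)%N -> 0 < cos phi ->
  cos phi ^+ 2 - 2 * (3 / 4 * cos phi + 4^-1 * cesaro_cos N phi) <=
  Num.min 0 (- (3 / 4) + (4 * N%:R * cos phi ^+ 2)^-1).
Proof.
move=> N0; set x := cos phi => x0; set C := cesaro_cos N phi.
have x1 : x <= 1 by exact: cos_le1.
have NR : 0 < N%:R :> R by rewrite ltr0n.
have E : 2 * x * (N%:R * C) = \sum_(n < N) (1 - (-1) ^+ n.+1 * cos (n.+1.*2%:R * phi)).
  by rewrite cesaro_cosE// mulr_sumr; apply: eq_bigr => n _; rewrite sum_alt_cos_odd.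
have C0 : 0 <= C.
  have : 0 <= 2 * x * (N%:R * C).
    rewrite E; apply: sumr_ge0 => n _; rewrite subr_ge0 (le_trans (ler_norm _))//.
    by rewrite normrM normrX normrN1 expr1n mul1r cos_max.
  by rewrite pmulr_rge0 ?mulr_gt0// pmulr_rge0.
have Clow : 1 / (2 * x) - (2 * N%:R * x ^+ 2)^-1 <= C.
  set S := \sum_(n < N) (-1) ^+ n.+1 * cos (n.+1.*2%:R * phi).
  have ES : 2 * x * (N%:R * C) = N%:R - S.
    by rewrite E sumrB sumr_const card_ord.
  have S1 : 2 * x * S <= 2.
    rewrite sum_alt_cos_even; set c := cos (_ * phi).
    have : (-1) ^+ N * c <= 1.
      rewrite (le_trans (ler_norm _))// normrM normrX normrN1 expr1n mul1r.
      exact: cos_max.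
    by rewrite -/x; lra.
  have -> : C = (2 * x * (2 * x * (N%:R * C))) / (4 * N%:R * x ^+ 2).
    by field; rewrite !gt_eqF.
  rewrite ES ler_pdivlMr ?mulr_gt0 ?exprn_gt0//.
  have -> : (1 / (2 * x) - (2 * N%:R * x ^+ 2)^-1) * (4 * N%:R * x ^+ 2) =
     2 * N%:R * x - 2 by field; rewrite !gt_eqF.
  lra.
rewrite le_min; apply/andP; split; first by nra.
(* The difference factors as (1 - x) (4 x^2 - 2 x + 1) / (4 x). It vanishes at x = 1, so 3/4 is the
   best constant here. *)
have cub : x ^+ 2 - 3 / 2 * x - 1 / (4 * x) <= - (3 / 4).
  rewrite -subr_ge0.
  have -> : - (3 / 4) - (x ^+ 2 - 3 / 2 * x - 1 / (4 * x)) =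
    (1 - x) * ((2 * x - 2^-1) ^+ 2 + 3 / 4) / (4 * x) by field; rewrite gt_eqF.
  rewrite divr_ge0 ?mulr_ge0 ?subr_ge0 ?addr_ge0 ?sqr_ge0// ?ltW//.
have e1 : 1 / (4 * x) = 2^-1 * (1 / (2 * x)) by field; rewrite gt_eqF.
have e2 : (4 * N%:R * x ^+ 2)^-1 = 2^-1 * (2 * N%:R * x ^+ 2)^-1.
  by field; rewrite !gt_eqF.
move: cub Clow; rewrite e1 e2; lra.
Qed.

Lemma sin_cos_natpihalf k :
  [/\ sin (k.+2%:R * (pi / 2)) = - sin (k%:R * (pi / 2)) :> R &
      cos (k.+2%:R * (pi / 2)) = - cos (k%:R * (pi / 2)) :> R].
Proof.
have -> : k.+2%:R * (pi / 2) = k%:R * (pi / 2) + pi :> R.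
  by rewrite -addn2 natrD; field.
by rewrite sinDpi cosDpi.
Qed.

(* [c] are the coefficients of a polynomial [q]; the hypothesis bounds
   [Re q (i y)] and the conclusion integrates it against [1/y^2 - 1]. *)
Lemma half_disc_moment_ge (n : nat) (c : nat -> R) (e : R) :
  (forall y : R, 0 <= y <= 1 ->
    \sum_(k < n) c k.+2 * cos (k.+2%:R * (pi / 2)) * y ^+ k.+2 <= e * y ^+ 2) ->
  - (e / 3) <=
  \sum_(k < n) c k.+2 * (cos (k.+2%:R * (pi / 2)) / (1 - k.+2%:R ^+ 2)).
Proof.
move=> H.
pose b k := c k.+2 * cos (k.+2%:R * (pi / 2)).
pose f (k : 'I_n) : R -> R :=
  (b k / k.+1%:R) \*: (id ^+ k.+1) - (b k / k.+3%:R) \*: (id ^+ k.+3).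
(* A primitive of (1 - y^2) (e - sum_k b_k y^k): its monotonicity on [0, 1] replaces an integration.
   The value of [f k] at 1 is b_k (1/(k+1) - 1/(k+3)), the wanted moment up to the factor -2. *)
pose F : R -> R := e \*: (id - 3^-1 \*: (id ^+ 3)) - \sum_k f k.
have df k (y : R) : is_derive y 1 (f k) (b k * y ^+ k - b k * y ^+ k.+2).
  apply: is_derive_eq; rewrite /GRing.scale/= !mulr1 !mulrA !divfK ?pnatr_eq0//.
have dF (y : R) : is_derive y 1 F
    ((1 - y ^+ 2) * (e - \sum_(k < n) b k * y ^+ k)).
  apply: (is_derive_eq (is_deriveB (is_deriveZ e (is_deriveB (is_derive_id y 1)
    (is_deriveZ _ (is_deriveX 3 (is_derive_id y 1))))) (is_derive_sum (fun k => df k y)))).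
  rewrite sumrB /GRing.scale/= [RHS]mulrBr [(1 - _) * \sum_(k < n) _]mulrBl mul1r mulr_sumr.
  have -> : \sum_(k < n) b k * y ^+ k.+2 = \sum_(k < n) y ^+ 2 * (b k * y ^+ k).
    by apply: eq_bigr => k _; rewrite -addn2 exprD; ring.
  by congr (_ - _); field.
have := derive_ge0_homo (@ler01 R) (fun y _ => dF y).
have FE y : F y = e * (y - 3^-1 * y ^+ 3) -
    \sum_(k < n) (b k / k.+1%:R * y ^+ k.+1 - b k / k.+3%:R * y ^+ k.+3).
  rewrite /F -[(_ - \sum_k f k) y]/(_ - (\sum_k f k) y) fct_sumE.
  congr (_ - _); apply: eq_bigr => k _.
  by rewrite /f -[LHS]/(_ * (id ^+ k.+1) y - _ * (id ^+ k.+3) y) !exprfctE.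
rewrite !FE [X in _ - X <= _]big1 => [|k _]; last by rewrite !expr0n/= !mulr0 subrr.
rewrite !expr0n/= !expr1n !mulr1 mulr0 subrr mulr0 subr0.
rewrite (eq_bigr (fun k : 'I_n => 2 * (- (c k.+2 * (cos (k.+2%:R * (pi / 2)) / (1 - k.+2%:R ^+ 2)))))); last first.
  move=> k _; rewrite !expr1n !mulr1 /b; set z := cos _.
  have r0 : 0 <= k%:R :> R by [].
  have -> : 1 - k.+2%:R ^+ 2 = - (k.+1%:R * k.+3%:R) :> R.
    by rewrite -[k.+3]addn3 -[k.+2]addn2 -[k.+1]addn1 !natrD; ring.
  rewrite -[k.+3]addn3 -[k.+1]addn1 !natrD; field.
  by rewrite !gt_eqF//=; lra.
rewrite -mulr_sumr sumrN => h.
suff /h : forall y : R, 0 < y < 1 -> 0 <= (1 - y ^+ 2) * (e - \sum_(k < n) b k * y ^+ k) by lra.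
move=> y /andP[y0 y1]; apply: mulr_ge0.
  by rewrite subr_ge0 expr_le1 ?ltW.
rewrite subr_ge0 -(ler_pM2r (_ : 0 < y ^+ 2)) ?exprn_gt0// mulr_suml.
apply: le_trans (H y _); last by rewrite !ltW.
rewrite le_eqVlt; apply/orP; left; apply/eqP; apply: eq_bigr => k _.
by rewrite /b -addn2 exprD; ring.
Qed.



(** For k >= 2 these are the numbers that [half_disc_moment_ge] obtains from the imaginary axis.
    Their agreement is Cauchy's theorem on the half disc, one monomial at a time. *)
Lemma integral_cos_cos (k : nat) :
  (\int[lebesgue_measure]_(x in `[(- (pi / 2))%R, (pi / 2)%R])
     (cos (k%:R * x) * (cos x / 2))%:E)%E =
  ((if k == 1%N then pi / 4
   else cos (k%:R * (pi / 2)) / (1 - k%:R ^+ 2) : R)%:E).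
Proof.
have pi0 := @pi_gt0 R.
have ab : - (pi / 2) < pi / 2 :> R by lra.
have dk (r x : R) : is_derive x 1 (fun y : R => r * y) r.
  apply: (is_derive_eq (is_deriveZ r (is_derive_id x 1))).
  by rewrite /GRing.scale/= mulr1.
have dsin (r x : R) : is_derive x 1 (fun y : R => sin (r * y)) (r * cos (r * x)).
  rewrite mulrC; apply: is_derive1_comp.
have dcos (r x : R) : is_derive x 1 (fun y : R => cos (r * y)) (- (r * sin (r * x))).
  rewrite mulrC -mulNr; apply: is_derive1_comp.
pose f (x : R) := cos (k%:R * x) * (cos x / 2).
have fc : continuous f.
  move=> x; apply: cvgM; last by apply: cvgM; [exact: continuous_cos|exact: cvg_cst].
  apply: differentiable_continuous; apply/derivable1_diffP; have [] := dcos k%:R x; by [].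
suff [F [dF <-]] : exists F : R -> R, (forall x : R, is_derive x 1 F (f x)) /\
   F (pi / 2) - F (- (pi / 2)) = if k == 1%N then pi / 4
   else cos (k%:R * (pi / 2)) / (1 - k%:R ^+ 2).
  rewrite EFinB; apply: continuous_FTC2 => //.
  - exact: continuous_subspaceT.
  - have Fc x : {for x, continuous F}.
      by apply: differentiable_continuous; apply/derivable1_diffP; have [] := dF x.
    split => [x _||]; first by have [] := dF x.
      exact/cvg_at_right_filter/Fc.
    exact/cvg_at_left_filter/Fc.
  - by move=> x _; rewrite derive1E; have [] := dF x.
case: eqVneq => k1.
  exists (4^-1 \*: (id + @sin R * @cos R)); split=> [x|].
    apply: (is_derive_eq (is_deriveZ _ (is_deriveD (is_derive_id x 1)
      (is_deriveM (is_derive_sin x) (is_derive_cos x))))).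
    rewrite /f k1 /GRing.scale/= mul1r.
    by have := cos2Dsin2 x; lra.
  by rewrite /= /GRing.scale/= !fctE cosN cos_pihalf !mulr0 !addr0; lra.
have k1' : 1 - k%:R ^+ 2 != 0 :> R.
  rewrite subr_eq0 eq_sym sqrf_eq1 pnatr_eq1 (negbTE k1)/=.
  by rewrite gt_eqF// (lt_le_trans (_ : _ < 0)) ?ltrN10.
exists ((2 * (1 - k%:R ^+ 2))^-1 \*: ((fun x : R => cos (k%:R * x)) * @sin R - k%:R \*: ((fun x : R => sin (k%:R * x)) * @cos R))).
split=> [x|].
  apply: (is_derive_eq (is_deriveZ _ (is_deriveB
    (is_deriveM (dcos k%:R x) (is_derive_sin x))
    (is_deriveZ _ (is_deriveM (dsin k%:R x) (is_derive_cos x)))))).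
  by rewrite /f /GRing.scale/=; field.
pose Z (x : R) := (2 * (1 - k%:R ^+ 2))^-1 *
  (cos (k%:R * x) * sin x - k%:R * (sin (k%:R * x) * cos x)).
rewrite -[LHS]/(Z (pi / 2) - Z (- (pi / 2))) /Z.
rewrite mulrN !cosN !sinN cos_pihalf sin_pihalf !mulr0 !subr0.
by field.
Qed.

End scalar.

(** * Symmetric matrices and the matrix exponential *)

Section spectral_theorem.
Context {R : realType}.

Lemma symmetricmx_trmx n (A : 'M[R]_n) : (A \is symmetricmx) = (A^T == A).
Proof.
by apply/is_hermitianmxP/eqP; rewrite expr0 scale1r map_mx_id// => ->.
Qed.

(** Over [R[i]] the matrix is Hermitian and its spectral diagonal is real; a real root of the
    characteristic polynomial descends to [R]. *)
Lemma symmetric_eigenvalue n (A : 'M[R]_n.+1) :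
  A \is symmetricmx -> exists a, eigenvalue A a.
Proof.
rewrite symmetricmx_trmx => /eqP sA.
pose f : {rmorphism R -> R[i]} := real_complex R.
pose B := map_mx f A.
have Breal : B \is a realmx.
  by apply/mxOverP => i j; rewrite mxE; apply/complex_realP; exists (A i j).
have Bherm : B \is hermsymmx.
  apply: realsym_hermsym => //; apply/is_hermitianmxP.
  rewrite expr0 scale1r map_mx_id//.
  by apply/matrixP => i j; rewrite !mxE -[in LHS]sA mxE.
have /mxOverP/(_ 0 0)/complex_realP[a aE] := hermitian_spectral_diag_real Bherm.
exists a; rewrite eigenvalue_root_char -(fmorph_root f) map_char_poly -/B.
rewrite -eigenvalue_root_char.
have Bnorm := hermitian_normalmx Bherm.
have /orthomx_spectralP BE := Bnorm.
apply/eigenvalueP; exists (row 0 (spectralmx B)).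
  rewrite {2}BE -row_mul !mulmxA mulmxV ?spectral_unit// mul1mx row_mul.
  by rewrite row_diag_mx -scalemxAl -rowE aE.
apply/negP => /eqP r0.
have /(congr1 (row 0)) := mulmxV (spectral_unit B).
rewrite row_mul r0 mul0mx => /rowP/(_ 0); rewrite !mxE eqxx => /eqP.
by rewrite eq_sym oner_eq0.
Qed.

(** The reflection along w = v - e, with e the first basis vector, exchanges v and e, so its row 0
    is [v]. For v = e there is no such reflection and the identity serves. *)
Lemma householder n (v : 'rV[R]_n.+1) : v *m v^T = 1%:M ->
  exists H : 'M[R]_n.+1, H *m H^T = 1%:M /\ row 0 H = v.
Proof.
move=> v1; pose e : 'rV[R]_n.+1 := delta_mx 0 0.
have ee : e *m e^T = 1%:M.
  by rewrite trmx_delta mul_delta_mx; apply/matrixP => i j; rewrite !ord1 !mxE.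
have ev : e *m v^T = (v 0 0)%:M.
  by rewrite -rowE; apply/matrixP => i j; rewrite !ord1 !mxE.
have ve : v *m e^T = (v 0 0)%:M.
  by rewrite -[LHS]trmxK trmx_mul trmxK ev tr_scalar_mx.
have [v0|v0] := eqVneq (v 0 0) 1.
  exists 1%:M; split; first by rewrite trmx1 mulmx1.
  have vme : (v - e) *m (v - e)^T = 0.
    by rewrite linearB/= mulmxBl !mulmxBr v1 ee ev ve v0 !subrr.
  suff : v - e = 0 by move/eqP; rewrite subr_eq0 => /eqP ->; rewrite rowE mulmx1.
  apply/rowP => j; rewrite [RHS]mxE; apply/eqP; rewrite -sqrf_eq0.
  have /matrixP/(_ 0 0) := vme; rewrite !mxE => /eqP.
  rewrite psumr_eq0; last by move=> i _; rewrite !mxE -expr2 sqr_ge0.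
  by move/allP => /(_ j); rewrite mem_index_enum => /(_ isT); rewrite !mxE -expr2.
(* [c] equals 2 / |w|^2, because |w|^2 = 2 (1 - v 0 0). *)
pose w := v - e; pose c := (1 - v 0 0)^-1.
have c0 : 1 - v 0 0 != 0 by rewrite subr_eq0 eq_sym.
have ww : w *m w^T = (2 * (1 - v 0 0))%:M.
  rewrite /w linearB/= mulmxBl !mulmxBr v1 ee ev ve -!raddfB/=.
  by congr (_%:M); ring.
have ew : e *m w^T = (v 0 0 - 1)%:M by rewrite /w linearB/= mulmxBr ev ee -raddfB.
have vE : v = w + e by rewrite /w subrK.
clearbody w; exists (1%:M - c *: (w^T *m w)); split.
  have -> : (1%:M - c *: (w^T *m w))^T = 1%:M - c *: (w^T *m w).
    by rewrite raddfB/= tr_scalar_mx linearZ/= trmx_mul trmxK.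
  rewrite mulmxBl !mulmxBr !mul1mx mulmx1 -scalemxAl -scalemxAr scalerA.
  rewrite -mulmxA (mulmxA w) ww mul_scalar_mx -scalemxAr scalerA.
  rewrite -scalerBl -addrA -opprD -scalerDl.
  by rewrite (_ : c + _ = 0) ?scale0r ?subr0// /c; field.
rewrite rowE mulmxBr mulmx1 -scalemxAr mulmxA -/e ew mul_scalar_mx scalerA.
have -> : c * (v 0 0 - 1) = -1 by rewrite /c; field.
by rewrite scaleN1r opprK vE addrC.
Qed.

(** Deflation: a Householder matrix whose row 0 is a unit eigenvector conjugates [A] to a matrix
    whose row 0 is a e, and symmetry clears column 0 as well. *)
Theorem real_spectral n (A : 'M[R]_n) : A \is symmetricmx ->
  exists (O : 'M[R]_n) (d : 'rV[R]_n),
    O *m O^T = 1%:M /\ A = O^T *m diag_mx d *m O.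
Proof.
elim: n A => [|n IH] A sA.
  by exists 1%:M, 0; split; apply/matrixP => - [].
have [a /eigenvalueP[u uA u0]] := symmetric_eigenvalue sA.
move: sA; rewrite symmetricmx_trmx => /eqP sA.
have uu : 0 < (u *m u^T) 0 0.
  rewrite lt_def; apply/andP; split; last first.
    by rewrite mxE sumr_ge0// => i _; rewrite mxE -expr2 sqr_ge0.
  apply: contra u0; rewrite mxE psumr_eq0; last by move=> i _; rewrite mxE -expr2 sqr_ge0.
  move/allP => h; apply/eqP/rowP => j; rewrite [RHS]mxE; apply/eqP.
  by have := h j; rewrite mem_index_enum => /(_ isT); rewrite mxE -expr2 sqrf_eq0.
pose v := (Num.sqrt ((u *m u^T) 0 0))^-1 *: u.
have vv : v *m v^T = 1%:M.
  rewrite /v linearZ/= -scalemxAl -scalemxAr scalerA.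
  rewrite -expr2 exprVn sqr_sqrtr ?(ltW uu)//; set r := (u *m u^T) 0 0.
  have -> : u *m u^T = r%:M by exact: mx11_scalar.
  by rewrite scale_scalar_mx mulVf// gt_eqF.
have vA : v *m A = a *: v by rewrite /v -scalemxAl uA !scalerA mulrC.
have [H [HH H0]] := householder vv.
have HtH : H^T *m H = 1%:M by apply: mulmx1C.
pose M : 'M[R]_(1 + n) := H *m A *m H^T.
have MT : M^T = M by rewrite /M !trmx_mul trmxK sA mulmxA.
have M0 : row 0 M = a *: delta_mx 0 0.
  rewrite /M !row_mul H0 vA -scalemxAl -H0 -row_mul HH rowE mulmx1; congr (_ *: _).
have ME : M = block_mx a%:M 0 0 (drsubmx M).
  have ur : ursubmx M = 0.
    apply/matrixP => i j; rewrite !ord1; have /rowP/(_ (rshift 1 j)) := M0.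
    by rewrite !mxE (_ : lshift n 0 = 0) /= ?mulr0//; apply: val_inj.
  have dl : dlsubmx M = 0 by rewrite -[dlsubmx M]trmxK trmx_dlsub MT ur trmx0.
  have ul : ulsubmx M = a%:M.
    apply/matrixP => i j; rewrite !ord1; have /rowP/(_ 0) := M0.
    by rewrite !mxE/= (_ : lshift n 0 = 0) ?mulr1//; apply: val_inj.
  by rewrite -[LHS]submxK ur dl ul.
have [|O' [d' [OO' ME']]] := IH (drsubmx M).
  by rewrite symmetricmx_trmx trmx_drsub MT.
pose K : 'M[R]_(1 + n) := block_mx 1%:M 0 0 O'.
have KK : K *m K^T = 1%:M.
  by rewrite /K tr_block_mx !trmx0 trmx1 mulmx_block !mul0mx !mulmx0 !addr0 !add0r mulmx1 OO' -scalar_mx_block.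
exists (K *m H), (row_mx (a%:M : 'rV_1) d' : 'rV_(1 + n)); split.
  by rewrite trmx_mul mulmxA -(mulmxA K) HH mulmx1.
have -> : diag_mx (row_mx (a%:M : 'rV_1) d') = block_mx a%:M 0 0 (diag_mx d') :> 'M[R]_(1 + n).
  rewrite diag_mx_row; congr block_mx.
  by apply/rowP => j; rewrite !ord1 !mxE eqxx.
rewrite trmx_mul !mulmxA -(mulmxA (H^T *m K^T)).
have -> : block_mx a%:M 0 0 (diag_mx d') *m K = K *m M *m K^T *m K.
  rewrite ME /K tr_block_mx !trmx0 trmx1 !mulmx_block !mul0mx !mulmx0 !addr0 !add0r ME'.
  rewrite !mulmx1 !mul1mx.
  have tOO : O'^T *m O' = 1%:M by apply: mulmx1C.
  congr block_mx; first by rewrite !mul0mx.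
  by rewrite !mulmxA OO' mul1mx -!mulmxA tOO mulmx1.
have tKK : K^T *m K = 1%:M by apply: mulmx1C.
have -> : H^T *m K^T *m (K *m M *m K^T *m K) *m H =
  H^T *m (K^T *m K) *m M *m (K^T *m K) *m H by rewrite !mulmxA.
by rewrite tKK !mulmx1 /M !mulmxA HtH mul1mx -mulmxA HtH mulmx1.
Qed.

End spectral_theorem.

(** * The Frobenius inner product and norm *)

Section frobenius.
Context {R : realType}.

Lemma discriminant_le (a b c : R) : 0 <= c ->
  (forall t, 0 <= a - 2 * t * b + t ^+ 2 * c) -> b ^+ 2 <= a * c.
Proof.
move=> c0 H; have [ceq0|cn0] := eqVneq c 0.
  have [->|bn0] := eqVneq b 0; first by rewrite expr0n/= ceq0 mulr0.
  have := H ((a + 1) / (2 * b)); rewrite ceq0 mulr0 addr0.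
  have -> : 2 * ((a + 1) / (2 * b)) * b = a + 1 by field.
  by move=> ?; exfalso; lra.
have c_gt0 : 0 < c by rewrite lt_def cn0.
have := H (b / c).
have -> : a - 2 * (b / c) * b + (b / c) ^+ 2 * c = (a * c - b ^+ 2) / c by field.
by rewrite pmulr_lge0 ?invr_gt0// subr_ge0.
Qed.

(** Rectangular matrices are allowed so that the same inner product serves row vectors. *)
Definition fdot m n (A B : 'M[R]_(m, n)) : R := \tr (A *m B^T).

Lemma fdotE m n (A B : 'M[R]_(m, n)) : fdot A B = \sum_i \sum_j A i j * B i j.
Proof. by apply: eq_bigr => i _; rewrite mxE; apply: eq_bigr => j _; rewrite mxE. Qed.

Section rect.
Variables m n : nat.
Implicit Types A B C : 'M[R]_(m, n).

Lemma fdotC A B : fdot A B = fdot B A.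
Proof. by rewrite /fdot -mxtrace_tr trmx_mul trmxK. Qed.

Lemma fdotDl A B C : fdot (A + B) C = fdot A C + fdot B C.
Proof. by rewrite /fdot mulmxDl linearD. Qed.

Lemma fdotZl a A B : fdot (a *: A) B = a * fdot A B.
Proof. by rewrite /fdot -scalemxAl linearZ. Qed.

Lemma fdotNl A B : fdot (- A) B = - fdot A B.
Proof. by rewrite /fdot mulNmx linearN. Qed.

Lemma fdotDr A B C : fdot A (B + C) = fdot A B + fdot A C.
Proof. by rewrite !(fdotC A) fdotDl. Qed.

Lemma fdotZr a A B : fdot A (a *: B) = a * fdot A B.
Proof. by rewrite !(fdotC A) fdotZl. Qed.

Lemma fdotNr A B : fdot A (- B) = - fdot A B.
Proof. by rewrite !(fdotC A) fdotNl. Qed.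

Lemma fdot_sq_ge0 A : 0 <= fdot A A.
Proof.
by rewrite fdotE !sumr_ge0// => i _; apply: sumr_ge0 => j _; rewrite -expr2 sqr_ge0.
Qed.

Lemma fdot_cauchy_schwarz A B : fdot A B ^+ 2 <= fdot A A * fdot B B.
Proof.
apply: discriminant_le => [|t]; first exact: fdot_sq_ge0.
have := fdot_sq_ge0 (A - t *: B).
by rewrite !(fdotDl, fdotDr, fdotNl, fdotNr, fdotZl, fdotZr) (fdotC B A); lra.
Qed.

Lemma fdot_entry A i j : A i j ^+ 2 <= fdot A A.
Proof.
rewrite fdotE (bigD1 i)//= (bigD1 j)//= -addrA -expr2 lerDl addr_ge0//.
  by apply: sumr_ge0 => k _; rewrite -expr2 sqr_ge0.
by apply: sumr_ge0 => k _; apply: sumr_ge0 => l _; rewrite -expr2 sqr_ge0.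
Qed.

Definition fnorm A : R := Num.sqrt (fdot A A).

Lemma fnorm_ge0 A : 0 <= fnorm A. Proof. exact: sqrtr_ge0. Qed.

Lemma sqr_fnorm A : fnorm A ^+ 2 = fdot A A.
Proof. by rewrite sqr_sqrtr// fdot_sq_ge0. Qed.

Lemma fnormZ a A : fnorm (a *: A) = `|a| * fnorm A.
Proof. by rewrite /fnorm fdotZl fdotZr mulrA -expr2 sqrtrM ?sqr_ge0// sqrtr_sqr. Qed.

Lemma fnormN A : fnorm (- A) = fnorm A.
Proof. by rewrite /fnorm fdotNl fdotNr opprK. Qed.

Lemma ler_fnormD A B : fnorm (A + B) <= fnorm A + fnorm B.
Proof.
rewrite -ler_sqr ?nnegrE ?addr_ge0 ?fnorm_ge0// sqr_fnorm sqrrD !sqr_fnorm.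
rewrite fdotDl !fdotDr (fdotC B A) mulr2n.
have : fdot A B <= fnorm A * fnorm B.
  rewrite (le_trans (ler_norm _))// -ler_sqr ?nnegrE ?mulr_ge0 ?fnorm_ge0//.
  by rewrite real_normK ?num_real// exprMn !sqr_fnorm fdot_cauchy_schwarz.
lra.
Qed.

Lemma fnorm_entry A i j : `|A i j| <= fnorm A.
Proof.
rewrite -ler_sqr ?nnegrE ?fnorm_ge0// real_normK ?num_real// sqr_fnorm.
exact: fdot_entry.
Qed.

End rect.

Lemma fdot_mull m n p (A : 'M[R]_(m, n)) (B : 'M[R]_(n, p)) C :
  fdot (A *m B) C = fdot B (A^T *m C).
Proof. by rewrite /fdot trmx_mul trmxK -mulmxA mxtrace_mulC mulmxA. Qed.

Lemma fdot_tr m n (A B : 'M[R]_(m, n)) : fdot A^T B^T = fdot A B.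
Proof. by rewrite /fdot trmxK mxtrace_mulC -mxtrace_tr trmx_mul trmxK. Qed.

Lemma fdot_mulr m n p (A : 'M[R]_(n, p)) (B : 'M[R]_(m, n)) C :
  fdot (B *m A) C = fdot B (C *m A^T).
Proof. by rewrite /fdot trmx_mul trmxK mulmxA. Qed.

Lemma fnormM m n p (A : 'M[R]_(m, n)) (B : 'M[R]_(n, p)) :
  fnorm (A *m B) <= fnorm A * fnorm B.
Proof.
rewrite -ler_sqr ?nnegrE ?mulr_ge0 ?fnorm_ge0// exprMn !sqr_fnorm.
rewrite fdotE [fdot A A]fdotE mulr_suml; apply: ler_sum => i _.
rewrite -[fdot B B]fdot_tr [fdot B^T _]fdotE mulr_sumr; apply: ler_sum => j _.
rewrite -expr2 mxE.
have e1 : fdot (row i A) (row j B^T) = \sum_k A i k * B k j.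
  by rewrite fdotE big_ord1; apply: eq_bigr => k _; rewrite !mxE.
have e2 : fdot (row i A) (row i A) = \sum_k A i k * A i k.
  by rewrite fdotE big_ord1; apply: eq_bigr => k _; rewrite !mxE.
have e3 : fdot (row j B^T) (row j B^T) = \sum_k B^T j k * B^T j k.
  by rewrite fdotE big_ord1; apply: eq_bigr => k _; rewrite !mxE.
by rewrite -e1 -e2 -e3 fdot_cauchy_schwarz.
Qed.

Lemma sqr_frobenius_norm n (A : 'M[R]_n) : frobenius_norm A ^+ 2 = fdot A A.
Proof.
rewrite fdotE sqr_sqrtr; last first.
  by apply: sumr_ge0 => i _; apply: sumr_ge0 => j _; rewrite sqr_ge0.
by apply: eq_bigr => i _; apply: eq_bigr => j _; rewrite expr2.
Qed.

Lemma fnormX n (A : 'M[R]_n) k :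
  fnorm (A ^+ k) <= fnorm (1%:M : 'M[R]_n) * fnorm A ^+ k.
Proof.
elim: k => [|k IH]; first by rewrite !expr0 mulr1.
by rewrite exprSr (le_trans (fnormM _ _))// exprSr mulrA ler_wpM2r ?fnorm_ge0.
Qed.

Lemma exprZmx n (A : 'M[R]_n) c k : (c *: A) ^+ k = c ^+ k *: A ^+ k.
Proof.
elim: k => [|k IH]; first by rewrite !expr0 scale1r.
by rewrite !exprS IH -[LHS]/(_ *m _) -scalemxAl -scalemxAr scalerA.
Qed.

Lemma ler_fnorm_sum m n (I : finType) (f : I -> 'M[R]_(m, n)) :
  fnorm (\sum_i f i) <= \sum_i fnorm (f i).
Proof.
elim/big_ind2 : _ => // [|x x' y y' h1 h2].
  by rewrite -(scale0r (0 : 'M[R]_(m, n))) fnormZ normr0 mul0r.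
by rewrite (le_trans (ler_fnormD _ _))// lerD.
Qed.

End frobenius.

(** * Entrywise limits and the power formula for the exponential *)

Section matrix_limits.
Context {R : realType}.

Lemma cvgn_sum (I : finType) (f : I -> nat -> R) (l : I -> R) :
  (forall i, f i @ \oo --> l i) ->
  (fun k => \sum_i f i k) @ \oo --> \sum_i l i.
Proof.
move=> fl; have -> : (fun k => \sum_i f i k) = \sum_i f i.
  by apply/funext => k; rewrite fct_sumE.
by elim/big_ind2 : _ => // [|x x' y y' h1 h2]; [exact: cvg_cst|exact: cvgD].
Qed.

(** Entrywise convergence reduces matrix limits to scalar ones; [mxcvg_cvg] recovers the topological
    limit in which [expmx] is defined. *)
Definition mxcvg m n (X : nat -> 'M[R]_(m, n)) (L : 'M[R]_(m, n)) :=
  forall i j, (fun k => X k i j) @ \oo --> L i j.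

Lemma mxcvg_cvg m n (X : nat -> 'M[R]_(m, n)) L : mxcvg X L -> X @ \oo --> L.
Proof.
move=> XL; apply/cvg_ballP => e e0.
suff : \forall k \near \oo, forall i j, ball (L i j) e (X k i j).
  by apply: filterS => k H; split.
apply: filter_forall => i; apply: filter_forall => j.
by have /cvg_ballP/(_ e e0) := XL i j.
Qed.

Lemma mxcvg_mul m n p (X : nat -> 'M[R]_(m, n)) L (Y : nat -> 'M[R]_(n, p)) M :
  mxcvg X L -> mxcvg Y M -> mxcvg (fun k => X k *m Y k) (L *m M).
Proof.
move=> XL YM i j; rewrite mxE.
under eq_fun do rewrite mxE.
by apply: cvgn_sum => k; apply: cvgM; [exact: XL|exact: YM].
Qed.

Lemma mxcvg_cst m n (L : 'M[R]_(m, n)) : mxcvg (fun=> L) L.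
Proof. by move=> i j; exact: cvg_cst. Qed.

Lemma mxcvg_uniq m n (X : nat -> 'M[R]_(m, n)) L M :
  mxcvg X L -> mxcvg X M -> L = M.
Proof.
move=> XL XM; apply/matrixP => i j.
by apply: cvg_unique (XL i j) (XM i j); exact: Rhausdorff.
Qed.

Lemma mxcvg_tr m n (X : nat -> 'M[R]_(m, n)) L :
  mxcvg X L -> mxcvg (fun k => (X k)^T) L^T.
Proof. by move=> XL i j; rewrite mxE; under eq_fun do rewrite mxE; exact: XL. Qed.

Lemma mxcvg_fdot m n (X : nat -> 'M[R]_(m, n)) L Y M :
  mxcvg X L -> mxcvg Y M -> (fun k => fdot (X k) (Y k)) @ \oo --> fdot L M.
Proof.
move=> XL YM; rewrite fdotE.
under eq_fun do rewrite fdotE.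
apply: cvgn_sum => i; apply: cvgn_sum => j.
by apply: cvgM; [exact: XL|exact: YM].
Qed.

Lemma mxcvg_near m n (X Y : nat -> 'M[R]_(m, n)) L (u : nat -> R) :
  (forall k, fnorm (X k - Y k) <= u k) -> u @ \oo --> 0 ->
  mxcvg Y L -> mxcvg X L.
Proof.
move=> XYu u0 YL i j.
have -> : (fun k => X k i j) = (fun k => (X k - Y k) i j + Y k i j).
  by apply/funext => k; rewrite !mxE subrK.
rewrite -[L i j]add0r; apply: cvgD; last exact: YL.
apply/norm_cvg0P.
apply: (@squeeze_cvgr _ _ _ _ (fun=> 0) u); [|exact: cvg_cst|exact: u0].
apply: nearW => k; rewrite normr_ge0/=.
exact: le_trans (fnorm_entry _ _ _) (XYu k).
Qed.

(** The lower estimate of the power comes from 1 + x >= exp (x / (1 + x)) >= exp (x - x^2), raised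
    to the power N + 1. *)
Lemma expR_pow_gap (r : R) (N : nat) : 0 <= r ->
  0 <= expR r - (1 + r / N.+1%:R) ^+ N.+1 <= expR r * r ^+ 2 / N.+1%:R.
Proof.
move=> r0; have N0 : 0 < N.+1%:R :> R by rewrite ltr0n.
pose x := r / N.+1%:R; have x0 : 0 <= x by rewrite divr_ge0.
have rE : r = x * N.+1%:R by rewrite /x divfK// gt_eqF.
have up : (1 + x) ^+ N.+1 <= expR r.
  by rewrite rE expRM_natr lerXn2r ?nnegrE ?addr_ge0 ?expR_ge0 ?expR_ge1Dx.
have lo1 : expR (x - x ^+ 2) <= 1 + x.
  have x1 : 0 < 1 + x by rewrite ltr_wpDr.
  apply: (@le_trans _ _ (expR (x / (1 + x)))).
    rewrite ler_expR ler_pdivlMr//.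
    have -> : (x - x ^+ 2) * (1 + x) = x - x ^+ 3 by ring.
    by rewrite gerBl exprn_ge0.
  rewrite -[leRHS]invrK -[leLHS]invrK -expRN lef_pV2 ?posrE ?invr_gt0 ?expR_gt0//.
  apply: le_trans (expR_ge1Dx _); rewrite le_eqVlt; apply/orP; left; apply/eqP.
  by field; rewrite gt_eqF.
have lo : expR (r - r ^+ 2 / N.+1%:R) <= (1 + x) ^+ N.+1.
  have -> : r - r ^+ 2 / N.+1%:R = (x - x ^+ 2) * N.+1%:R.
    by rewrite rE; field; rewrite gt_eqF.
  by rewrite expRM_natr lerXn2r ?nnegrE ?addr_ge0 ?expR_ge0.
rewrite subr_ge0 up/= lerBlDr -lerBlDl (le_trans _ lo)// expRD.
rewrite -{1}[expR r]mulr1 -!mulrA -mulrBr ler_pM2l ?expR_gt0//.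
exact: expR_ge1Dx.
Qed.

Lemma cvg_harmonicM (c : R) : (fun N : nat => c / N.+1%:R) @ \oo --> 0.
Proof. by rewrite -[0](mulr0 c); apply: cvgMr; exact: cvg_harmonic. Qed.

Lemma cvg_expR_pow (r : R) : 0 <= r ->
  (fun N : nat => (1 + r / N.+1%:R) ^+ N.+1) @ \oo --> expR r.
Proof.
move=> r0.
apply: (@squeeze_cvgr _ _ _ _ (fun N => expR r - expR r * r ^+ 2 / N.+1%:R)
  (fun=> expR r)).
- apply: nearW => N; have /andP[h1 h2] := expR_pow_gap N r0.
  by rewrite lerBlDr -lerBlDl h2 /= -subr_ge0.
- by rewrite -[X in _ --> X]subr0; apply: cvgB; [exact: cvg_cst|exact: cvg_harmonicM].
- exact: cvg_cst.
Qed.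

Section expmx.
Variable n : nat.
Implicit Types A B : 'M[R]_n.

Let coef A := fun k => (k`!%:R)^-1 *: A ^+ k.

Lemma expmx_cvg A : mxcvg (series (fun k => (k`!%:R)^-1 *: A ^+ k)) (expmx A).
Proof.
rewrite -/(coef A); pose N1 := fnorm (1%:M : 'M[R]_n).
have entry i j : cvgn (fun k => series (coef A) k i j).
  have -> : (fun k => series (coef A) k i j) = series (fun k => coef A k i j).
    by apply/funext => k; rewrite /series/= summxE.
  apply: normed_cvg; apply: (@series_le_cvg _ _ (N1 *: exp_coeff (fnorm A))) => [k|k|k|].
  - exact: normr_ge0.
  - by rewrite mulr_ge0 ?fnorm_ge0 ?exp_coeff_ge0 ?fnorm_ge0.
  - rewrite (le_trans (fnorm_entry _ _ _))// fnormZ ger0_norm ?invr_ge0//.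
    rewrite /exp_coeff/= -[leRHS]/(N1 * (_ / _)) mulrC mulrA ler_wpM2r ?invr_ge0//.
    exact: fnormX.
  - by apply: is_cvg_seriesZ; exact: is_cvg_series_exp_coeff.
pose L := \matrix_(i, j) limn (fun k => series (coef A) k i j).
have AL : mxcvg (series (coef A)) L by move=> i j; rewrite mxE; exact: entry.
suff -> : expmx A = L by [].
by apply/cvg_lim => //; exact: mxcvg_cvg.
Qed.

(** As C(N+1, k) / (N+1)^k <= 1 / k!, the distance to the truncated series is dominated term by term
    by the scalar one at r = |A|. Powers are the convenient form for transposes, commutation and
    skew estimates. *)
Lemma expmx_pow_cvg A :
  mxcvg (fun N => (1 + N.+1%:R^-1 *: A) ^+ N.+1) (expmx A).
Proof.
pose N1 := fnorm (1%:M : 'M[R]_n); pose r := fnorm A.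
have r0 : 0 <= r by exact: fnorm_ge0.
pose u N := N1 * (series (exp_coeff r) N.+2 - (1 + r / N.+1%:R) ^+ N.+1).
have shift2 (w : nat -> R) (l : R) : w @ \oo --> l -> (fun N => w N.+2) @ \oo --> l.
  by move=> h; have := h; rewrite -(cvg_shiftS w) -(cvg_shiftS (fun N => w N.+1)).
have seriesS : mxcvg (fun N => series (coef A) N.+2) (expmx A).
  by move=> i j; exact: (shift2 (fun k => series (coef A) k i j) _ (@expmx_cvg A i j)).
apply: (@mxcvg_near _ _ _ (fun N => series (coef A) N.+2) _ u) => // [N|].
  have N0 : N.+1%:R != 0 :> R by rewrite pnatr_eq0.
  have binE (S : pzRingType) (s : S) :
      (1 + s) ^+ N.+1 = \sum_(k < N.+2) s ^+ k *+ 'C(N.+1, k).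
    rewrite exprDn_comm; last exact/commr_sym/commr1.
    by apply: eq_bigr => k _; rewrite expr1n mul1r.
  rewrite -opprB fnormN binE /series/= !big_mkord -sumrB.
  rewrite /u binE /series/= !big_mkord -sumrB mulr_sumr.
  apply: le_trans (ler_fnorm_sum _) _; apply: ler_sum => k _.
  have sE (B : 'M[R]_n) l : B *+ l = l%:R *: B by rewrite scaler_nat.
  rewrite exprZmx sE scalerA /coef -scalerBl fnormZ.
  rewrite /exp_coeff/= expr_div_n -[(r ^+ k / _) *+ _]mulr_natl.
  have f0 : 0 < k`!%:R :> R by rewrite ltr0n fact_gt0.
  have cle : 'C(N.+1, k)%:R * N.+1%:R^-1 ^+ k <= (k`!%:R)^-1 :> R.
    rewrite -(ler_pM2r f0) mulVf ?gt_eqF// mulrAC -natrM bin_ffact exprVn.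
    rewrite ler_pdivrMr ?exprn_gt0 ?ltr0n// mul1r -natrX ler_nat.
    elim: (k : nat) => // l IH.
    by rewrite ffactnSr expnSr leq_mul// leq_subr.
  rewrite ger0_norm ?subr_ge0//.
  apply: (@le_trans _ _ ((k`!%:R^-1 - 'C(N.+1, k)%:R * N.+1%:R^-1 ^+ k) * (N1 * r ^+ k))).
    by rewrite ler_wpM2l ?subr_ge0// fnormX.
  by rewrite le_eqVlt; apply/orP; left; apply/eqP; rewrite exprVn; ring.
rewrite -[0](mulr0 N1); apply: cvgMr.
rewrite -[X in _ --> X](subrr (expR r)); apply: cvgB; last exact: cvg_expR_pow.
by apply: shift2; exact: is_cvg_series_exp_coeff.
Qed.

End expmx.
End matrix_limits.

Section expmx_theory.
Context {R : realType} {n : nat}.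
Implicit Types (A B : 'M[R]_n) (c e : R).
Let N1 := fnorm (1%:M : 'M[R]_n).

Lemma mulmxE_ring A B : A * B = A *m B. Proof. by []. Qed.

Lemma expmx_comm A B : A *m B = B *m A -> expmx A *m B = B *m expmx A.
Proof.
move=> AB.
have h1 := mxcvg_mul (@expmx_pow_cvg _ _ A) (@mxcvg_cst _ _ _ B).
have h2 := mxcvg_mul (@mxcvg_cst _ _ _ B) (@expmx_pow_cvg _ _ A).
apply: mxcvg_uniq h1 _; congr (mxcvg _ _): h2; apply/funext => N.
have hc : GRing.comm B (1 + N.+1%:R^-1 *: A).
  apply: commrD; first exact: commr1.
  by rewrite /GRing.comm !mulmxE_ring -scalemxAl -scalemxAr AB.
exact: (commrX N.+1 hc).
Qed.

Lemma expmx_tr A : (expmx A)^T = expmx A^T.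
Proof.
have h1 := mxcvg_tr (@expmx_pow_cvg _ _ A).
apply: mxcvg_uniq h1 _; congr (mxcvg _ _): (@expmx_pow_cvg _ _ A^T).
apply/funext => N; set e := N.+1%:R^-1.
elim: N.+1 => [|k IH]; first by rewrite !expr0 trmx1.
rewrite exprS exprSr IH !mulmxE_ring trmx_mul; congr (_ *m _).
by rewrite raddfD/= linearZ/= trmx1.
Qed.

Lemma expmx_diag_conj (O : 'M[R]_n) (d : 'rV[R]_n) : O *m O^T = 1%:M ->
  expmx (O^T *m diag_mx d *m O) = O^T *m diag_mx (map_mx expR d) *m O.
Proof.
move=> OO.
have powE k : (O^T *m diag_mx d *m O) ^+ k =
    O^T *m diag_mx (map_mx (fun x => x ^+ k) d) *m O.
  elim: k => [|k IH].
    rewrite expr0 (_ : map_mx _ d = const_mx 1) ?diag_const_mx ?mulmx1 ?(mulmx1C OO)//.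
    by apply/rowP => j; rewrite !mxE expr0.
  rewrite exprS IH mulmxE_ring !mulmxA -(mulmxA _ O O^T) OO mulmx1 -(mulmxA O^T) mulmx_diag.
  congr (_ *m diag_mx _ *m _); apply/rowP => j; rewrite !mxE exprS.
  by [].
apply: mxcvg_uniq (@expmx_cvg _ _ _) _.
have -> : series (fun k => k`!%:R^-1 *: (O^T *m diag_mx d *m O) ^+ k) =
    fun N => O^T *m diag_mx (map_mx (fun x => series (exp_coeff x) N) d) *m O.
  apply/funext => N; rewrite /series/=.
  under eq_bigr do rewrite powE scalemxAl scalemxAr -linearZ.
  rewrite -mulmx_suml -mulmx_sumr -linear_sum/=.
  congr (_ *m diag_mx _ *m _); apply/rowP => j; rewrite summxE mxE.
  by apply: eq_bigr => k _; rewrite !mxE mulrC.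
apply: mxcvg_mul; last exact: mxcvg_cst.
apply: mxcvg_mul; first exact: mxcvg_cst.
move=> i j; rewrite !mxE.
under eq_fun do rewrite !mxE.
case: (i == j); rewrite ?mulr1n ?mulr0n; last exact: cvg_cst.
exact: is_cvg_series_exp_coeff.
Qed.

Lemma fnorm_addid c A (W : 'M[R]_n) : 0 <= c ->
  fnorm ((1 + c *: A) *m W) <= (1 + c * fnorm A) * fnorm W.
Proof.
move=> c0; rewrite mulmxDl mul1mx -scalemxAl (le_trans (ler_fnormD _ _))//.
by rewrite fnormZ ger0_norm// mulrDl mul1r lerD2l -mulrA ler_wpM2l// fnormM.
Qed.

Lemma fnorm_addid_pow c A k : 0 <= c ->
  fnorm ((1 + c *: A) ^+ k) <= (1 + c * fnorm A) ^+ k * N1.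
Proof.
move=> c0; elim: k => [|k IH]; first by rewrite !expr0 mul1r.
rewrite !exprS -mulrA (le_trans (fnorm_addid _ _ c0))// ler_wpM2l//.
by rewrite addr_ge0// mulr_ge0 ?fnorm_ge0.
Qed.

Lemma fnorm_addid_pow_expR A N :
  fnorm ((1 + N.+1%:R^-1 *: A) ^+ N.+1) <= expR (fnorm A) * N1.
Proof.
rewrite (le_trans (fnorm_addid_pow _ _ _))// ler_wpM2r ?fnorm_ge0//.
rewrite mulrC; have /andP[+ _] := expR_pow_gap N (fnorm_ge0 A).
by rewrite subr_ge0.
Qed.

Lemma fnorm_expmx_le A : fnorm (expmx A) <= expR (fnorm A) * N1.
Proof.
have h := mxcvg_fdot (@expmx_pow_cvg _ _ A) (@expmx_pow_cvg _ _ A).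
rewrite -ler_sqr ?nnegrE ?mulr_ge0 ?expR_ge0 ?fnorm_ge0// sqr_fnorm.
apply: (ler_cvg_to h (@cvg_cst _ _ _ _ _)); apply: nearW => N.
rewrite -sqr_fnorm ler_sqr ?nnegrE ?mulr_ge0 ?expR_ge0 ?fnorm_ge0//.
exact: fnorm_addid_pow_expR.
Qed.

(** 1 + e (A + B) and (1 + e A) (1 + e B) differ by e^2 A B; telescoping over N + 1 factors leaves
    an error of order 1/N. *)
Lemma comm_pow_cvg A B : A *m B = B *m A ->
  mxcvg (fun N => (1 + N.+1%:R^-1 *: (A + B)) ^+ N.+1) (expmx A *m expmx B).
Proof.
move=> AB; set a := fnorm A; set b := fnorm B.
have [a0 b0] : 0 <= a /\ 0 <= b by split; exact: fnorm_ge0.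
have prodE N : (1 + N.+1%:R^-1 *: A) ^+ N.+1 *m (1 + N.+1%:R^-1 *: B) ^+ N.+1 =
    ((1 + N.+1%:R^-1 *: A) * (1 + N.+1%:R^-1 *: B)) ^+ N.+1.
  rewrite exprMn_comm//.
  apply: commrD; first exact: commr1.
  apply: commr_sym; apply: commrD; first exact: commr1.
  by rewrite /GRing.comm !mulmxE_ring -!scalemxAl -!scalemxAr !scalerA AB mulrC.
have lim : mxcvg (fun N => ((1 + N.+1%:R^-1 *: A) * (1 + N.+1%:R^-1 *: B)) ^+ N.+1)
    (expmx A *m expmx B).
  have := mxcvg_mul (@expmx_pow_cvg _ _ A) (@expmx_pow_cvg _ _ B).
  by under eq_fun do rewrite prodE.
apply: (mxcvg_near (u := fun N => a * b * expR (a + b) * N1 / N.+1%:R) _ _ lim); last exact: cvg_harmonicM.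
move=> N; set e := N.+1%:R^-1 : R.
have e0 : 0 <= e by rewrite invr_ge0.
set X := 1 + e *: (A + B); set Y := (1 + e *: A) * (1 + e *: B).
(* [c] bounds the effect of multiplying by X as well as by Y, and c^(N+1) <= exp (a + b). *)
pose c := (1 + e * a) * (1 + e * b).
have c1 : 1 <= c.
  have := mulr_ge0 e0 a0; have := mulr_ge0 e0 b0; rewrite /c; nra.
have YX : X - Y = - (e ^+ 2) *: (A *m B).
  rewrite /X /Y mulrDl mul1r mulrDr mulr1 mulmxE_ring -scalemxAl -scalemxAr scalerA -expr2.
  by rewrite scalerDr scaleNr !opprD !addrA; apply/matrixP => i j; rewrite !mxE; ring.
have Xc (W : 'M[R]_n) : fnorm (X *m W) <= c * fnorm W.
  rewrite (le_trans (fnorm_addid _ _ e0))// ler_wpM2r ?fnorm_ge0//.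
  have := ler_wpM2l e0 (ler_fnormD A B); rewrite -/a -/b /c.
  have := mulr_ge0 (mulr_ge0 e0 a0) (mulr_ge0 e0 b0); lra.
have Yc1 (W : 'M[R]_n) : fnorm (Y *m W) <= c * fnorm W.
  rewrite /Y mulmxE_ring -mulmxA (le_trans (fnorm_addid _ _ e0))//.
  rewrite /c -mulrA ler_wpM2l ?addr_ge0 ?mulr_ge0//.
  exact: fnorm_addid.
have Yc k : fnorm (Y ^+ k) <= c ^+ k * N1.
  elim: k => [|k IH]; first by rewrite !expr0 mul1r.
  rewrite [Y ^+ _]exprS [c ^+ _]exprS -mulrA (le_trans (Yc1 _))// ler_wpM2l//.
  exact: le_trans c1.
have D k : fnorm (X ^+ k - Y ^+ k) <= k%:R * (e ^+ 2 * (a * b)) * (c ^+ k * N1).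
  elim: k => [|k IH].
    by rewrite !expr0 subrr mul0r mul0r -(scale0r (0 : 'M[R]_n)) fnormZ normr0 mul0r.
  have -> : X ^+ k.+1 - Y ^+ k.+1 = X *m (X ^+ k - Y ^+ k) + (X - Y) *m Y ^+ k.
    by rewrite !exprS !mulmxE_ring mulmxBr mulmxBl addrA subrK.
  rewrite (le_trans (ler_fnormD _ _))//.
  have h1 : fnorm (X *m (X ^+ k - Y ^+ k)) <= k%:R * (e ^+ 2 * (a * b)) * (c ^+ k.+1 * N1).
    rewrite (le_trans (Xc _))// [c ^+ k.+1]exprS.
    rewrite [leRHS](_ : _ = c * (k%:R * (e ^+ 2 * (a * b)) * (c ^+ k * N1))); last by ring.
    by rewrite ler_wpM2l ?(le_trans ler01 c1).
  have h2 : fnorm ((X - Y) *m Y ^+ k) <= e ^+ 2 * (a * b) * (c ^+ k.+1 * N1).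
    rewrite (le_trans (fnormM _ _))// ler_pM ?fnorm_ge0//.
      rewrite YX fnormZ normrN ger0_norm ?sqr_ge0// ler_wpM2l ?sqr_ge0//.
      exact: fnormM.
    rewrite (le_trans (Yc k))// ler_wpM2r ?fnorm_ge0// exprS ler_peMl//.
    by rewrite exprn_ge0// (le_trans ler01).
  by rewrite (le_trans (lerD h1 h2))// -mulrDl -{2}[e ^+ 2 * _]mul1r -mulrDl natr1.
rewrite (le_trans (D _))//.
have -> : N.+1%:R * (e ^+ 2 * (a * b)) = a * b * e.
  have Ne : N.+1%:R * e = 1 by rewrite mulfV// pnatr_eq0.
  by transitivity (N.+1%:R * e * (a * b * e)); [ring|rewrite Ne mul1r].
rewrite [leRHS](_ : _ = a * b * e * (expR (a + b) * N1)); last by rewrite /e; ring.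
rewrite ler_wpM2l ?mulr_ge0// ler_wpM2r ?fnorm_ge0//.
rewrite expRD /c exprMn ler_pM ?exprn_ge0 ?addr_ge0 ?mulr_ge0//.
  by have /andP[+ _] := expR_pow_gap N a0; rewrite subr_ge0 mulrC.
by have /andP[+ _] := expR_pow_gap N b0; rewrite subr_ge0 mulrC.
Qed.

Section skew.
Variable K : 'M[R]_n.
Hypothesis skewK : K^T = - K.

(** For skew K the matrices V and V K are orthogonal, so each factor only adds e^2 |V K|^2 to
    |V|^2. *)
Lemma skew_pow_le p (W : 'M[R]_(p, n)) N :
  fdot (W *m (1 + N.+1%:R^-1 *: K) ^+ N.+1) (W *m (1 + N.+1%:R^-1 *: K) ^+ N.+1)
  <= expR (fdot K K / N.+1%:R) * fdot W W.
Proof.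
set e := N.+1%:R^-1 : R.
have e0 : 0 <= e by rewrite invr_ge0.
have step (V : 'M[R]_(p, n)) : fdot (V *m (1 + e *: K)) (V *m (1 + e *: K)) <=
    (1 + e ^+ 2 * fdot K K) * fdot V V.
  have cross : fdot V (V *m K) = 0.
    have : fdot V (V *m K) = - fdot V (V *m K).
      by rewrite {1}fdotC fdot_mulr skewK mulmxN fdotNr.
    by lra.
  rewrite mulmxDr mulmx1 -scalemxAr !(fdotDl, fdotDr, fdotZl, fdotZr).
  rewrite [fdot (V *m K) V]fdotC cross !mulr0 addr0 add0r mulrDl mul1r lerD2l.
  rewrite mulrA -expr2 -mulrA ler_wpM2l ?sqr_ge0// -!sqr_fnorm -exprMn mulrC.
  by rewrite ler_sqr ?nnegrE ?mulr_ge0 ?fnorm_ge0// fnormM.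
have powle k : fdot (W *m (1 + e *: K) ^+ k) (W *m (1 + e *: K) ^+ k) <=
    (1 + e ^+ 2 * fdot K K) ^+ k * fdot W W.
  elim: k => [|k IH]; first by rewrite !expr0 mulmx1 mul1r.
  rewrite [(1 + e *: K) ^+ _]exprSr [(1 + _ * fdot K K) ^+ _]exprS mulmxE_ring mulmxA.
  rewrite (le_trans (step _))// -mulrA.
  by rewrite ler_wpM2l// addr_ge0// mulr_ge0 ?sqr_ge0 ?fdot_sq_ge0.
rewrite (le_trans (powle _))// ler_wpM2r ?fdot_sq_ge0//.
have q0 : 0 <= e * fdot K K by rewrite mulr_ge0 ?fdot_sq_ge0.
have /andP[+ _] := expR_pow_gap N q0; rewrite subr_ge0.
by rewrite [e * _ / _]mulrC mulrA -expr2 [e * _]mulrC.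
Qed.

Lemma expmx_skew_le p (W : 'M[R]_(p, n)) :
  fdot (W *m expmx K) (W *m expmx K) <= fdot W W.
Proof.
have hW := mxcvg_mul (@mxcvg_cst _ _ _ W) (@expmx_pow_cvg _ _ K).
have h := mxcvg_fdot hW hW.
have h2 : (fun N : nat => expR (fdot K K / N.+1%:R) * fdot W W) @ \oo --> fdot W W.
  rewrite -[X in _ --> X]mul1r; apply: cvgMl; rewrite -[X in _ --> X]expR0.
  by apply: continuous_cvg; [exact: continuous_expR|exact: cvg_harmonicM].
by apply: (ler_cvg_to h h2); apply: nearW => N; exact: skew_pow_le.
Qed.

End skew.
End expmx_theory.

(** * Quadratic forms in an eigenbasis *)

Section spectral_inequalities.
Context {R : realType} {n : nat}.
Implicit Types F G O : 'M[R]_n.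

(** The Jordan product. In an eigenbasis of [F] it multiplies entry (i, j) by (d_i + d_j) / 2, the
    number whose exponential multiplies the squared entry in |exp(F/4) G exp(F/4)|^2. *)
Definition symmul F G : 'M[R]_n := 2^-1 *: (F *m G + G *m F).

Lemma fdot_conj O (X Y : 'M[R]_n) : O *m O^T = 1%:M ->
  fdot (O *m X *m O^T) (O *m Y *m O^T) = fdot X Y.
Proof.
move=> OO; have OO' := mulmx1C OO.
by rewrite fdot_mulr trmxK -mulmxA OO' mulmx1 fdot_mull mulmxA OO' mul1mx.
Qed.

Lemma loewner_quadratic m (A B : 'M[R]_m) (v : 'rV[R]_m) : loewner_le A B ->
  (v *m A *m v^T) 0 0 <= (v *m B *m v^T) 0 0.
Proof. by case=> _ /(_ v); rewrite mulmxBr mulmxBl !mxE subr_ge0. Qed.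

(** All the quadratic forms become sums over the points (d_i + d_j) / 2 of [a, b] with the common
    weights g_ij^2, so that scalar inequalities on [a, b] apply termwise. The d_i are the
    eigenvalues of F and g is G in an eigenbasis. *)
Lemma spectral_quadratic F a b G : F \is symmetricmx ->
  loewner_le a%:M F -> loewner_le F b%:M ->
  exists (d : 'I_n -> R) (g : 'I_n -> 'I_n -> R),
  [/\ forall i, a <= d i <= b,
      fdot G G = \sum_i \sum_j g i j ^+ 2,
      fdot G (symmul F G) = \sum_i \sum_j (d i + d j) / 2 * g i j ^+ 2,
      fdot (symmul F G) (symmul F G) =
        \sum_i \sum_j ((d i + d j) / 2) ^+ 2 * g i j ^+ 2 &
      fdot (expmx (4^-1 *: F) *m G *m expmx (4^-1 *: F))
           (expmx (4^-1 *: F) *m G *m expmx (4^-1 *: F)) =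
        \sum_i \sum_j expR ((d i + d j) / 2) * g i j ^+ 2].
Proof.
move=> sF aF Fb; have [Q [d [QQ FE]]] := real_spectral sF.
have QQ' := mulmx1C QQ.
pose g := Q *m G *m Q^T.
have conjF : Q *m F *m Q^T = diag_mx d.
  by rewrite FE !mulmxA QQ mul1mx -mulmxA QQ mulmx1.
have rowM (M : 'M[R]_n) i : (row i Q *m M *m (row i Q)^T) 0 0 = (Q *m M *m Q^T) i i.
  by rewrite -row_mul tr_row !mxE; apply: eq_bigr => k _; rewrite !mxE.
have rowF i : (row i Q *m F *m (row i Q)^T) 0 0 = d 0 i.
  by rewrite rowM conjF !mxE eqxx mulr1n.
have row1 c i : (row i Q *m c%:M *m (row i Q)^T) 0 0 = c.
  by rewrite rowM mul_mx_scalar -scalemxAl QQ scalemx1 !mxE eqxx mulr1n.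
have symE : Q *m symmul F G *m Q^T = \matrix_(i, j) ((d 0 i + d 0 j) / 2 * g i j).
  rewrite /symmul -scalemxAr -scalemxAl mulmxDr mulmxDl.
  have -> : Q *m (F *m G) *m Q^T = diag_mx d *m g.
    by rewrite -conjF /g !mulmxA -(mulmxA _ Q^T Q) QQ' mulmx1.
  have -> : Q *m (G *m F) *m Q^T = g *m diag_mx d.
    by rewrite -conjF /g !mulmxA -(mulmxA _ Q^T Q) QQ' mulmx1.
  by rewrite mul_diag_mx mul_mx_diag; apply/matrixP => i j; rewrite !mxE; field.
pose E := diag_mx (map_mx expR (4^-1 *: d)).
have expE : expmx (4^-1 *: F) = Q^T *m E *m Q.
  rewrite -expmx_diag_conj//; congr expmx.
  by rewrite FE linearZ/= -scalemxAr -scalemxAl.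
have BGB : Q *m (expmx (4^-1 *: F) *m G *m expmx (4^-1 *: F)) *m Q^T =
    \matrix_(i, j) (expR (4^-1 * d 0 i) * g i j * expR (4^-1 * d 0 j)).
  have -> : Q *m (expmx (4^-1 *: F) *m G *m expmx (4^-1 *: F)) *m Q^T = E *m g *m E.
    rewrite expE /g !mulmxA QQ mul1mx -!mulmxA QQ mulmx1.
    by [].
  by rewrite mul_diag_mx mul_mx_diag; apply/matrixP => i j; rewrite !mxE.
exists (fun i => d 0 i), (fun i j => g i j); split.
- by move=> i; rewrite -{1}(row1 a i) -(row1 b i) -(rowF i) !loewner_quadratic.
- rewrite -(fdot_conj _ _ QQ) fdotE.
  by apply: eq_bigr => i _; apply: eq_bigr => j _; rewrite expr2.
- rewrite -(fdot_conj _ _ QQ) symE fdotE.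
  by apply: eq_bigr => i _; apply: eq_bigr => j _; rewrite -/g [(\matrix_(_, _) _) i j]mxE; ring.
- rewrite -(fdot_conj _ _ QQ) symE fdotE.
  by apply: eq_bigr => i _; apply: eq_bigr => j _; rewrite mxE; ring.
- rewrite -(fdot_conj _ _ QQ) BGB fdotE.
  apply: eq_bigr => i _; apply: eq_bigr => j _; rewrite mxE.
  have -> : (d 0 i + d 0 j) / 2 = 4^-1 * d 0 i + 4^-1 * d 0 i + (4^-1 * d 0 j + 4^-1 * d 0 j) by field.
  by rewrite !expRD; ring.
Qed.

Lemma expR_chord a b x : a < b -> a <= x <= b ->
  expR x <= (b * expR a - a * expR b) / (b - a) + (expR b - expR a) / (b - a) * x :> R.
Proof.
move=> ab /andP[ax xb].
have tangent y : expR x * (1 + (y - x)) <= expR y.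
  by rewrite -[y in leRHS](subrKC x) expRD ler_pM2l ?expR_gt0// expR_ge1Dx.
have s0 : 0 < b - a by rewrite subr_gt0.
have -> : (b * expR a - a * expR b) / (b - a) + (expR b - expR a) / (b - a) * x =
   ((b - x) * expR a + (x - a) * expR b) / (b - a) by field; rewrite gt_eqF.
rewrite ler_pdivlMr//.
have := ler_wpM2l (_ : 0 <= b - x) (tangent a).
have := ler_wpM2l (_ : 0 <= x - a) (tangent b).
rewrite !subr_ge0 => /(_ ax) + /(_ xb); lra.
Qed.

Section bounds.
Variables (F : 'M[R]_n) (a b : R).
Hypotheses (sF : F \is symmetricmx) (aF : loewner_le a%:M F) (Fb : loewner_le F b%:M).

Lemma fdot_expmx_le_chord G : a < b ->
  fdot (expmx (4^-1 *: F) *m G *m expmx (4^-1 *: F))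
       (expmx (4^-1 *: F) *m G *m expmx (4^-1 *: F)) <=
  (b * expR a - a * expR b) / (b - a) * fdot G G +
  (expR b - expR a) / (b - a) * fdot G (symmul F G).
Proof.
move=> ab; have [d [g [dab -> -> _ ->]]] := spectral_quadratic G sF aF Fb.
rewrite !mulr_sumr -big_split; apply: ler_sum => i _.
rewrite !mulr_sumr -big_split; apply: ler_sum => j _ /=.
rewrite mulrA -mulrDl ler_wpM2r ?sqr_ge0// expR_chord//.
have := dab i; have := dab j; lra.
Qed.

Lemma fdot_expmx_le_max G :
  fdot (expmx (4^-1 *: F) *m G *m expmx (4^-1 *: F))
       (expmx (4^-1 *: F) *m G *m expmx (4^-1 *: F)) <= expR b * fdot G G.
Proof.
have [d [g [dab -> _ _ ->]]] := spectral_quadratic G sF aF Fb.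
rewrite !mulr_sumr; apply: ler_sum => i _.
rewrite !mulr_sumr; apply: ler_sum => j _ /=.
rewrite ler_wpM2r ?sqr_ge0// ler_expR.
have := dab i; have := dab j; lra.
Qed.

Lemma fdot_symmul_le G : fdot G (symmul F G) <= b * fdot G G.
Proof.
have [d [g [dab -> -> _ _]]] := spectral_quadratic G sF aF Fb.
rewrite !mulr_sumr; apply: ler_sum => i _.
rewrite !mulr_sumr; apply: ler_sum => j _ /=.
rewrite ler_wpM2r ?sqr_ge0//.
have := dab i; have := dab j; lra.
Qed.

(** Termwise (m - a) (b - m) >= 0 at the points m = (d_i + d_j) / 2. *)
Lemma fdot_symmul_sq_le G :
  fdot (symmul F G) (symmul F G) <= (a + b) * fdot G (symmul F G) - a * b * fdot G G.
Proof.
have [d [g [dab -> -> -> _]]] := spectral_quadratic G sF aF Fb.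
rewrite !mulr_sumr -sumrB; apply: ler_sum => i _.
rewrite !mulr_sumr -sumrB; apply: ler_sum => j _ /=.
set m := (d i + d j) / 2.
have -> : (a + b) * (m * g i j ^+ 2) - a * b * g i j ^+ 2 =
  ((a + b) * m - a * b) * g i j ^+ 2 by ring.
rewrite ler_wpM2r ?sqr_ge0//.
have : 0 <= (m - a) * (b - m).
  have h1 := dab i; have h2 := dab j; apply: mulr_ge0; rewrite /m; lra.
lra.
Qed.

End bounds.

Lemma lambda_max_spectral (S : 'M[R]_n) : (0 < n)%N -> S \is symmetricmx ->
  exists (Q : 'M[R]_n) (d : 'rV[R]_n) (k : 'I_n),
    [/\ Q *m Q^T = 1%:M, S = Q^T *m diag_mx d *m Q,
      forall i, d 0 i <= d 0 k & lambda_max S = d 0 k].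
Proof.
move=> n0 sS; have [Q [d [QQ SE]]] := real_spectral sS.
pose i0 : 'I_n := Ordinal n0.
case: (@arg_maxP _ _ _ i0 xpredT (fun i => d 0 i) isT) => k _ kmax.
exists Q, d, k; split => //; first by move=> i; exact: kmax.
have QS : Q *m S = diag_mx d *m Q by rewrite SE !mulmxA QQ mul1mx.
have ek : eigenvalue S (d 0 k).
  apply/eigenvalueP; exists (row k Q).
    by rewrite -row_mul QS row_mul row_diag_mx -scalemxAl -rowE.
  apply/negP => /eqP r0; have /(congr1 (row k)) := QQ.
  rewrite row_mul r0 mul0mx => /rowP/(_ k); rewrite !mxE eqxx => /eqP.
  by rewrite eq_sym oner_eq0.
have ub x : eigenvalue S x -> x <= d 0 k.
  move=> /eigenvalueP[v vS v0].
  set w := v *m Q^T; have wD : w *m diag_mx d = x *: w.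
    rewrite /w; by rewrite scalemxAl -vS SE !mulmxA -(mulmxA _ Q) QQ mulmx1.
  have /rV0Pn[i wi] : w != 0.
    apply: contra v0 => /eqP w0.
    by rewrite -[v]mulmx1 -(mulmx1C QQ) mulmxA -/w w0 mul0mx.
  clearbody w; have /rowP/(_ i) := wD.
  by rewrite mul_mx_diag !mxE mulrC => /(mulIf wi) <-; exact: kmax.
apply/eqP; rewrite eq_le; apply/andP; split.
  by apply: sup_le_ub => [|x /ub]; first by exists (d 0 k).
by apply: ub_le_sup => //; exists (d 0 k) => x /ub.
Qed.

(** Serves the measurability of the tail event, which becomes a countable intersection. If every
    eigenvalue is at most t - e, the trace is at most n exp(- m e), which falls below 1 for large
    m. *)
Lemma lambda_max_le_expmx_trace (S : 'M[R]_n) (t : R) : (0 < n)%N ->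
  S \is symmetricmx ->
  (t <= lambda_max S) <->
  (forall m : nat, 1 <= \tr (expmx (m%:R *: (S - t%:M)))).
Proof.
move=> n0 sS; have [Q [d [k [QQ SE kmax ->]]]] := lambda_max_spectral n0 sS.
have trE (m : nat) : \tr (expmx (m%:R *: (S - t%:M))) =
    \sum_i expR (m%:R * (d 0 i - t)).
  have -> : m%:R *: (S - t%:M) = Q^T *m diag_mx (m%:R *: (d - const_mx t)) *m Q.
    have -> : diag_mx (m%:R *: (d - const_mx t)) = m%:R *: (diag_mx d - t%:M).
      by rewrite -diag_const_mx linearZ/= raddfB.
    rewrite -scalemxAr -scalemxAl mulmxBr mulmxBl -SE.
    by rewrite mul_mx_scalar -scalemxAl (mulmx1C QQ) scalemx1.
  rewrite expmx_diag_conj// mxtrace_mulC mulmxA QQ mul1mx mxtrace_diag.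
  by apply: eq_bigr => i _; rewrite !mxE.
split=> [tk m|H].
  rewrite trE (bigD1 k)//= (@le_trans _ _ (expR (m%:R * (d 0 k - t))))//.
    by rewrite -expR0 ler_expR mulr_ge0// subr_ge0.
  by rewrite lerDl sumr_ge0// => i _; exact: expR_ge0.
rewrite leNgt; apply/negP => kt.
pose e := t - d 0 k; have e0 : 0 < e by rewrite subr_gt0.
have H' (m : nat) : 1 <= n%:R * expR (- (m%:R * e)).
  rewrite (le_trans (H m))// trE (@le_trans _ _ (\sum_(i < n) expR (- (m%:R * e))))//.
    apply: ler_sum => i _; rewrite ler_expR -mulrN ler_wpM2l// /e opprB lerD2r.
    exact: kmax.
  by rewrite sumr_const card_ord -[leLHS]mulr_natl.
have [m hm] : exists m : nat, n%:R < 1 + m%:R * e.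
  exists (Num.truncn (n%:R / e)).+1.
  rewrite ltr_pwDl// -ler_pdivrMr// ltW// truncnS_gt.
  by [].
have := H' m; apply/negP; rewrite -ltNge expRN ltr_pdivrMr ?expR_gt0// mul1r.
exact: lt_le_trans hm (expR_ge1Dx _).
Qed.

End spectral_inequalities.

(** * Complex matrices as real blocks *)

Section rotation_blocks.
Context {R : realType} {n : nat}.
Implicit Types (A B H : 'M[R]_n) (X : 'M[R]_(n + n)).

(* A complex matrix A + i B is encoded as A (+) A + J (B (+) B). *)
Definition rotJ : 'M[R]_(n + n) := block_mx 0 (- 1%:M) 1%:M 0.
Definition dbl H : 'M[R]_(n + n) := block_mx H 0 0 H.

Lemma dblM A B : dbl (A *m B) = dbl A *m dbl B.
Proof. by rewrite /dbl mulmx_block !mulmx0 !mul0mx !addr0 !add0r. Qed.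

Lemma dbl_scalar (c : R) : dbl c%:M = c%:M.
Proof. by rewrite /dbl -scalar_mx_block. Qed.

Lemma dblD A B : dbl (A + B) = dbl A + dbl B.
Proof. by rewrite /dbl add_block_mx !addr0. Qed.

Lemma dblZ (c : R) A : dbl (c *: A) = c *: dbl A.
Proof. by rewrite -!mul_scalar_mx dblM dbl_scalar. Qed.

Lemma dblN A : dbl (- A) = - dbl A.
Proof. by rewrite -scaleN1r dblZ scaleN1r. Qed.

Lemma dbl_tr A : (dbl A)^T = dbl A^T.
Proof. by rewrite /dbl tr_block_mx !trmx0. Qed.

Lemma dbl_sym A : A \is symmetricmx -> dbl A \is symmetricmx.
Proof. by rewrite !symmetricmx_trmx dbl_tr => /eqP ->. Qed.

Lemma rotJ_dbl A : rotJ *m dbl A = dbl A *m rotJ.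
Proof.
rewrite /rotJ /dbl !mulmx_block !mulmx0 !mul0mx !addr0 !add0r.
by rewrite !mulNmx !mulmxN !mul1mx !mulmx1.
Qed.

Lemma rotJ_tr : rotJ^T = - rotJ.
Proof. by rewrite /rotJ tr_block_mx !trmx0 linearN/= trmx1 opp_block_mx !oppr0 opprK. Qed.

Lemma rotJ_sqr : rotJ *m rotJ = - 1%:M.
Proof.
rewrite /rotJ mulmx_block !mulmx0 !mul0mx !addr0 !add0r mulNmx mulmxN !mul1mx.
by rewrite -[X in _ = - X]dbl_scalar -dblN.
Qed.

Lemma rotJ_dbl_skew A : A \is symmetricmx ->
  (rotJ *m dbl A)^T = - (rotJ *m dbl A).
Proof.
rewrite symmetricmx_trmx => /eqP sA.
by rewrite trmx_mul dbl_tr sA rotJ_tr mulmxN rotJ_dbl.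
Qed.

Lemma dbl_psd A : psd A -> psd (dbl A).
Proof.
move=> [sA pA]; split; first exact: dbl_sym.
move=> v; rewrite -[v]hsubmxK /dbl mul_row_block tr_row_mx mul_row_col.
by rewrite !mulmx0 addr0 add0r mxE addr_ge0.
Qed.

Lemma dbl_loewner A B : loewner_le A B -> loewner_le (dbl A) (dbl B).
Proof. by rewrite /loewner_le -dblN -dblD => /dbl_psd. Qed.

(** Commuting with [rotJ] forces the blocks A, B in the first row and -B, A in the second, so |X|^2
    = 2 (|A|^2 + |B|^2), while the row on the left is (v A, v B). The factor 2 later compensates the
    doubled dimension. *)
Lemma comm_rotJ_half X (v : 'rV[R]_n) : X *m rotJ = rotJ *m X -> fdot v v = 1 ->
  2 * fdot (row_mx v 0 *m X) (row_mx v 0 *m X) <= fdot X X.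
Proof.
move=> XJ v1; rewrite -[X]submxK.
have : block_mx (ulsubmx X) (ursubmx X) (dlsubmx X) (drsubmx X) *m rotJ =
  rotJ *m block_mx (ulsubmx X) (ursubmx X) (dlsubmx X) (drsubmx X) by rewrite submxK.
set A := ulsubmx X; set B := ursubmx X; set C := dlsubmx X; set D := drsubmx X.
rewrite /rotJ !mulmx_block !mulmx0 !mul0mx !addr0 !add0r.
rewrite !mulNmx !mulmxN !mul1mx !mulmx1.
move=> /eq_block_mx[BC AD _ _].
have -> : D = A by rewrite -[D]opprK -AD opprK.
have -> : C = - B by rewrite BC opprK.
have block_fdot (P Q S T : 'M[R]_n) :
    fdot (block_mx P Q S T) (block_mx P Q S T) =
    fdot P P + fdot Q Q + (fdot S S + fdot T T).
  by rewrite /fdot tr_block_mx mulmx_block mxtrace_block !mxtraceD.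
have row_fdot (u w : 'rV[R]_n) : fdot (row_mx u w) (row_mx u w) = fdot u u + fdot w w.
  by rewrite /fdot tr_row_mx mul_row_col mxtraceD.
have vle (M : 'M[R]_n) : fdot (v *m M) (v *m M) <= fdot M M.
  rewrite -!sqr_fnorm ler_sqr ?nnegrE ?fnorm_ge0// (le_trans (fnormM _ _))//.
  by rewrite /fnorm v1 sqrtr1 mul1r.
rewrite mul_row_block !mul0mx !addr0 row_fdot block_fdot fdotNl fdotNr opprK.
have := vle A; have := vle B; lra.
Qed.

End rotation_blocks.

(** * Bounded measurable functions and Markov operators *)

Section bounded_measurable.
Context {R : realType} {d : measure_display} {T : measurableType d}.
Implicit Types f g : T -> R.

(** A class closed under the algebraic operations used below, on which integrability against a
    probability is automatic. *)
Definition bmfun f := measurable_fun [set: T] f /\ exists M, forall x, `|f x| <= M.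

Lemma bmfun_cst c : bmfun (fun=> c).
Proof. by split; [exact: measurable_cst|exists `|c|]. Qed.

Lemma bmfunD f g : bmfun f -> bmfun g -> bmfun (fun x => f x + g x).
Proof.
move=> [mf [M fM]] [mg [N gN]]; split; first exact: measurable_funD.
by exists (M + N) => x; rewrite (le_trans (ler_normD _ _))// lerD.
Qed.

Lemma bmfunM f g : bmfun f -> bmfun g -> bmfun (fun x => f x * g x).
Proof.
move=> [mf [M fM]] [mg [N gN]]; split; first exact: measurable_funM.
by exists (M * N) => x; rewrite normrM ler_pM.
Qed.

Lemma bmfunZ c f : bmfun f -> bmfun (fun x => c * f x).
Proof. exact/bmfunM/bmfun_cst. Qed.

Lemma bmfunN f : bmfun f -> bmfun (fun x => - f x).
Proof.
move=> /(bmfunZ (-1)) h; rewrite (_ : (fun x => - f x) = (fun x => -1 * f x))//.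
by apply/funext => x; rewrite mulN1r.
Qed.

Lemma bmfunB f g : bmfun f -> bmfun g -> bmfun (fun x => f x - g x).
Proof. by move=> bf /bmfunN; exact: bmfunD. Qed.

Lemma bmfunX f k : bmfun f -> bmfun (fun x => f x ^+ k).
Proof.
move=> bf; elim: k => [|k IH]; first exact: bmfun_cst.
by under eq_fun do rewrite exprS; exact: bmfunM.
Qed.

Lemma bmfun_sum (I : Type) (s : seq I) (f : I -> T -> R) :
  (forall i, bmfun (f i)) -> bmfun (fun x => \sum_(i <- s) f i x).
Proof.
move=> bf; elim: s => [|i s IH]; first by under eq_fun do rewrite big_nil; exact: bmfun_cst.
by under eq_fun do rewrite big_cons; exact: bmfunD.
Qed.

Lemma bmfun_indic A : measurable A -> bmfun (\1_A : T -> R).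
Proof.
move=> mA; split; first exact: measurable_indic.
by exists 1 => x; rewrite indicE; case: (_ \in _); rewrite ?normr1 ?normr0.
Qed.

Section integral.
Variable mu : {measure set T -> \bar R}.
Hypothesis mu1 : mu setT = 1%E.

Lemma bmfun_integrable f : bmfun f -> mu.-integrable setT (EFin \o f).
Proof.
move=> [mf [M fM]]; apply: measurable_bounded_integrable => //.
  by rewrite mu1 ltry.
exists M; split; first exact: num_real.
by move=> x Mx y _; exact: le_trans (fM y) (ltW Mx).
Qed.

Lemma bmfun_fineK f : bmfun f ->
  (\int[mu]_x (f x)%:E)%E = (\int[mu]_x f x)%:E.
Proof.
move=> bf; rewrite /Rintegral fineK//.
by apply: integrable_fin_num => //; exact: bmfun_integrable.
Qed.

Lemma RintD f g : bmfun f -> bmfun g ->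
  \int[mu]_x (f x + g x) = \int[mu]_x f x + \int[mu]_x g x.
Proof. by move=> bf bg; apply: RintegralD => //; exact: bmfun_integrable. Qed.

Lemma RintB f g : bmfun f -> bmfun g ->
  \int[mu]_x (f x - g x) = \int[mu]_x f x - \int[mu]_x g x.
Proof. by move=> bf bg; apply: RintegralB => //; exact: bmfun_integrable. Qed.

Lemma RintZ c f : bmfun f -> \int[mu]_x (c * f x) = c * \int[mu]_x f x.
Proof. by move=> bf; apply: RintegralZl => //; exact: bmfun_integrable. Qed.

Lemma Rint_cst (c : R) : \int[mu]_x c = c.
Proof. by rewrite Rintegral_cst// mu1/= mulr1. Qed.

Lemma le_Rint f g : bmfun f -> bmfun g -> (forall x, f x <= g x) ->
  \int[mu]_x f x <= \int[mu]_x g x.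
Proof. by move=> bf bg fg; apply: le_Rintegral => //; exact: bmfun_integrable. Qed.

Lemma Rint_ge0 f : (forall x, 0 <= f x) -> 0 <= \int[mu]_x f x.
Proof. by move=> f0; apply: Rintegral_ge0 => x _. Qed.

Lemma Rint_sum (I : Type) (s : seq I) (f : I -> T -> R) :
  (forall i, bmfun (f i)) ->
  \int[mu]_x (\sum_(i <- s) f i x) = \sum_(i <- s) \int[mu]_x f i x.
Proof.
move=> bf; elim: s => [|i s IH].
  by rewrite big_nil; under eq_Rintegral do rewrite big_nil; rewrite Rint_cst.
rewrite big_cons -IH -RintD//; last exact: bmfun_sum.
by apply: eq_Rintegral => x _; rewrite big_cons.
Qed.

Lemma Rint_indic A : measurable A -> \int[mu]_x (\1_A x : R) = fine (mu A).
Proof. by move=> mA; rewrite /Rintegral integral_indic// setIT. Qed.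

End integral.

(** Covers integrals, [markov_op] at a point and weighted integrals alike; monotonicity takes the
    place of continuity in the extension from indicators. *)
Definition mono_linear (L : (T -> R) -> R) :=
  (forall c f g, bmfun f -> bmfun g -> L (fun x => f x + c * g x) = L f + c * L g) /\
  (forall f g, bmfun f -> bmfun g -> (forall x, f x <= g x) -> L f <= L g).

Lemma mono_linear_sum L n (c : 'I_n -> R) (f : 'I_n -> T -> R) :
  mono_linear L -> (forall i, bmfun (f i)) ->
  L (fun x => \sum_i c i * f i x) = \sum_i c i * L (f i).
Proof.
move=> [Lin _]; elim: n c f => [|n IH] c f bf.
  rewrite big_ord0; have := Lin 1 (fun=> 0) (fun=> 0) (bmfun_cst 0) (bmfun_cst 0).
  rewrite (_ : (fun x => 0 + 1 * 0) = (fun=> 0)) => [h|]; last by apply/funext => x; ring.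
  have -> : (fun x => \sum_(i < 0) c i * f i x) = fun=> 0.
    by apply/funext => x; rewrite big_ord0.
  lra.
have -> : (fun x => \sum_i c i * f i x) = (fun x =>
    \sum_(i < n) c (widen_ord (leqnSn n) i) * f (widen_ord (leqnSn n) i) x + c ord_max * f ord_max x).
  by apply/funext => x; rewrite big_ord_recr.
rewrite Lin//; last by apply: bmfun_sum => i; exact: bmfunZ.
by rewrite IH ?big_ord_recr// => i; exact: bf.
Qed.

(** The sum counts the integers in [1, t], so it is the integer part of t. *)
Lemma sum_threshold (n : nat) (t : R) : 0 <= t <= n%:R ->
  0 <= t - \sum_(k < n) (k.+1%:R <= t)%R%:R <= 1.
Proof.
elim: n t => [|n IH] t /andP[t0 tn].
  by rewrite big_ord0 subr0 t0 (le_trans tn).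
rewrite big_ord_recr/=; case: (leP t n%:R) => tn'.
  have -> : (n.+1%:R <= t) = false.
    by apply/negbTE; rewrite -ltNge (le_lt_trans tn')// ltr_nat.
  by rewrite addr0 IH// t0.
have -> : \sum_(k < n) ((k.+1%:R <= t)%R%:R : R) = n%:R.
  rewrite (eq_bigr (fun=> 1)) ?sumr_const ?card_ord// => k _.
  by rewrite (le_trans _ (ltW tn'))// ler_nat.
have := tn; rewrite -natr1 => tn1.
by case: (leP (n%:R + 1) t) => h /=; apply/andP; split; lra.
Qed.

(* A bounded measurable function is uniformly approximated by a combination of
   the indicators of its super-level sets. *)
Lemma mono_linear_ext (L1 L2 : (T -> R) -> R) :
  mono_linear L1 -> mono_linear L2 ->
  (forall A, measurable A -> L1 (\1_A) = L2 (\1_A)) ->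
  forall f, bmfun f -> L1 f = L2 f.
Proof.
move=> lin1 lin2 eqI f bf; have [mf [M0 fM0]] := bf.
have one : (\1_setT : T -> R) = fun=> 1.
  by apply/funext => x; rewrite indicE in_setT.
pose M := `|M0| + 1; have M_gt0 : 0 < M by rewrite ltr_wpDl.
have fM x : `|f x| <= M.
  by rewrite (le_trans (fM0 x))// (le_trans (ler_norm _))// lerDl.
pose D := `|L1 (\1_setT)|.
apply/eqP; rewrite -subr_eq0 -normr_le0; apply/ler_addgt0Pl => e e0.
rewrite addr0.
have D0 : 0 <= D by exact: normr_ge0.
(* With mesh w = 2 M / N, this choice of N keeps w * L1(1) below e. *)
have [n hn] : exists n : nat, 4 * M * D <= e * n.+1%:R.
  exists (Num.truncn (4 * M * D / e)).
  by rewrite [e * _]mulrC -ler_pdivrMr// ltW// truncnS_gt.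
set N := n.+1%:R in hn; have N0 : 0 < N by rewrite ltr0n.
pose w := 2 * M / N; have w0 : 0 < w by rewrite divr_gt0 ?mulr_gt0.
pose A (k : 'I_n.+1) := [set x | k.+1%:R <= (f x + M) / w].
have mA k : measurable (A k).
  rewrite -[A k]setTI.
  have -> : A k = (fun x => (f x + M) / w) @^-1` `[k.+1%:R, +oo[.
    by apply/seteqP; split => x; rewrite /A/= in_itv/= andbT.
  apply: measurable_funM => //; exact: measurable_funD.
pose s x := \sum_(k < n.+1) w * \1_(A k) x + (- M) * \1_setT x.
have bA k : bmfun (\1_(A k) : T -> R) by exact: bmfun_indic.
have bT : bmfun (\1_setT : T -> R) by exact: bmfun_indic.
have bs1 : bmfun (fun x => \sum_(k < n.+1) w * \1_(A k) x).
  by apply: bmfun_sum => k; exact: bmfunZ.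
have bs : bmfun s by apply: bmfunD => //; exact: bmfunZ.
have close x : s x <= f x <= s x + w * \1_setT x.
  have h : 0 <= (f x + M) / w <= N.
    have := fM x; rewrite ler_norml => /andP[h1 h2].
    apply/andP; split; first by rewrite divr_ge0 ?(ltW w0)//; lra.
    rewrite ler_pdivrMr// /w [N * _](_ : _ = 2 * M); first by lra.
    by field; rewrite gt_eqF.
  have := sum_threshold h; rewrite /s one mulr1.
  set S := \sum_(k < _) _.
  have -> : \sum_(k < n.+1) w * \1_(A k) x = w * S.
    rewrite mulr_sumr; apply: eq_bigr => k _; rewrite indicE; congr (_ * _%:R).
    by rewrite /A mem_setE.
  have fE : f x = w * ((f x + M) / w) - M by field; rewrite gt_eqF.
  move=> /andP[h1 h2].
  have := ler_wpM2l (ltW w0) h2; have := ler_wpM2l (ltW w0) h1.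
  by move=> h3 h4; apply/andP; split; lra.
have Ls L : mono_linear L -> L s = \sum_(k < n.+1) w * L (\1_(A k)) + (- M) * L (\1_setT).
  by move=> lin; rewrite /s (lin.1 _ _ _ bs1 bT) mono_linear_sum.
have bnd L : mono_linear L -> L s <= L f <= L s + w * L (\1_setT).
  move=> lin; apply/andP; split.
    by apply: lin.2 => // x; have /andP[] := close x.
  rewrite -lin.1//; apply: lin.2 => //; first by apply: bmfunD => //; exact: bmfunZ.
  by move=> x; have /andP[] := close x.
have LsE : L1 s = L2 s.
  by rewrite !Ls// eqI//; congr (_ + _); apply: eq_bigr => k _; rewrite eqI.
have := bnd _ lin1; have := bnd _ lin2; rewrite LsE -(eqI setT)//.
have : w * L1 (\1_setT) <= e.
  apply: (@le_trans _ _ (w * D)); first by rewrite ler_wpM2l ?ler_norm ?ltW.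
  rewrite /w mulrAC ler_pdivrMr//; move: hn; have := mulr_ge0 (ltW M_gt0) D0; lra.
move=> h1 /andP[h2 h3] /andP[h4 h5].
by rewrite ler_norml; apply/andP; split; lra.
Qed.

End bounded_measurable.

(** * The Markov operator and its contraction constant *)

Section markov_operator.
Context {R : realType} {d : measure_display} {T : measurableType d}.
Variable P : R.-pker T ~> T.

Let P1 x : P x setT = 1%E := @prob_kernel _ _ _ _ _ P x.

Lemma bmfun_markov_op h : bmfun h -> bmfun (markov_op P h).
Proof.
move=> [mh [M hM]]; have bh : bmfun h by split => //; exists M.
split; last first.
  exists M => x; rewrite /markov_op.
  rewrite (le_trans (le_normr_Rintegral _ _))//; first exact: bmfun_integrable.
  rewrite -[leRHS](Rint_cst (P1 x)); apply: le_Rint => //.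
    by split; [exact: measurableT_comp|exists M => y; rewrite normr_id].
  exact: bmfun_cst.
(* Measurability of a kernel integral is applied to a nonnegative integrand, whence the shift by the
   bound M. *)
have -> : markov_op P h = fun x => fine (\int[P x]_y (h y + M)%:E)%E - M.
  apply/funext => x; rewrite (bmfun_fineK (P1 x)); last exact/bmfunD/bmfun_cst.
  rewrite /= RintD//; last exact: bmfun_cst.
  by rewrite Rint_cst// addrK.
apply: measurable_funB => //; apply: measurableT_comp => //.
apply: measurable_fun_integral_kernel.
- by move=> U mU; exact: measurable_kernel.
- move=> y; rewrite lee_fin -lerBlDr sub0r lerNl (le_trans (ler_norm _))// normrN.
  exact: hM.
- by apply/measurable_EFinP; exact: measurable_funD.
Qed.

Lemma markov_op_mono_linear x : mono_linear (fun h => markov_op P h x).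
Proof.
split=> [c f g bf bg|f g bf bg fg]; rewrite /markov_op.
  by rewrite (RintD (P1 x))//; [rewrite (RintZ (P1 x))|exact: bmfunZ].
exact: (le_Rint (P1 x)).
Qed.

Lemma markov_opD f g : bmfun f -> bmfun g ->
  markov_op P (fun x => f x + g x) = fun x => markov_op P f x + markov_op P g x.
Proof. by move=> bf bg; apply/funext => x; exact: (RintD (P1 x)). Qed.

Lemma markov_op_cst c : markov_op P (fun=> c) = fun=> c.
Proof. by apply/funext => x; exact: (Rint_cst (P1 x)). Qed.

Lemma Rint_mono_linear (mu : {measure set T -> \bar R}) :
  mu setT = 1%E -> mono_linear (fun f => \int[mu]_x f x).
Proof.
move=> mu1; split=> [c f g bf bg|f g bf bg fg].
  by rewrite (RintD mu1)//; [rewrite (RintZ mu1)|exact: bmfunZ].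
exact: (le_Rint mu1).
Qed.

Section stationary.
Variable mu : probability T R.
Hypothesis hstat : stationary P mu.
Let mu1 : mu setT = 1%E := probability_setT mu.

Lemma Rint_markov_op h : bmfun h -> \int[mu]_x markov_op P h x = \int[mu]_x h x.
Proof.
move: h; apply: mono_linear_ext.
- split=> [c f g bf bg|f g bf bg fg].
    have [Pf Pg] := (bmfun_markov_op bf, bmfun_markov_op bg).
    rewrite -(RintZ mu1 c Pg) -(RintD mu1 Pf (bmfunZ c Pg)).
    by apply: eq_Rintegral => x _; exact: (markov_op_mono_linear x).1.
  apply: (le_Rint mu1); [exact: bmfun_markov_op|exact: bmfun_markov_op|].
  by move=> x; exact: (markov_op_mono_linear x).2.
- exact: Rint_mono_linear.
- move=> A mA; rewrite [RHS]Rint_indic// /Rintegral; congr fine.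
  transitivity (\int[mu]_x P x A)%E; last exact: hstat.
  apply: eq_integral => x _; rewrite /markov_op Rint_indic// fineK//.
  have : (P x A <= P x setT)%E by apply: le_measure; rewrite ?inE.
  by rewrite P1 ge0_fin_numE// => /le_lt_trans; apply; exact: ltry.
Qed.

(** Jensen for P x, by expanding a variance. Only measurability of [h] is assumed because [lambda]
    ranges over all of L^2; if the right-hand side is infinite there is nothing to prove. *)
Lemma markov_op_sqr_le h x : measurable_fun setT h ->
  ((markov_op P h x ^+ 2)%:E <= \int[P x]_y (h y ^+ 2)%:E)%E.
Proof.
move=> mh.
have mh2 : measurable_fun setT (fun y => h y ^+ 2) by exact: measurable_funX.
have [fin|inf] := ltP (\int[P x]_y (h y ^+ 2)%:E)%E +oo%E; last first.
  by rewrite (le_trans _ inf)// leey.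
have i2 : (P x).-integrable setT (EFin \o (fun y => h y ^+ 2)).
  apply/integrableP; split; first exact/measurable_EFinP.
  rewrite (eq_integral (fun y => (h y ^+ 2)%:E))// => y _ /=.
  by rewrite ger0_norm// sqr_ge0.
have i1 : (P x).-integrable setT (EFin \o h).
  apply: (@le_integrable _ _ _ (P x) _ measurableT _ (EFin \o (fun y => 1 + h y ^+ 2))).
  - exact/measurable_EFinP.
  - move=> y _ /=; rewrite lee_fin [leRHS]ger0_norm ?addr_ge0 ?sqr_ge0//.
    by rewrite ler_norml; have := sqr_ge0 (h y - 1); have := sqr_ge0 (h y + 1); lra.
  - have := integrableD measurableT (bmfun_integrable (P1 x) (bmfun_cst 1)) i2.
    by apply: eq_integrable => // y _.
rewrite -[leRHS]fineK; last by rewrite ge0_fin_numE// integral_ge0// => y _; rewrite lee_fin sqr_ge0.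
rewrite lee_fin -/(Rintegral _ _ _).
set m := markov_op P h x.
have ic : (P x).-integrable setT (EFin \o (fun=> m ^+ 2 : R)).
  exact: (bmfun_integrable (P1 x) (bmfun_cst _)).
have iZ : (P x).-integrable setT (EFin \o (fun y => 2 * m * h y)).
  by have := integrableZl measurableT (2 * m) i1.
have : 0 <= \int[P x]_y (h y ^+ 2 - 2 * m * h y + m ^+ 2).
  apply: Rintegral_ge0 => y _.
  by have := sqr_ge0 (h y - m); lra.
have iB : (P x).-integrable setT (EFin \o (fun y => h y ^+ 2 - 2 * m * h y)).
  by have := integrableB measurableT i2 iZ; apply: eq_integrable => // y _.
rewrite RintegralD//.
rewrite RintegralB// RintegralZl// (Rint_cst (P1 x)) -/(markov_op P h x) -/m.
by rewrite /Rintegral; lra.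
Qed.


Lemma measurable_markov_op h : measurable_fun setT h ->
  measurable_fun setT (markov_op P h).
Proof.
move=> mh; have meh : measurable_fun setT (EFin \o h) by exact/measurable_EFinP.
have -> : markov_op P h = fun x => fine (\int[P x]_y (EFin \o h)^\+ y -
    \int[P x]_y (EFin \o h)^\- y)%E.
  by apply/funext => x; rewrite /markov_op /Rintegral integralE.
apply: measurableT_comp => //; apply: emeasurable_funB.
  apply: measurable_fun_integral_kernel => //.
    by move=> U mU; exact: measurable_kernel.
  exact: measurable_funepos.
apply: measurable_fun_integral_kernel => //.
  by move=> U mU; exact: measurable_kernel.
exact: measurable_funeneg.
Qed.

(** Stationarity is available for bounded functions; it is applied to the truncations min(h^2, N),
    with monotone convergence inside and outside. *)
Lemma integral_markov_sqr_le (h : T -> R) : measurable_fun setT h ->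
  (\int[mu]_x \int[P x]_y (h y ^+ 2)%:E <= \int[mu]_x (h x ^+ 2)%:E)%E.
Proof.
move=> mh; have mh2 : measurable_fun setT (fun y => h y ^+ 2) by exact: measurable_funX.
pose f (N : nat) y : R := Order.min (h y ^+ 2) N%:R.
have f0 N y : 0 <= f N y by rewrite le_min sqr_ge0/=.
have bf N : bmfun (f N).
  split; first exact: measurable_minr.
  by exists N%:R => y; rewrite ger0_norm// ge_min lexx orbT.
have fle N y : f N y <= h y ^+ 2 by rewrite ge_min lexx.
have mf N : measurable_fun setT (EFin \o f N) by exact/measurable_EFinP/(bf N).1.
have fh y : (fun N => (f N y)%:E) @ \oo --> (h y ^+ 2)%:E.
  apply: cvg_EFin; first exact: nearW.
  apply: cvg_near_cst; exists (Num.truncn (h y ^+ 2)).+1 => // N /= hN.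
  by apply/min_idPl; rewrite ltW// (lt_le_trans (truncnS_gt _))// ler_nat.
have nd y : {homo (fun N => (f N y)%:E) : n m / (n <= m)%N >-> (n <= m)%E}.
  move=> N M NM; rewrite lee_fin le_min ge_min lexx/= ge_min.
  by rewrite ler_nat NM orbT.
have intE x : (\int[P x]_y (h y ^+ 2)%:E = limn (fun N => (markov_op P (f N) x)%:E))%E.
  transitivity (\int[P x]_y limn (fun N => (f N y)%:E))%E.
    by apply: eq_integral => y _; apply/esym/cvg_lim.
  rewrite monotone_convergence//.
  - by congr (lim (_ @ \oo)); apply/funext => N; rewrite (bmfun_fineK (P1 x)).
  - by move=> N y _; rewrite lee_fin.
rewrite (eq_integral _ _ (fun x _ => intE x)) monotone_convergence//.
- apply: lime_le.
    apply: ereal_nondecreasing_is_cvgn => N M NM.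
    apply: ge0_le_integral => //.
    + by move=> x _; rewrite lee_fin; exact: (Rint_ge0).
    + exact/measurable_EFinP/(bmfun_markov_op (bf N)).1.
    + exact/measurable_EFinP/(bmfun_markov_op (bf M)).1.
    + move=> x _; rewrite lee_fin; apply: (markov_op_mono_linear x).2 => // y.
      by have := nd y _ _ NM; rewrite lee_fin.
  apply: nearW => N; rewrite (bmfun_fineK mu1); last exact: bmfun_markov_op.
  rewrite Rint_markov_op// -(bmfun_fineK mu1)//; apply: ge0_le_integral => //.
  + by move=> x _; rewrite lee_fin.
  + exact: mf.
  + exact/measurable_EFinP.
  + by move=> x _; rewrite lee_fin.
- by move=> N; exact/measurable_EFinP/(bmfun_markov_op (bf N)).1.
- by move=> N x _; rewrite lee_fin; exact: Rint_ge0.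
- move=> x _ N M NM; rewrite lee_fin; apply: (markov_op_mono_linear x).2 => // y.
  by have := nd y _ _ NM; rewrite lee_fin.
Qed.

Lemma sqr_integral_markov_op_le (h : T -> R) : measurable_fun setT h ->
  (\int[mu]_x (markov_op P h x ^+ 2)%:E <= \int[mu]_x (h x ^+ 2)%:E)%E.
Proof.
move=> mh; apply: (le_trans _ (integral_markov_sqr_le mh)).
apply: ge0_le_integral => //.
- by move=> x _; rewrite lee_fin sqr_ge0.
- by apply/measurable_EFinP/measurable_funX; exact: measurable_markov_op.
- apply: measurable_fun_integral_kernel => //.
  + by move=> U mU; exact: measurable_kernel.
  + by move=> y; rewrite lee_fin sqr_ge0.
  + exact/measurable_EFinP/measurable_funX.
- by move=> x _; exact: markov_op_sqr_le.
Qed.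

Lemma Lnorm2E (nu : {measure set T -> \bar R}) (h : T -> R) :
  Lnorm nu 2%:E (EFin \o h) = ((\int[nu]_x (h x ^+ 2)%:E) `^ 2^-1)%E.
Proof.
rewrite unlock; congr (_ `^ _)%E; apply: eq_integral => x _ /=.
by rewrite -[2]/(2%:R) powR_mulrn ?normr_ge0// real_normK ?num_real.
Qed.

Let fineLnorm h : bmfun h ->
  fine (Lnorm mu 2%:E (EFin \o h)) = Num.sqrt (\int[mu]_x (h x ^+ 2)).
Proof.
move=> bh; rewrite Lnorm2E (bmfun_fineK mu1); last exact: bmfunX.
by rewrite poweR_EFin/= powR12_sqrt// Rint_ge0// => x; exact: sqr_ge0.
Qed.

Let lambda_set := [set r | exists h : T -> R,
  [/\ h \in Lfun mu 2%:E, Lnorm mu 2%:E (EFin \o h) != 0%E, ('E_mu[h] = 0)%E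
    & r = fine (Lnorm mu 2%:E (EFin \o markov_op P h))
          / fine (Lnorm mu 2%:E (EFin \o h))]].

(** A [sup] dominates the elements of its set only if the set is bounded above; Jensen and
    stationarity provide the bound 1. *)
Let lambda_ub : ubound lambda_set 1.
Proof.
move=> r [h [hL h0 _ ->]].
have [mh fh] : measurable_fun setT h /\ (Lnorm mu 2%:E (EFin \o h) < +oo)%E.
  by move: hL => /andP[]; rewrite !inE.
have h_fin : Lnorm mu 2%:E (EFin \o h) \is a fin_num by rewrite ge0_fin_numE ?Lnorm_ge0.
have le : (Lnorm mu 2%:E (EFin \o markov_op P h) <= Lnorm mu 2%:E (EFin \o h))%E.
  rewrite !Lnorm2E; apply: gt0_ler_poweR => //.
  - by rewrite in_itv/= integral_ge0 ?leey// => x _; rewrite lee_fin sqr_ge0.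
  - by rewrite in_itv/= integral_ge0 ?leey// => x _; rewrite lee_fin sqr_ge0.
  - exact: sqr_integral_markov_op_le.
have Ph_fin : Lnorm mu 2%:E (EFin \o markov_op P h) \is a fin_num.
  by rewrite ge0_fin_numE ?Lnorm_ge0// (le_lt_trans le).
rewrite ler_pdivrMr ?mul1r; first by rewrite fine_le.
by rewrite fine_gt0// fh andbT lt0e h0 Lnorm_ge0.
Qed.

Lemma lambda_ge0 : 0 <= lambda P mu.
Proof.
rewrite /lambda -/lambda_set; have [->|/set0P[r rL]] := eqVneq lambda_set set0.
  by rewrite sup0.
apply: (@le_trans _ _ r); last by apply: ub_le_sup => //; exists 1.
by case: rL => h [_ _ _ ->]; rewrite divr_ge0 ?fine_ge0 ?Lnorm_ge0.
Qed.

Lemma lambda_contraction h : bmfun h -> \int[mu]_x h x = 0 ->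
  \int[mu]_x (markov_op P h x ^+ 2) <= lambda P mu ^+ 2 * \int[mu]_x (h x ^+ 2).
Proof.
move=> bh h0; have bh2 := bmfunX 2 bh; have bPh := bmfun_markov_op bh.
set a := \int[mu]_x (h x ^+ 2).
have a0 : 0 <= a by apply: Rint_ge0 => x; exact: sqr_ge0.
have Pa0 : 0 <= \int[mu]_x (markov_op P h x ^+ 2).
  by apply: Rint_ge0 => x; exact: sqr_ge0.
(* If [h] vanishes in L^2 it does not enter the supremum; the plain L^2 contraction then shows that
   the left-hand side vanishes too. *)
have [az|anz] := eqVneq a 0.
  have := sqr_integral_markov_op_le bh.1.
  rewrite (bmfun_fineK mu1 bh2) (bmfun_fineK mu1 (bmfunX 2 bPh)) lee_fin.
  by rewrite -/a az mulr0.
have a_gt0 : 0 < a by rewrite lt_neqAle eq_sym anz.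
have Ln : Lnorm mu 2%:E (EFin \o h) = (Num.sqrt a)%:E.
  by rewrite Lnorm2E (bmfun_fineK mu1)// poweR_EFin powR12_sqrt.
rewrite -ler_pdivrMr// -[leLHS]sqr_sqrtr ?divr_ge0// lerXn2r ?nnegrE ?sqrtr_ge0 ?lambda_ge0//.
rewrite sqrtrM// sqrtrV//; apply: ub_le_sup; first by exists 1; exact: lambda_ub.
exists h; split => //.
- rewrite inE/=; apply/andP; split; rewrite inE/=; first exact: bh.1.
  by rewrite /finite_norm Ln ltry.
- by rewrite Ln eqe sqrtr_eq0 -ltNge.
- by rewrite unlock (bmfun_fineK mu1)// h0.
- by rewrite !fineLnorm.
Qed.

End stationary.
End markov_operator.

(** * The Markov property for bounded functions of the past *)

Section markov_property.
Context {R : realType} {d : measure_display} {T : measurableType d}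
  {P : R.-pker T ~> T} {mu : probability T R}
  {d' : measure_display} {Omega : measurableType d'}
  {Pr : probability Omega R} {n : nat}.
Variable s : 'I_n -> {RV Pr >-> T}.
Hypothesis hs : markov_chain P mu s.

Definition history_gen (i : nat) : set (set Omega) :=
  \bigcup_(k in [set k : 'I_n | (k <= i)%N])
    preimage_set_system setT (s k) measurable.

(** [Omega] with the sigma-algebra of the chain up to time [i]: a [bmfun] on this type is a bounded
    function measurable with respect to the past. *)
Definition history_type (i : nat) := g_sigma_algebraType (history_gen i).

Let Pr1 : Pr setT = 1%E := probability_setT Pr.

Lemma bmfun_rv k (f : T -> R) : bmfun f -> bmfun (fun w => f (s k w)).
Proof.
move=> [mf [M fM]]; split; last by exists M => w.
by apply: measurableT_comp => //; exact: measurable_funPT.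
Qed.

Lemma bmfun_history (k : 'I_n) i (f : T -> R) : (k <= i)%N -> bmfun f ->
  bmfun (fun w : history_type i => f (s k w)).
Proof.
move=> ki [mf [M fM]]; split; last by exists M => w.
apply: (measurableT_comp mf) => _ B mB; apply: sub_sigma_algebra.
by exists k => //; exists B.
Qed.

Lemma measurable_history i (E : set Omega) :
  @measurable _ (history_type i) E -> measurable E.
Proof.
apply: smallest_sub; first exact: sigma_algebra_measurable.
by move=> _ [k _ [B mB <-]]; rewrite setTI -[_ @^-1` _]setTI; exact: measurable_funPT.
Qed.

Lemma bmfun_history_sub i (g : Omega -> R) :
  @bmfun _ _ (history_type i) g -> bmfun g.
Proof.
move=> [mg bg]; split=> // _ B mB; apply: (@measurable_history i).
exact: mg.
Qed.

Lemma Rint_initial (i : 'I_n) (f : T -> R) : i = 0 :> nat -> bmfun f ->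
  \int[Pr]_w f (s i w) = \int[mu]_x f x.
Proof.
move=> i0; move: f; apply: mono_linear_ext.
- have [lin mono] := Rint_mono_linear Pr1.
  split=> [c f g bf bg|f g bf bg fg].
    exact: lin (bmfun_rv i bf) (bmfun_rv i bg).
  by apply: mono => //; exact: bmfun_rv.
- exact: Rint_mono_linear (probability_setT mu).
- move=> A mA; rewrite [RHS]Rint_indic//.
  rewrite (_ : (fun w => \1_A (s i w)) = \1_(s i @^-1` A)) //.
  have mE : measurable (s i @^-1` A).
    by rewrite -[_ @^-1` _]setTI; exact: measurable_funPT.
  by rewrite [LHS]Rint_indic//; congr fine; exact: hs.1.
Qed.

Lemma mono_linear_rv (k : 'I_n) (g : Omega -> R) (Q : (T -> R) -> T -> R) :
  bmfun g -> (forall w, 0 <= g w) ->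
  (forall x, mono_linear (fun h => Q h x)) -> (forall h, bmfun h -> bmfun (Q h)) ->
  mono_linear (fun h => \int[Pr]_w (g w * Q h (s k w))).
Proof.
move=> bg g0 linQ bQ; have bgQ h : bmfun h -> bmfun (fun w => g w * Q h (s k w)).
  by move=> bh; apply: bmfunM => //; exact: bmfun_rv (bQ _ bh).
split=> [c f h bf bh|f h bf bh fh].
  rewrite -(RintZ Pr1 c (bgQ _ bh)) -(RintD Pr1 (bgQ _ bf) (bmfunZ c (bgQ _ bh))).
  by apply: eq_Rintegral => w _; rewrite (linQ _).1//; ring.
apply: (le_Rint Pr1); [exact: bgQ|exact: bgQ|move=> w].
by apply: ler_wpM2l => //; exact: (linQ _).2.
Qed.

Lemma mono_linear_weight i (h : Omega -> R) : bmfun h -> (forall w, 0 <= h w) ->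
  mono_linear (fun g : history_type i -> R => \int[Pr]_w (g w * h w)).
Proof.
move=> bh h0; have bM (g : history_type i -> R) : bmfun g ->
    bmfun (fun w : Omega => g w * h w).
  by move=> bg; apply: bmfunM => //; exact: bmfun_history_sub bg.
split=> [c f g bf bg|f g bf bg fg].
  rewrite -(RintZ Pr1 c (bM _ bg)) -(RintD Pr1 (bM _ bf) (bmfunZ c (bM _ bg))).
  by apply: eq_Rintegral => w _; ring.
by apply: (le_Rint Pr1); [exact: bM|exact: bM|move=> w; exact: ler_wpM2r].
Qed.

(** The defining identity concerns events; [mono_linear_ext] extends it in [g] and in [h]
    separately. *)
Lemma markov_property (i j : 'I_n) (g : history_type i -> R) (h : T -> R) :
  j = i.+1 :> nat -> bmfun g -> bmfun h ->
  \int[Pr]_w (g w * h (s j w)) = \int[Pr]_w (g w * markov_op P h (s i w)).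
Proof.
move=> ij bg bh.
(* Monotonicity in [g] requires a nonnegative [h], obtained by adding a constant, which [markov_op]
   preserves. *)
wlog h0 : h bh / forall x, 0 <= h x.
  move=> wl; have [_ [M hM]] := bh.
  have bg' : bmfun (g : Omega -> R) by exact: bmfun_history_sub bg.
  have bhM : bmfun (fun x => h x + M) by exact/bmfunD/bmfun_cst.
  have := wl (fun x => h x + M) bhM.
  have hM0 x : 0 <= h x + M by have := hM x; rewrite ler_norml; lra.
  move=> /(_ hM0).
  rewrite (markov_opD P bh (bmfun_cst M)) markov_op_cst.
  have e (q : T -> R) k : bmfun q -> \int[Pr]_w (g w * (q (s k w) + M)) =
      \int[Pr]_w (g w * q (s k w)) + \int[Pr]_w (g w * M).
    move=> bq; rewrite -RintD//.
    - by apply: eq_Rintegral => w _; ring.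
    - by apply: bmfunM => //; exact: bmfun_rv.
    - by apply: bmfunM => //; exact: bmfun_cst.
  by rewrite e// e; [exact: addIr|exact: bmfun_markov_op].
move: g bg; apply: mono_linear_ext.
- by apply: mono_linear_weight => //; exact: bmfun_rv.
- apply: mono_linear_weight; first exact/bmfun_rv/bmfun_markov_op.
  by move=> w; exact: Rint_ge0.
move=> E mE; have mE' := measurable_history mE.
move: h bh {h0}; apply: mono_linear_ext.
- apply: (@mono_linear_rv j (\1_E) (fun h => h)) => //.
  + exact: bmfun_indic.
- apply: (@mono_linear_rv i (\1_E) (markov_op P)) => //.
  + exact: bmfun_indic.
  + exact: markov_op_mono_linear.
  + by move=> h; exact: bmfun_markov_op.
move=> A mA.
have mAj : measurable (s j @^-1` A).
  by rewrite -[_ @^-1` _]setTI; exact: measurable_funPT.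
transitivity (fine (Pr (E `&` s j @^-1` A))).
  rewrite -Rint_indic; last exact: measurableI.
  apply: eq_Rintegral => w _; rewrite !indicE in_setI mulr_natr -mulrnA mulnC.
  by rewrite mulnb andbC.
rewrite (hs.2 i j)// /Rintegral; congr fine; rewrite [LHS]integral_mkcond.
apply: eq_integral => w _; rewrite patchE indicE.
case: ifPn => wE; last by rewrite mul0r.
rewrite mul1r /markov_op Rint_indic// fineK//.
have : (P (s i w) A <= P (s i w) setT)%E by apply: le_measure; rewrite ?inE.
by rewrite prob_kernel ge0_fin_numE// => /le_lt_trans; apply; exact: ltry.
Qed.

End markov_property.

(** * The moment bound *)

Lemma expmxD (R : realType) n (A B : 'M[R]_n) : A *m B = B *m A ->
  expmx (A + B) = expmx A *m expmx B.
Proof.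
by move=> AB; apply: mxcvg_uniq (comm_pow_cvg AB); exact: (@expmx_pow_cvg _ _ (A + B)).
Qed.

Lemma fdot0r (R : realType) m n (A : 'M[R]_(m, n)) : fdot A 0 = 0.
Proof. by rewrite /fdot trmx0 mulmx0 mxtrace0. Qed.

Lemma psd_scalar (R : realType) n (c : R) : 0 <= c -> psd (c%:M : 'M[R]_n).
Proof.
move=> c0; split; first by rewrite symmetricmx_trmx tr_scalar_mx.
move=> v; rewrite mul_mx_scalar -scalemxAl mxE mulr_ge0// mxE sumr_ge0// => j _.
by rewrite mxE -expr2 sqr_ge0.
Qed.

Lemma psdD (R : realType) n (A B : 'M[R]_n) : psd A -> psd B -> psd (A + B).
Proof.
move=> [As Ap] [Bs Bp]; split.
  by move: As Bs; rewrite !symmetricmx_trmx linearD/= => /eqP -> /eqP ->.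
by move=> v; rewrite mulmxDr mulmxDl mxE addr_ge0.
Qed.

Lemma ler_scalar_loewner (R : realType) n (a b : R) (A : 'M[R]_n) : a <= b ->
  loewner_le b%:M A -> loewner_le a%:M A.
Proof.
move=> ab bA; rewrite /loewner_le (_ : A - a%:M = (b - a)%:M + (A - b%:M)).
  by apply: psdD => //; apply: psd_scalar; rewrite subr_ge0.
by rewrite raddfB/= [RHS]addrC addrA subrK.
Qed.

Lemma loewner_ler_scalar (R : realType) n (a b : R) (A : 'M[R]_n) : a <= b ->
  loewner_le A a%:M -> loewner_le A b%:M.
Proof.
move=> ab Aa; rewrite /loewner_le (_ : b%:M - A = (b - a)%:M + (a%:M - A)).
  by apply: psdD => //; apply: psd_scalar; rewrite subr_ge0.
by rewrite raddfB/= addrA subrK.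
Qed.

Section bounded_measurable_matrix.
Context {R : realType} {d : measure_display} {T : measurableType d}.

Definition bmx m n (G : T -> 'M[R]_(m, n)) := forall i j, bmfun (fun x => G x i j).

Lemma bmx_cst m n (G : 'M[R]_(m, n)) : bmx (fun=> G).
Proof. by move=> i j; exact: bmfun_cst. Qed.

Lemma bmxD m n (G H : T -> 'M[R]_(m, n)) : bmx G -> bmx H ->
  bmx (fun x => G x + H x).
Proof. by move=> bG bH i j; under eq_fun do rewrite mxE; exact: bmfunD. Qed.

Lemma bmxN m n (G : T -> 'M[R]_(m, n)) : bmx G -> bmx (fun x => - G x).
Proof. by move=> bG i j; under eq_fun do rewrite mxE; exact: bmfunN. Qed.

Lemma bmxB m n (G H : T -> 'M[R]_(m, n)) : bmx G -> bmx H ->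
  bmx (fun x => G x - H x).
Proof. by move=> bG /bmxN; exact: bmxD. Qed.

Lemma bmxZ m n (c : R) (G : T -> 'M[R]_(m, n)) : bmx G -> bmx (fun x => c *: G x).
Proof. by move=> bG i j; under eq_fun do rewrite mxE; exact: bmfunZ. Qed.

Lemma bmxM m n p (G : T -> 'M[R]_(m, n)) (H : T -> 'M[R]_(n, p)) : bmx G -> bmx H ->
  bmx (fun x => G x *m H x).
Proof.
move=> bG bH i j; under eq_fun do rewrite mxE.
by apply: bmfun_sum => k; exact: bmfunM.
Qed.

Lemma bmx_tr m n (G : T -> 'M[R]_(m, n)) : bmx G -> bmx (fun x => (G x)^T).
Proof. by move=> bG i j; under eq_fun do rewrite mxE; exact: bG. Qed.

Lemma bmx_exp n (G : T -> 'M[R]_n) k : bmx G -> bmx (fun x => G x ^+ k).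
Proof.
move=> bG; elim: k => [|k IH]; first exact: bmx_cst.
by under eq_fun do rewrite exprS mulmxE_ring; exact: bmxM.
Qed.

Lemma bmfun_fdot m n (G H : T -> 'M[R]_(m, n)) : bmx G -> bmx H ->
  bmfun (fun x => fdot (G x) (H x)).
Proof.
move=> bG bH; under eq_fun do rewrite fdotE.
by apply: bmfun_sum => i; apply: bmfun_sum => j; exact: bmfunM.
Qed.

Lemma bmx_fnorm m n (G : T -> 'M[R]_(m, n)) : bmx G ->
  exists M, forall x, fnorm (G x) <= M.
Proof.
move=> bG; have [_ [M hM]] := bmfun_fdot bG bG.
exists (Num.sqrt M) => x; rewrite /fnorm ler_wsqrtr//.
exact: le_trans (ler_norm _) (hM x).
Qed.

Lemma measurable_expmx n (G : T -> 'M[R]_n) :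
  (forall i j, measurable_fun setT (fun x => G x i j)) ->
  forall i j, measurable_fun setT (fun x => expmx (G x) i j).
Proof.
move=> mG i j.
have mX k i' j' : measurable_fun setT (fun x => (G x ^+ k) i' j').
  elim: k i' j' => [|k IH] i' j'.
    by under eq_fun do rewrite expr0; exact: measurable_cst.
  under eq_fun do rewrite exprS mulmxE_ring mxE.
  by apply: measurable_sum => l; exact: measurable_funM.
apply: (measurable_fun_cvg (h := fun N x =>
  series (fun k => (k`!%:R)^-1 *: G x ^+ k) N i j)).
  move=> N; rewrite [X in measurable_fun _ X](_ : _ =
      fun x => \sum_(0 <= k < N) (k`!%:R)^-1 * (G x ^+ k) i j).
    by apply: measurable_sum => k; apply: measurable_funM => //; exact: mX.
  by apply/funext => x; rewrite /series/= summxE; apply: eq_bigr => k _; rewrite mxE.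
by move=> x _; exact: (@expmx_cvg _ _ (G x) i j).
Qed.

Lemma bmx_expmx n (G : T -> 'M[R]_n) : bmx G -> bmx (fun x => expmx (G x)).
Proof.
move=> bG i j; split; first by apply: measurable_expmx => i' j'; have [] := bG i' j'.
have [M hM] := bmx_fnorm bG; exists (expR M * fnorm (1%:M : 'M[R]_n)) => x.
apply: (le_trans (fnorm_entry _ _ _)); apply: (le_trans (fnorm_expmx_le _)).
by rewrite ler_wpM2r ?fnorm_ge0// ler_expR.
Qed.

Definition mxint m n (mu : {measure set T -> \bar R}) (G : T -> 'M[R]_(m, n)) :=
  \matrix_(i, j) \int[mu]_x G x i j.

Section integral.
Variable mu : {measure set T -> \bar R}.
Hypothesis mu1 : mu setT = 1%E.

Lemma Rint_fdot m n (u : 'M[R]_(m, n)) G : bmx G ->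
  \int[mu]_x fdot u (G x) = fdot u (mxint mu G).
Proof.
move=> bG; under eq_Rintegral do rewrite fdotE.
rewrite (Rint_sum mu1); last first.
  by move=> i; apply: bmfun_sum => j; exact: bmfunZ.
rewrite fdotE; apply: eq_bigr => i _.
rewrite (Rint_sum mu1); last by move=> j; exact: bmfunZ.
by apply: eq_bigr => j _; rewrite (RintZ mu1)// mxE.
Qed.

Lemma Rint_fdot_cauchy_schwarz m n (X Y : T -> 'M[R]_(m, n)) : bmx X -> bmx Y ->
  (\int[mu]_x fdot (X x) (Y x)) ^+ 2 <=
  \int[mu]_x fdot (X x) (X x) * \int[mu]_x fdot (Y x) (Y x).
Proof.
move=> bX bY; apply: discriminant_le.
  by apply: (Rint_ge0 mu) => x; exact: fdot_sq_ge0.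
move=> t.
have bXX := bmfun_fdot bX bX; have bXY := bmfun_fdot bX bY.
have bYY := bmfun_fdot bY bY.
have -> : \int[mu]_x fdot (X x) (X x) - 2 * t * \int[mu]_x fdot (X x) (Y x) +
    t ^+ 2 * \int[mu]_x fdot (Y x) (Y x) =
    \int[mu]_x (fdot (X x) (X x) - 2 * t * fdot (X x) (Y x) + t ^+ 2 * fdot (Y x) (Y x)).
  rewrite (RintD mu1); last 2 first.
  - by apply: bmfunB => //; exact: bmfunZ.
  - exact: bmfunZ.
  by rewrite (RintB mu1)//; [rewrite !(RintZ mu1)|exact: bmfunZ].
apply: Rint_ge0 => x; have := fdot_sq_ge0 (X x - t *: Y x).
rewrite !(fdotDl, fdotDr, fdotNl, fdotNr, fdotZl, fdotZr) (fdotC (Y x)); lra.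
Qed.

Lemma mxintB m n (G H : T -> 'M[R]_(m, n)) : bmx G -> bmx H ->
  mxint mu (fun x => G x - H x) = mxint mu G - mxint mu H.
Proof.
move=> bG bH; apply/matrixP => i j; rewrite !mxE -(RintB mu1)//.
by apply: eq_Rintegral => x _; rewrite !mxE.
Qed.

Lemma mxint_cst m n (G : 'M[R]_(m, n)) : mxint mu (fun=> G) = G.
Proof. by apply/matrixP => i j; rewrite !mxE (Rint_cst mu1). Qed.

End integral.
End bounded_measurable_matrix.

Section symmul.
Context {R : realType} {n : nat}.
Implicit Types F G H : 'M[R]_n.

Lemma symmulDr F G H : symmul F (G + H) = symmul F G + symmul F H.
Proof. by rewrite /symmul mulmxDr mulmxDl -scalerDr addrACA. Qed.

Lemma symmulZr F (c : R) G : symmul F (c *: G) = c *: symmul F G.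
Proof. by rewrite /symmul -scalemxAr -scalemxAl -scalerDr !scalerA mulrC. Qed.

Lemma fdot_symmulC F G H : F \is symmetricmx ->
  fdot G (symmul F H) = fdot (symmul F G) H.
Proof.
rewrite symmetricmx_trmx => /eqP Fs.
rewrite /symmul !(fdotZl, fdotZr) !(fdotDl, fdotDr) fdot_mull fdot_mulr Fs.
by congr (_ * (_ + _)); rewrite fdotC ?fdot_mull ?fdot_mulr ?Fs fdotC ?fdot_mull ?fdot_mulr ?Fs.
Qed.

End symmul.

Lemma symmul_linear_expand (R : realType) n (F u w : 'M[R]_n) (c : R) :
  F \is symmetricmx ->
  fdot (u + c *: w) (symmul F (u + c *: w)) =
  fdot u (symmul F u) + 2 * c * fdot u (symmul F w) + c ^+ 2 * fdot w (symmul F w).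
Proof.
move=> Fs; rewrite symmulDr symmulZr; have := fdot_symmulC w u Fs.
move: (symmul F u) (symmul F w) => Fu Fw.
by rewrite !(fdotDl, fdotDr, fdotZl, fdotZr) (fdotC Fw u) => ->; ring.
Qed.

(** * Half a backward step *)

Section leon_perron.
Context {R : realType} {d : measure_display} {T : measurableType d} {D : nat}.
Variable mu : {measure set T -> \bar R}.
Hypothesis mu1 : mu setT = 1%E.
Variables (F : T -> 'M[R]_D) (l : R).
Hypotheses (bF : bmx F) (Fsym : forall x, F x \is symmetricmx)
  (Fmean : mxint mu F = 0) (l01 : 0 <= l < 1).

Let Q x := expmx (4^-1 *: F x).

Lemma bmx_symmul (w : T -> 'M[R]_D) : bmx w -> bmx (fun x => symmul (F x) (w x)).
Proof. by move=> bw; apply: bmxZ; apply: bmxD; exact: bmxM. Qed.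

Let Fu (u : 'M[R]_D) : mxint mu (fun x => symmul (F x) u) = 0.
Proof.
have -> : mxint mu (fun x => symmul (F x) u) = symmul (mxint mu F) u.
  rewrite /symmul; apply/matrixP => i j; rewrite !mxE.
  under eq_Rintegral do rewrite !mxE.
  rewrite (RintZ mu1); last first.
    apply: bmfunD; apply: bmfun_sum => k; first exact/bmfunM/bmfun_cst.
    exact: bmfunZ.
  congr (_ * _); rewrite (RintD mu1); last 2 first.
  - by apply: bmfun_sum => k; exact/bmfunM/bmfun_cst.
  - by apply: bmfun_sum => k; exact: bmfunZ.
  congr (_ + _); rewrite (Rint_sum mu1); last first.
  - by move=> k; exact: bmfunZ.
  - by apply: eq_bigr => k _; rewrite (RintZ mu1)// mxE.
  - by move=> k; exact/bmfunM/bmfun_cst.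
  apply: eq_bigr => k _; under eq_Rintegral do rewrite mulrC.
  by rewrite (RintZ mu1)// mxE mulrC.
by rewrite Fmean /symmul mul0mx mulmx0 addr0 scaler0.
Qed.

(** The chord bound makes the integrand quadratic in u + w. Since F has mean zero, the term <u, F u>
    drops out, and only the numbers of [leon_perron_scalar] survive. *)
Lemma leon_perron_strict (a b : R) (u : 'M[R]_D) (w : T -> 'M[R]_D) (Y : R) :
  (forall x, loewner_le a%:M (F x)) -> (forall x, loewner_le (F x) b%:M) ->
  a < 0 < b -> bmx w -> mxint mu w = 0 ->
  0 <= Y -> \int[mu]_x fdot (w x) (w x) <= l * Y ->
  \int[mu]_x fdot (Q x *m (u + w x) *m Q x) (Q x *m (u + w x) *m Q x) <=
  expR (alpha l * (b - a) ^+ 2 / 8) * (fdot u u + Y).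
Proof.
move=> Fa Fb ab bw w0 Y0 wY; have /andP[a0 b0] := ab.
have ltab : a < b by exact: lt_trans a0 b0.
have /andP[l0 l1] := l01.
set K := expR _; set y := \int[mu]_x _ in wY.
have bww : bmfun (fun x => fdot (w x) (w x)) by exact: bmfun_fdot.
have bFw := bmx_symmul bw.
have bG : bmx (fun x => u + w x) by apply: bmxD => //; exact: bmx_cst.
have bGG := bmfun_fdot bG bG.
have bQ : bmx Q by apply: bmx_expmx; exact: bmxZ.
have bQGQ : bmx (fun x => Q x *m (u + w x) *m Q x) by apply: bmxM => //; exact: bmxM.
have bL := bmfun_fdot bQGQ bQGQ.
have y0 : 0 <= y by apply: (Rint_ge0 mu) => x; exact: fdot_sq_ge0.
have yY : y <= Y by rewrite (le_trans wY)// ler_piMl// ltW.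
have buw : bmfun (fun x => fdot u (w x)) by apply: bmfun_fdot => //; exact: bmx_cst.
have GG : \int[mu]_x fdot (u + w x) (u + w x) = fdot u u + y.
  transitivity (\int[mu]_x (fdot u u + (2 * fdot u (w x) + fdot (w x) (w x)))).
    by apply: eq_Rintegral => x _; rewrite !(fdotDl, fdotDr) (fdotC (w x) u); ring.
  rewrite (RintD mu1); [|exact: bmfun_cst|by apply: bmfunD => //; exact: bmfunZ].
  rewrite (RintD mu1)//; last exact: bmfunZ.
  by rewrite (RintZ mu1)// (Rint_fdot mu1 u bw) w0 (Rint_cst mu1) fdot0r mulr0 add0r.
(* If exp b <= K, bounding F by b is enough; otherwise K < exp b is what the scalar lemma asks
   for. *)
have [Kb|Kb] := leP (expR b) K.
  apply: (@le_trans _ _ (\int[mu]_x (expR b * fdot (u + w x) (u + w x)))).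
    apply: (le_Rint mu1) => //; first exact: bmfunZ.
    by move=> x; exact: fdot_expmx_le_max.
  rewrite (RintZ mu1)// GG; apply: (@le_trans _ _ (K * (fdot u u + y))).
    by rewrite ler_wpM2r// addr_ge0// fdot_sq_ge0.
  by rewrite ler_wpM2l ?expR_ge0// lerD2l.
pose v := mxint mu (fun x => symmul (F x) (w x)).
pose w2 := \int[mu]_x fdot (w x) (symmul (F x) (w x)).
have bwFw : bmfun (fun x => fdot (w x) (symmul (F x) (w x))) by exact: bmfun_fdot.
have int_expand (q : 'M[R]_D) (c : R) :
    \int[mu]_x fdot (q + c *: w x) (symmul (F x) (q + c *: w x)) =
    2 * c * fdot q v + c ^+ 2 * w2.
  transitivity (\int[mu]_x (fdot q (symmul (F x) q) + (2 * c * fdot q (symmul (F x) (w x))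
      + c ^+ 2 * fdot (w x) (symmul (F x) (w x))))).
    by apply: eq_Rintegral => x _; rewrite symmul_linear_expand// addrA.
  have bq : bmx (fun x => symmul (F x) q) by exact/bmx_symmul/bmx_cst.
  have bqw : bmfun (fun x => fdot q (symmul (F x) (w x))).
    by apply: bmfun_fdot => //; exact: bmx_cst.
  rewrite (RintD mu1); last 2 first.
  - by apply: bmfun_fdot => //; exact: bmx_cst.
  - by apply: bmfunD; exact: bmfunZ.
  rewrite (RintD mu1); [|exact: bmfunZ|exact: bmfunZ].
  by rewrite !(RintZ mu1)// !(Rint_fdot mu1)// Fu fdot0r add0r.
pose V := fdot v v; have V0 : 0 <= V by exact: fdot_sq_ge0.
have bvw (q : 'M[R]_D) (c : R) : bmx (fun x => q + c *: w x).
  by apply: bmxD; [exact: bmx_cst|exact: bmxZ].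
(* F <= b is tested on v + b w: this gives 2 b V + b^2 w2 <= b (V + b^2 y), to be divided by b. *)
have w2le : b * w2 <= b ^+ 2 * y - V.
  have : \int[mu]_x fdot (v + b *: w x) (symmul (F x) (v + b *: w x)) <=
      \int[mu]_x (b * fdot (v + b *: w x) (v + b *: w x)).
    apply: (le_Rint mu1).
    - by apply: bmfun_fdot => //; apply: bmx_symmul.
    - by apply: bmfunZ; exact: bmfun_fdot.
    - by move=> x; exact: (fdot_symmul_le (a := a)).
  rewrite int_expand (RintZ mu1); last exact: bmfun_fdot.
  have -> : \int[mu]_x fdot (v + b *: w x) (v + b *: w x) = V + b ^+ 2 * y.
    have bvw' : bmfun (fun x => fdot v (w x)) by apply: bmfun_fdot => //; exact: bmx_cst.
    transitivity (\int[mu]_x (V + (2 * b * fdot v (w x) + b ^+ 2 * fdot (w x) (w x)))).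
      apply: eq_Rintegral => x _; rewrite !(fdotDl, fdotDr, fdotZl, fdotZr).
      by rewrite (fdotC (w x) v) -/V; ring.
    rewrite (RintD mu1); [|exact: bmfun_cst|by apply: bmfunD => //; exact: bmfunZ].
    rewrite (RintD mu1); [|exact: bmfunZ|exact: bmfunZ].
    by rewrite !(RintZ mu1)// (Rint_fdot mu1 v bw) w0 (Rint_cst mu1) fdot0r mulr0 add0r.
  rewrite -/V => h; rewrite -(ler_pM2l b0).
  have -> : b * (b * w2) = b ^+ 2 * w2 by ring.
  by rewrite -/V; lra.
(* V = E<symmul F v, w>. Cauchy-Schwarz applies, and E|symmul F v|^2 <= - a b V because (m - a) (b -
   m) >= 0 on the spectrum and the linear term has mean zero; it remains to divide by V. *)
have Vle : V <= - (a * b) * y.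
  pose Mv x := symmul (F x) v.
  have bMv : bmx Mv by exact/bmx_symmul/bmx_cst.
  have vMv : V = \int[mu]_x fdot (Mv x) (w x).
    rewrite /V {2}/v -(Rint_fdot mu1)//; apply: eq_Rintegral => x _.
    by rewrite fdot_symmulC.
  have cs := Rint_fdot_cauchy_schwarz mu1 bMv bw.
  have MvMv : \int[mu]_x fdot (Mv x) (Mv x) <= - (a * b) * V.
    apply: (@le_trans _ _ (\int[mu]_x ((a + b) * fdot v (Mv x) - a * b * V))).
      apply: (le_Rint mu1); first exact: bmfun_fdot.
        apply: bmfunB; last exact: bmfun_cst.
        by apply: bmfunZ; apply: bmfun_fdot => //; exact: bmx_cst.
      by move=> x; exact: fdot_symmul_sq_le.
    have bvM : bmfun (fun x => fdot v (Mv x)) by apply: bmfun_fdot => //; exact: bmx_cst.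
    rewrite (RintB mu1); [|exact: bmfunZ|exact: bmfun_cst].
    rewrite (RintZ mu1)// (Rint_fdot mu1)// Fu (Rint_cst mu1) fdot0r; lra.
  rewrite -vMv -/y in cs.
  have [->|Vn] := eqVneq V 0; first by rewrite mulr_ge0// oppr_ge0 nmulr_rle0// ltW.
  have Vp : 0 < V by rewrite lt_neqAle eq_sym Vn.
  rewrite -(ler_pM2l Vp); apply: le_trans (le_trans cs _); first by rewrite expr2.
  by rewrite mulrA [V * _]mulrC ler_wpM2r.
set c0 := (b * expR a - a * expR b) / (b - a).
set c1 := (expR b - expR a) / (b - a).
apply: (@le_trans _ _ (c0 * (fdot u u + y) + c1 * (2 * fdot u v + w2))).
  rewrite -GG.
  have -> : 2 * fdot u v + w2 = \int[mu]_x fdot (u + w x) (symmul (F x) (u + w x)).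
    have := int_expand u 1; rewrite mulr1 expr1n mul1r => <-.
    by apply: eq_Rintegral => x _; rewrite scale1r.
  have bGF : bmfun (fun x => fdot (u + w x) (symmul (F x) (u + w x))).
    by apply: bmfun_fdot => //; exact: bmx_symmul.
  rewrite -!(RintZ mu1)// -(RintD mu1); [|exact: bmfunZ|exact: bmfunZ].
  apply: (le_Rint mu1) => //; first by apply: bmfunD; exact: bmfunZ.
  by move=> x; exact: fdot_expmx_le_chord.
apply: (@leon_perron_scalar _ l a b (fdot u u) V y (fdot u v) w2 Y) => //.
- exact: fdot_sq_ge0.
- exact: fdot_cauchy_schwarz.
Qed.

Lemma mean_zero_bounds (a b : R) : (0 < D)%N ->
  (forall x, loewner_le a%:M (F x)) -> (forall x, loewner_le (F x) b%:M) -> a <= 0 <= b.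
Proof.
move=> D0 Fa Fb; pose i := Ordinal D0; pose v : 'rV[R]_D := delta_mx 0 i.
have vE (A : 'M[R]_D) : (v *m A *m v^T) 0 0 = A i i.
  by rewrite /v -rowE trmx_delta -colE !mxE.
have Fii : \int[mu]_x F x i i = 0 by move/matrixP: Fmean => /(_ i i); rewrite !mxE.
have aF x : a <= F x i i.
  by have := loewner_quadratic v (Fa x); rewrite !vE mxE eqxx.
have Fb' x : F x i i <= b.
  by have := loewner_quadratic v (Fb x); rewrite !vE mxE eqxx.
apply/andP; split; rewrite -Fii.
  by rewrite -(Rint_cst mu1 a); apply: (le_Rint mu1) => //; exact: bmfun_cst.
by rewrite -[leRHS](Rint_cst mu1); apply: (le_Rint mu1) => //; exact: bmfun_cst.
Qed.

(** Mean zero only gives a <= 0 <= b. Widening the interval by e on both sides makes the signs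
    strict, and e tends to 0. *)
Lemma leon_perron (a b : R) (u : 'M[R]_D) (w : T -> 'M[R]_D) (Y : R) : (0 < D)%N ->
  (forall x, loewner_le a%:M (F x)) -> (forall x, loewner_le (F x) b%:M) ->
  bmx w -> mxint mu w = 0 ->
  0 <= Y -> \int[mu]_x fdot (w x) (w x) <= l * Y ->
  \int[mu]_x fdot (Q x *m (u + w x) *m Q x) (Q x *m (u + w x) *m Q x) <=
  expR (alpha l * (b - a) ^+ 2 / 8) * (fdot u u + Y).
Proof.
move=> D0 Fa Fb bw w0 Y0 wY; have /andP[a0 b0] := mean_zero_bounds D0 Fa Fb.
set I := Rintegral _ _ _.
have h e : 0 < e -> I <= expR (alpha l * (b - a + 2 * e) ^+ 2 / 8) * (fdot u u + Y).
  move=> e0; rewrite (_ : b - a + 2 * e = (b + e) - (a - e)); last by ring.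
  apply: leon_perron_strict => //.
  - by move=> x; apply: ler_scalar_loewner (Fa x); lra.
  - by move=> x; apply: loewner_ler_scalar (Fb x); lra.
  - by apply/andP; split; lra.
pose f e := expR (alpha l * (b - a + 2 * e) ^+ 2 / 8) * (fdot u u + Y).
suff : f N.+1%:R^-1 @[N --> \oo] --> f 0.
  move=> fcvg; have cI : (fun=> I) @ \oo --> I by exact: cvg_cst.
  suff : I <= f 0 by rewrite /f mulr0 addr0.
  by apply: (ler_cvg_to cI fcvg); apply: nearW => N; apply: h; rewrite invr_gt0.
apply: continuous_cvg; last exact: cvg_harmonic.
apply: cvgMl; apply: continuous_comp; last exact: continuous_expR.
apply: cvgMl; apply: cvgMr; rewrite /= !expr2.
have h2 : (fun e : R => b - a + 2 * e) @ (0 : R) --> b - a + 2 * 0.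
  by apply: cvgD; [exact: cvg_cst|apply: cvgMr; exact: cvg_id].
exact: cvgM.
Qed.

End leon_perron.

Definition mxprod (R : realType) (D n : nat) (A : 'I_n -> 'M[R]_D) : 'M[R]_D :=
  \prod_(j < n) A j.

(** * The backward recursion along the chain *)

Section matrix_chain.
Context {R : realType} {d : measure_display} {T : measurableType d}.
Variables (P : R.-pker T ~> T) (mu : probability T R) (D : nat).
Hypotheses (hstat : stationary P mu) (hgap : lambda P mu < 1) (D0 : (0 < D)%N).

Let mu1 : mu setT = 1%E := probability_setT mu.
Let P1 x : P x setT = 1%E := @prob_kernel _ _ _ _ _ P x.
Let l := lambda P mu.
Let l0 : 0 <= l := lambda_ge0 hstat.
Let l01 : 0 <= l < 1. Proof. by rewrite l0. Qed.

Definition mxop (G : T -> 'M[R]_D) x := mxint (P x) G.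

Lemma bmx_mxop G : bmx G -> bmx (mxop G).
Proof.
move=> bG i j; rewrite (_ : (fun x => _) = markov_op P (fun x => G x i j)).
  exact: bmfun_markov_op.
by apply/funext => x; rewrite /mxop /mxint mxE.
Qed.

Lemma mxint_mxop G : bmx G -> mxint mu (mxop G) = mxint mu G.
Proof.
move=> bG; apply/matrixP => i j; rewrite !mxE -[RHS](Rint_markov_op hstat)//.
by apply: eq_Rintegral => x _; rewrite mxE.
Qed.

Lemma Rint_fdot_self (nu : {measure set T -> \bar R}) (w : T -> 'M[R]_D) :
  nu setT = 1%E -> bmx w ->
  \int[nu]_x fdot (w x) (w x) = \sum_i \sum_j \int[nu]_x (w x i j ^+ 2).
Proof.
move=> nu1 bw; under eq_Rintegral do rewrite fdotE.
rewrite (Rint_sum nu1); last first.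
  by move=> i; apply: bmfun_sum => j; exact: bmfunM.
apply: eq_bigr => i _; rewrite (Rint_sum nu1); last by move=> j; exact: bmfunM.
by apply: eq_bigr => j _; apply: eq_Rintegral => x _; rewrite expr2.
Qed.

Lemma mxop_contraction w : bmx w -> mxint mu w = 0 ->
  \int[mu]_x fdot (mxop w x) (mxop w x) <= l ^+ 2 * \int[mu]_x fdot (w x) (w x).
Proof.
move=> bw w0; rewrite !Rint_fdot_self//; last exact: bmx_mxop.
rewrite mulr_sumr; apply: ler_sum => i _; rewrite mulr_sumr; apply: ler_sum => j _.
have := lambda_contraction hstat (bw i j); move/matrixP: w0 => /(_ i j).
rewrite !mxE => -> /(_ erefl); apply: le_trans.
by rewrite le_eqVlt; apply/orP; left; apply/eqP; apply: eq_Rintegral => x _; rewrite mxE.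
Qed.

(* The norm in which one backward step of the chain costs at most the two-state
   constant: the squared mean is weighted 1 and the variance [lambda P mu]. *)
Definition leon_perron_norm2 (G : T -> 'M[R]_D) : R :=
  fdot (mxint mu G) (mxint mu G) +
  l * \int[mu]_x fdot (G x - mxint mu G) (G x - mxint mu G).

Lemma leon_perron_norm2_ge0 G : 0 <= leon_perron_norm2 G.
Proof.
apply: addr_ge0; first exact: fdot_sq_ge0.
by apply: mulr_ge0 => //; apply: (Rint_ge0 mu) => x; exact: fdot_sq_ge0.
Qed.

Section step.
Variables (F U : T -> 'M[R]_D) (a b : R).
Hypotheses (bF : bmx F) (bU : bmx U) (Fsym : forall x, F x \is symmetricmx)
  (Fmean : mxint mu F = 0) (Fa : forall x, loewner_le a%:M (F x))
  (Fb : forall x, loewner_le (F x) b%:M)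
  (UF : forall x, U x *m F x = F x *m U x)
  (Ucontr : forall x (W : 'M[R]_D), fdot (W *m (U x)^T) (W *m (U x)^T) <= fdot W W).

Let Q x := expmx (4^-1 *: F x).
Let A x := U x *m expmx (2^-1 *: F x).
Let K := expR (alpha l * (b - a) ^+ 2 / 8).

(** With r0 the mean of S and r1 = S - r0, the left-hand side is N = E<r0 + l r1, S> = E<X, Z>,
    where S = Q Z Q. [leon_perron] gives E|Z|^2 <= K M, as P contributes l^2 to the variance and [U]
    is contractive, and E|X|^2 <= K N, as l r1 has variance l (l E|r1|^2). Cauchy-Schwarz yields N^2
    <= K^2 N M. *)
Lemma leon_perron_step G : bmx G ->
  leon_perron_norm2 (fun x => A x *m mxop G x *m (A x)^T) <= K ^+ 2 * leon_perron_norm2 G.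
Proof.
move=> bG; have bPG := bmx_mxop bG.
have bQ : bmx Q by apply: bmx_expmx; exact: bmxZ.
have bA : bmx A by apply: bmxM => //; apply: bmx_expmx; exact: bmxZ.
pose S x := A x *m mxop G x *m (A x)^T.
have bS : bmx S by apply: bmxM; [exact: bmxM|exact: bmx_tr].
rewrite -/S; set N := leon_perron_norm2 S; set M := leon_perron_norm2 G.
pose r0 := mxint mu S; pose r1 x := S x - r0.
pose u := mxint mu G; pose w x := G x - u.
have bw : bmx w by apply: bmxB => //; exact: bmx_cst.
have br1 : bmx r1 by apply: bmxB => //; exact: bmx_cst.
have w0 : mxint mu w = 0.
  by rewrite (mxintB mu1)//; [rewrite (mxint_cst mu1) subrr|exact: bmx_cst].
have r10 : mxint mu r1 = 0.
  by rewrite (mxintB mu1)//; [rewrite (mxint_cst mu1) subrr|exact: bmx_cst].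
have bPw := bmx_mxop bw.
have PGE x : mxop G x = u + mxop w x.
  rewrite /mxop (mxintB (P1 x))//; last exact: bmx_cst.
  by rewrite (mxint_cst (P1 x)) addrC subrK.
have Qsym x : (Q x)^T = Q x.
  rewrite /Q expmx_tr linearZ/=; move: (Fsym x).
  by rewrite symmetricmx_trmx => /eqP ->.
have UQ x : U x *m Q x = Q x *m U x.
  by rewrite /Q -expmx_comm// -scalemxAl -scalemxAr UF.
have AE x : A x = Q x *m U x *m Q x.
  rewrite -UQ -mulmxA -(expmxD (erefl (_ *m _))) -scalerDl.
  by rewrite (_ : 4^-1 + 4^-1 = 2^-1 :> R)//; lra.
pose Z x := U x *m (Q x *m (u + mxop w x) *m Q x) *m (U x)^T.
have SE x : S x = Q x *m Z x *m Q x.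
  by rewrite /S AE PGE !trmx_mul Qsym /Z !mulmxA.
have bZ : bmx Z.
  by apply: (bmxM (bmxM bU (bmxM (bmxM bQ (bmxD (bmx_cst u) bPw)) bQ)) (bmx_tr bU)).
pose X x := Q x *m (r0 + l *: r1 x) *m Q x.
have br : bmx (fun x => r0 + l *: r1 x) by apply: bmxD; [exact: bmx_cst|exact: bmxZ].
have bX : bmx X by apply: bmxM => //; exact: bmxM.
have NE : N = \int[mu]_x fdot (X x) (Z x).
  transitivity (\int[mu]_x (fdot r0 (S x) + l * (fdot (r1 x) (r1 x) + fdot r0 (r1 x)))).
    have b1 : bmfun (fun x => fdot r0 (r1 x)) by apply: bmfun_fdot => //; exact: bmx_cst.
    have b2 : bmfun (fun x => fdot (r1 x) (r1 x)) by exact: bmfun_fdot.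
    rewrite (RintD mu1); last 2 first.
    - by apply: bmfun_fdot => //; exact: bmx_cst.
    - by apply: bmfunZ; exact: bmfunD.
    rewrite (RintZ mu1) ?(RintD mu1)//; last exact: bmfunD.
    by rewrite !(Rint_fdot mu1)// r10 fdot0r addr0.
  apply: eq_Rintegral => x _; rewrite /X -[in RHS]mulmxA fdot_mull Qsym.
  rewrite fdot_mulr Qsym -SE.
  have -> : S x = r0 + r1 x by rewrite /r1 addrC subrK.
  by move: (r0) (r1 x) => p q; rewrite !(fdotDl, fdotDr, fdotZl) (fdotC q p); ring.
have ZX x : fdot (Z x) (Z x) <= fdot (Q x *m (u + mxop w x) *m Q x) (Q x *m (u + mxop w x) *m Q x).
  rewrite /Z; apply: (le_trans (Ucontr _ _)).
  by rewrite -fdot_tr trmx_mul; apply: (le_trans (Ucontr _ _)); rewrite fdot_tr.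
have Z_le : \int[mu]_x fdot (Z x) (Z x) <= K * M.
  have bY : bmx (fun x => Q x *m (u + mxop w x) *m Q x).
    by apply: (bmxM (bmxM bQ (bmxD (bmx_cst u) bPw)) bQ).
  apply: (@le_trans _ _ (\int[mu]_x fdot (Q x *m (u + mxop w x) *m Q x)
      (Q x *m (u + mxop w x) *m Q x))).
    by apply: (le_Rint mu1) => //; exact: bmfun_fdot.
  apply: leon_perron => //.
  - by rewrite mxint_mxop.
  - by rewrite mulr_ge0//; apply: (Rint_ge0 mu) => x; exact: fdot_sq_ge0.
  - by rewrite mulrA -expr2; exact: mxop_contraction.
have X_le : \int[mu]_x fdot (X x) (X x) <= K * N.
  apply: leon_perron => //.
  - exact: bmxZ.
  - apply/matrixP => i j; rewrite !mxE; under eq_Rintegral do rewrite mxE.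
    by rewrite (RintZ mu1)//; move/matrixP: r10 => /(_ i j); rewrite !mxE => ->; rewrite mulr0.
  - by rewrite mulr_ge0//; apply: (Rint_ge0 mu) => x; exact: fdot_sq_ge0.
  - rewrite mulrA le_eqVlt; apply/orP; left; apply/eqP.
    rewrite -(RintZ mu1); last exact: bmfun_fdot.
    by apply: eq_Rintegral => x _; rewrite fdotZl fdotZr mulrA.
have cs : N ^+ 2 <= K * N * (K * M).
  rewrite [N in X in X <= _]NE; apply: (le_trans (Rint_fdot_cauchy_schwarz mu1 bX bZ)).
  by apply: ler_pM => //; apply: (Rint_ge0 mu) => x; exact: fdot_sq_ge0.
have N0 : 0 <= N by exact: leon_perron_norm2_ge0.
have [->|Nn] := eqVneq N 0.
  by rewrite mulr_ge0 ?leon_perron_norm2_ge0// exprn_ge0// expR_ge0.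
have Np : 0 < N by rewrite lt_neqAle eq_sym Nn.
rewrite -(ler_pM2l Np); move: cs; rewrite expr2 (_ : K * N * _ = N * (K ^+ 2 * M))//; ring.
Qed.

End step.

Section chain.
Context {dO : measure_display} {Omega : measurableType dO} {Pr : probability Omega R}
  {n : nat}.
Variable s : 'I_n.+1 -> {RV Pr >-> T}.
Hypothesis hs : markov_chain P mu s.
Let Pr1 : Pr setT = 1%E := probability_setT Pr.

(** The form is linear in [H], with coefficients the entries of V^T V, which depend on the past
    only. *)
Lemma markov_property_fdot (i j : 'I_n.+1) (V : history_type s i -> 'M[R]_D)
    (H : T -> 'M[R]_D) : j = i.+1 :> nat -> bmx V -> bmx H ->
  \int[Pr]_w fdot (V w *m mxop H (s i w)) (V w) =
  \int[Pr]_w fdot (V w *m H (s j w)) (V w).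
Proof.
move=> ij bV bH; pose G w := (V w)^T *m V w.
have bG : bmx G by exact: bmxM (bmx_tr bV) bV.
have bG' k m : bmfun (fun w : Omega => G w k m) by exact: bmfun_history_sub (bG k m).
have expand (q : 'I_n.+1) (E : T -> 'M[R]_D) : bmx E ->
    \int[Pr]_w fdot (V w *m E (s q w)) (V w) =
    \sum_k \sum_m \int[Pr]_w (G w k m * E (s q w) k m).
  move=> bE; under eq_Rintegral do rewrite fdot_mull fdotC fdotE.
  have bt k m : bmfun (fun w : Omega => G w k m * E (s q w) k m).
    by apply: bmfunM => //; exact: (bmfun_rv s q (bE k m)).
  rewrite (Rint_sum Pr1); last by move=> k; exact: bmfun_sum.
  by apply: eq_bigr => k _; rewrite (Rint_sum Pr1).
rewrite !expand//; last exact: bmx_mxop.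
apply: eq_bigr => k _; apply: eq_bigr => m _.
rewrite (markov_property hs ij (bG k m) (bH k m)).
by apply: eq_Rintegral => w _; congr (_ * _); rewrite /mxop /mxint mxE.
Qed.

Variables (F U : 'I_n.+1 -> T -> 'M[R]_D) (a b : 'I_n.+1 -> R).
Hypotheses (bF : forall j, bmx (F j)) (bU : forall j, bmx (U j))
  (Fsym : forall j x, F j x \is symmetricmx)
  (Fmean : forall j, mxint mu (F j) = 0)
  (Fa : forall j x, loewner_le (a j)%:M (F j x))
  (Fb : forall j x, loewner_le (F j x) (b j)%:M)
  (UF : forall j x, U j x *m F j x = F j x *m U j x)
  (Ucontr : forall j x (W : 'M[R]_D),
    fdot (W *m (U j x)^T) (W *m (U j x)^T) <= fdot W W).

Let A j x := U j x *m expmx (2^-1 *: F j x).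
Let K j := expR (alpha l * (b j - a j) ^+ 2 / 8).

(** [k] factors are left and [m] is the index of the first one; the recursion is on [k], and [inord]
    turns [m] into an index of the chain. *)
Fixpoint backward_mx (k m : nat) : T -> 'M[R]_D :=
  if k is k'.+1 then fun x =>
    A (inord m) x *m mxop (backward_mx k' m.+1) x *m (A (inord m) x)^T
  else fun=> 1%:M.

Let bA j : bmx (A j).
Proof. by apply: (bmxM (bU j)); apply: bmx_expmx; exact: bmxZ. Qed.

Lemma bmx_backward k m : bmx (backward_mx k m).
Proof.
elim: k m => [|k IH] m; first exact: bmx_cst.
exact: bmxM (bmxM (bA _) (bmx_mxop (IH _))) (bmx_tr (bA _)).
Qed.

Lemma leon_perron_norm2_backward k m :
  leon_perron_norm2 (backward_mx k m) <=
  (\prod_(i < k) K (inord (m + i)) ^+ 2) * D%:R.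
Proof.
elim: k m => [|k IH] m.
  rewrite big_ord0 mul1r /leon_perron_norm2 (mxint_cst mu1).
  rewrite (_ : \int[mu]_x _ = 0); last first.
    under eq_Rintegral do rewrite subrr fdot0r; exact: (Rint_cst mu1).
  by rewrite mulr0 addr0 /fdot trmx1 mulmx1 mxtrace1.
apply: (le_trans (leon_perron_step (bF (inord m)) (bU (inord m)) (Fsym (inord m))
  (Fmean (inord m)) (Fa (inord m)) (Fb (inord m)) (UF (inord m)) (@Ucontr (inord m))
  (bmx_backward k m.+1))).
rewrite big_ord_recl addn0 -[leRHS]mulrA ler_wpM2l ?exprn_ge0 ?expR_ge0//.
apply: (le_trans (IH _)); rewrite ler_wpM2r//.
rewrite le_eqVlt; apply/orP; left; apply/eqP; apply: eq_bigr => i _.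
by rewrite lift0 addnS addSn.
Qed.

Let W (m : nat) (w : Omega) : 'M[R]_D := \prod_(j < m) A (inord j) (s (inord j) w).

Let WS m w : W m.+1 w = W m w *m A (inord m) (s (inord m) w).
Proof. by rewrite /W big_ord_recr. Qed.

Let bW i m : (i <= n)%N -> (m <= i.+1)%N -> bmx (W m : history_type s i -> 'M[R]_D).
Proof.
move=> iN; elim: m => [|m IH] mi.
  by rewrite (_ : W 0 = fun=> 1%:M); [exact: bmx_cst|apply/funext => w; rewrite /W big_ord0].
rewrite (_ : W m.+1 = fun w => W m w *m A (inord m) (s (inord m) w)); last first.
  by apply/funext => w; rewrite WS.
apply: bmxM; first by apply: IH; exact: ltnW.
move=> p q; apply: (bmfun_history s _ (bA (inord m) p q)).
by rewrite inordK// ltnS (leq_trans _ iN).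
Qed.

(** The left-hand side does not change with m: the Markov property trades P H at time m for H at
    time m + 1, and the factor at time m joins the product of the past. At m = n the operator acts
    on the constant 1. *)
Lemma Rint_backward k m : (m + k = n)%N ->
  \int[Pr]_w fdot (W m w *m backward_mx k.+1 m (s (inord m) w)) (W m w) =
  \int[Pr]_w fdot (W n.+1 w) (W n.+1 w).
Proof.
elim: k m => [|k IH] m mk.
  transitivity (\int[Pr]_w fdot (W m.+1 w) (W m.+1 w)); last first.
    by rewrite (_ : m = n)// -mk addn0.
  apply: eq_Rintegral => w _; rewrite /= WS.
  rewrite (_ : mxop _ _ = 1%:M); last exact: (mxint_cst (P1 _)).
  by rewrite mulmx1 mulmxA fdot_mulr trmxK.
rewrite -(IH m.+1); last by rewrite addSnnS.
have mn : (m < n)%N by rewrite -mk addnS ltnS leq_addr.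
have im : (inord m : 'I_n.+1) = m :> nat by rewrite inordK// ltnS ltnW.
have im1 : (inord m.+1 : 'I_n.+1) = m.+1 :> nat by rewrite inordK.
rewrite -(@markov_property_fdot (inord m) (inord m.+1)); first last.
- exact: bmx_backward.
- by apply: bW; rewrite im// ltnW.
- by rewrite im1 im.
apply: eq_Rintegral => w _; rewrite [in RHS]WS.
have -> x : backward_mx k.+2 m x =
  A (inord m) x *m mxop (backward_mx k.+1 m.+1) x *m (A (inord m) x)^T by [].
rewrite -[in RHS](trmxK (A (inord m) _)) -[RHS]fdot_mulr.
by rewrite trmxK !mulmxA.
Qed.

(** The left-hand side is <1, E H>. Its square is at most D |E H|^2, hence at most D times the norm
    of H, which is at most D times the product of the K_j^2; the square root leaves one K_j per
    factor. *)
Theorem matrix_chain_bound :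
  \int[Pr]_w fdot (mxprod (fun j => A j (s j w))) (mxprod (fun j => A j (s j w))) <=
  D%:R * \prod_(j < n.+1) K j.
Proof.
have -> : \int[Pr]_w fdot (mxprod (fun j => A j (s j w))) (mxprod (fun j => A j (s j w))) =
    \int[Pr]_w fdot (W n.+1 w) (W n.+1 w).
  apply: eq_Rintegral => w _; rewrite /W /mxprod.
  by under [in RHS]eq_bigr do rewrite inord_val.
rewrite -(@Rint_backward n 0)//; set H := backward_mx n.+1 0.
have bH : bmx H by exact: bmx_backward.
have -> : \int[Pr]_w fdot (W 0 w *m H (s (inord 0) w)) (W 0 w) = fdot 1%:M (mxint mu H).
  rewrite -(Rint_fdot mu1)// -(Rint_initial hs (i := inord 0)) ?inordK//.
    by apply: eq_Rintegral => w _; rewrite /W big_ord0 mul1mx fdotC.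
  by apply: bmfun_fdot => //; exact: bmx_cst.
have K0 : 0 <= \prod_(j < n.+1) K j by apply: prodr_ge0 => j _; exact: expR_ge0.
apply: le_trans (ler_norm _) _.
rewrite -(@ler_pXn2r _ 2) ?nnegrE ?normr_ge0 ?mulr_ge0// real_normK ?num_real//.
apply: (le_trans (fdot_cauchy_schwarz _ _)).
have -> : fdot (1%:M : 'M[R]_D) 1%:M = D%:R by rewrite /fdot trmx1 mulmx1 mxtrace1.
rewrite exprMn expr2 -mulrA ler_wpM2l//.
apply: (@le_trans _ _ (leon_perron_norm2 H)).
  rewrite lerDl mulr_ge0//; apply: (Rint_ge0 mu) => x; exact: fdot_sq_ge0.
apply: (le_trans (leon_perron_norm2_backward _ _)).
rewrite mulrC ler_wpM2l// prodrXl le_eqVlt; apply/orP; left; apply/eqP.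
by congr (_ ^+ 2); apply: eq_bigr => i _; rewrite add0n inord_val.
Qed.

End chain.
End matrix_chain.

(** * Mean values over a half circle *)

Section half_circle.
Context {R : realType}.

Let pihalf : - (pi / 2) < pi / 2 :> R.
Proof. have := pi_gt0 R; lra. Qed.

(* [half_circle_weight] is the density of cos(phi)/2 dphi with respect to the
   uniform law on [-pi/2, pi/2], set to 0 elsewhere to be nonnegative. *)
Definition half_circle := uniform_prob pihalf.

Definition half_circle_weight (phi : R) : R :=
  pi / 2 * cos phi * \1_(`[- (pi / 2), pi / 2]) phi.

Let hc1 : half_circle setT = 1%E := probability_setT half_circle.

Lemma half_circle_weightE phi : half_circle_weight phi =
  if - (pi / 2) <= phi <= pi / 2 then pi / 2 * cos phi else 0.
Proof.
rewrite /half_circle_weight indicE mem_setE in_itv/=.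
by case: ifP; rewrite ?mulr1 ?mulr0.
Qed.

Lemma half_circle_weight_ge0 phi : 0 <= half_circle_weight phi.
Proof.
rewrite half_circle_weightE; case: ifP => // h; apply: mulr_ge0.
  by rewrite divr_ge0// pi_ge0.
exact: cos_ge0_pihalf.
Qed.

Lemma bmfun_cos (k : R) : bmfun (fun phi : R => cos (k * phi)).
Proof.
split.
  apply: measurableT_comp; first by apply: continuous_measurable_fun; exact: continuous_cos.
  by apply: measurable_funM => //; exact: measurable_cst.
by exists 1 => x; rewrite ler_norml cos_geN1 cos_le1.
Qed.

Lemma bmfun_sin (k : R) : bmfun (fun phi : R => sin (k * phi)).
Proof.
split.
  apply: measurableT_comp; first by apply: continuous_measurable_fun; exact: continuous_sin.
  by apply: measurable_funM => //; exact: measurable_cst.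
by exists 1 => x; rewrite ler_norml sin_geN1 sin_le1.
Qed.

Lemma bmfun_half_circle_weight : bmfun half_circle_weight.
Proof.
apply: bmfunM; last by apply: bmfun_indic; exact: measurable_itv.
apply: bmfunZ; have := bmfun_cos 1.
by rewrite (_ : (fun phi : R => cos (1 * phi)) = cos)//; apply/funext => x; rewrite mul1r.
Qed.

Lemma half_circle_moment (k : nat) :
  \int[half_circle]_phi (half_circle_weight phi * cos (k%:R * phi)) =
  if k == 1%N then pi / 4 else cos (k%:R * (pi / 2)) / (1 - k%:R ^+ 2).
Proof.
have key (f : R -> R) : bmfun f -> (forall x, 0 <= f x) ->
  (\int[half_circle]_phi (f phi)%:E =
   (pi^-1)%:E * \int[lebesgue_measure]_(x in `[(- (pi / 2))%R, (pi / 2)%R]) (f x)%:E)%E.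
  move=> bf f0; rewrite integral_uniform.
  - by congr ((_^-1)%:E * _)%E; lra.
  - by apply/measurable_EFinP; exact: bf.1.
  - by move=> x; rewrite lee_fin.
pose w := half_circle_weight; have bw : bmfun w by exact: bmfun_half_circle_weight.
pose m (j : nat) : R := if j == 1%N then pi / 4 else cos (j%:R * (pi / 2)) / (1 - j%:R ^+ 2).
have bc := bmfun_cos k%:R.
have ib (j : nat) : lebesgue_measure.-integrable `[(- (pi / 2))%R, (pi / 2)%R]
    (EFin \o (fun x : R => cos (j%:R * x) * (cos x / 2))).
  apply: continuous_compact_integrable; first exact: segment_compact.
  apply: continuous_subspaceT => x.
  apply: cvgM.
    apply: continuous_comp; last exact: continuous_cos.
    by apply: cvgMr; exact: cvg_id.
  by apply: cvgMl; exact: continuous_cos.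
have pi0 : pi != 0 :> R by rewrite gt_eqF// pi_gt0.
(* The formula for uniform integrals in [key] is for nonnegative functions, so cos is raised by 1
   and the moment of order 0 is subtracted afterwards. *)
have e1 : \int[half_circle]_phi (w phi * (cos (k%:R * phi) + 1)) = m k + m 0%N.
  have bwc : bmfun (fun phi => w phi * (cos (k%:R * phi) + 1)).
    by apply: bmfunM => //; apply: bmfunD => //; exact: bmfun_cst.
  apply: EFin_inj; rewrite -(bmfun_fineK hc1 bwc) key//; last first.
    move=> x; rewrite mulr_ge0 ?half_circle_weight_ge0// -lerBlDr sub0r cos_geN1.
  have -> : (\int[lebesgue_measure]_(x in `[(- (pi / 2))%R, (pi / 2)%R]) (w x * (cos (k%:R * x) + 1))%:E =
      \int[lebesgue_measure]_(x in `[(- (pi / 2))%R, (pi / 2)%R]) (pi%:E * ((cos (k%:R * x) * (cos x / 2))%:E +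
      (cos (0%:R * x) * (cos x / 2))%:E)))%E.
    apply: eq_integral => x; rewrite inE/= in_itv/= => xI.
    rewrite /w half_circle_weightE xI -EFinD -EFinM mul0r cos0; congr _%:E; ring.
  rewrite integralZl//; last by apply: integrableD => //; [exact: (ib k)|exact: (ib 0%N)].
  rewrite integralD//; [|exact: (ib k)|exact: (ib 0%N)].
  by rewrite !integral_cos_cos muleA -EFinM mulVf// mul1r.
have e0 : \int[half_circle]_phi w phi = m 0%N.
  apply: EFin_inj; rewrite -(bmfun_fineK hc1 bw) key//; last first.
    by move=> x; exact: half_circle_weight_ge0.
  have -> : (\int[lebesgue_measure]_(x in `[(- (pi / 2))%R, (pi / 2)%R]) (w x)%:E =
      \int[lebesgue_measure]_(x in `[(- (pi / 2))%R, (pi / 2)%R]) (pi%:E * (cos (0%:R * x) * (cos x / 2))%:E))%E.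
    apply: eq_integral => x; rewrite inE/= in_itv/= => xI.
    rewrite /w half_circle_weightE xI -EFinM mul0r cos0; congr _%:E; ring.
  rewrite integralZl//; last exact: (ib 0%N).
  by rewrite integral_cos_cos muleA -EFinM mulVf// mul1r.
have bwk : bmfun (fun phi => w phi * cos (k%:R * phi)) by exact: bmfunM.
move: e1; rewrite -e0 (_ : \int[half_circle]_phi (w phi * (cos (k%:R * phi) + 1)) =
  \int[half_circle]_phi (w phi * cos (k%:R * phi)) + \int[half_circle]_phi w phi).
  by move=> /addIr.
by rewrite -(RintD hc1)//; apply: eq_Rintegral => x _; rewrite mulrDr mulr1.
Qed.

Lemma half_circle_weight_int : \int[half_circle]_phi half_circle_weight phi = 1.
Proof.
have := half_circle_moment 0; rewrite /= mul0r cos0 expr0n subr0 divr1.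
apply: etrans; by apply: eq_Rintegral => x _; rewrite mul0r cos0 mulr1.
Qed.

End half_circle.

Lemma fdot_row_mx (R : realType) m n p (A C : 'M[R]_(m, n)) (B D : 'M[R]_(m, p)) :
  fdot (row_mx A B) (row_mx C D) = fdot A C + fdot B D.
Proof. by rewrite /fdot tr_row_mx mul_row_col raddfD. Qed.

Lemma fdot_suml (R : realType) m n (I : finType) (F : I -> 'M[R]_(m, n)) A :
  fdot (\sum_i F i) A = \sum_i fdot (F i) A.
Proof. by rewrite /fdot mulmx_suml raddf_sum. Qed.

(** * Polynomials with matrix coefficients at complex points *)

Section rotation.
Context {R : realType} {n : nat}.
Local Notation M := 'M[R]_n.+1.
Local Notation M2 := 'M[R]_(n.+1 + n.+1).

(* The complex number r e^(i phi) as a real block matrix. *)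
Definition rotmx (r phi : R) : M2 := (r * cos phi)%:M + (r * sin phi) *: rotJ.

Lemma rotmxM r s phi psi : rotmx r phi *m rotmx s psi = rotmx (r * s) (phi + psi).
Proof.
have J2 (a b c e : R) : (a%:M + b *: rotJ) *m (c%:M + e *: rotJ) =
    (a * c - b * e)%:M + (a * e + b * c) *: rotJ :> M2.
  rewrite mulmxDl !mulmxDr -scalar_mxM mul_scalar_mx mul_mx_scalar.
  rewrite -scalemxAl -scalemxAr rotJ_sqr !scalerA scalerN scalemx1 raddfB scalerDl.
  by rewrite (mulrC b c) [X in _ + X]addrC addrACA.
by rewrite /rotmx J2 cosD sinD; congr (_%:M + _ *: _); ring.
Qed.

Lemma rotmxX r phi k : rotmx r phi ^+ k = rotmx (r ^+ k) (k%:R * phi).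
Proof.
elim: k => [|k IH].
  by rewrite !expr0 mul0r /rotmx cos0 sin0 mulr0 scale0r addr0 mulr1.
by rewrite exprS IH mulmxE_ring rotmxM -exprS -[in RHS]natr1 mulrDl mul1r addrC.
Qed.

Lemma rotmx_dblC r phi (A : M) : rotmx r phi *m dbl A = dbl A *m rotmx r phi.
Proof.
by rewrite /rotmx mulmxDl mulmxDr scalar_mxC -scalemxAl -scalemxAr rotJ_dbl.
Qed.

Lemma dbl_rotmx (A : M) r phi : dbl A *m rotmx r phi =
  (r * cos phi) *: dbl A + (r * sin phi) *: (rotJ *m dbl A).
Proof. by rewrite /rotmx mulmxDr mul_mx_scalar -scalemxAr rotJ_dbl. Qed.

Lemma rotmx_rotJ r phi : rotmx r phi *m rotJ = rotJ *m rotmx r phi.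
Proof. by rewrite /rotmx mulmxDl mulmxDr scalar_mxC -scalemxAl -scalemxAr. Qed.

Fact dbl_zmod_morphism : zmod_morphism (dbl : M -> M2).
Proof. by move=> A B; rewrite dblD dblN. Qed.

Fact dbl_monoid_morphism : monoid_morphism (dbl : M -> M2).
Proof. by split; [exact: dbl_scalar|move=> A B; exact: dblM]. Qed.

HB.instance Definition _ := GRing.isZmodMorphism.Build M M2 dbl dbl_zmod_morphism.
HB.instance Definition _ := GRing.isMonoidMorphism.Build M M2 dbl dbl_monoid_morphism.

Fact commr_dbl_rotmx r phi : commr_rmorph (dbl : M -> M2) (rotmx r phi).
Proof. by move=> A; exact: rotmx_dblC. Qed.

(** Evaluation at r e^(i phi). It is multiplicative, although the coefficients do not commute with
    each other, because [rotmx] commutes with the image of [dbl]. *)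
Definition rotev r phi : {poly M} -> M2 := horner_morph (commr_dbl_rotmx r phi).

Lemma rotev1 r phi : rotev r phi 1 = 1%:M.
Proof. exact: rmorph1. Qed.

Lemma rotevM r phi p q : rotev r phi (p * q) = rotev r phi p *m rotev r phi q.
Proof. exact: rmorphM. Qed.

Lemma rotevE r phi (p : {poly M}) N : (size p <= N)%N -> rotev r phi p =
  \sum_(k < N) dbl p`_k *m rotmx (r ^+ k) (k%:R * phi).
Proof.
move=> pN; rewrite /rotev /horner_morph (@horner_coef_wide _ N); last first.
  by rewrite (leq_trans (size_poly _ _)).
by apply: eq_bigr => k _; rewrite coef_map rotmxX.
Qed.

Lemma rotev_rotJ r phi p : rotev r phi p *m rotJ = rotJ *m rotev r phi p.
Proof.
rewrite (rotevE _ _ (leqnn _)) mulmx_suml mulmx_sumr; apply: eq_bigr => k _.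
by rewrite -mulmxA rotmx_rotJ mulmxA -rotJ_dbl mulmxA.
Qed.

(** The real part of v p(z) v^T: [rotJ] sends (u, 0) to (0, -u), which is orthogonal to (v, 0), so
    the imaginary parts drop out. *)
Lemma fdot_rotev (v : 'rV[R]_n.+1) r phi (p : {poly M}) N : (size p <= N)%N ->
  fdot (row_mx v 0 *m rotev r phi p) (row_mx v 0) =
  \sum_(k < N) fdot (v *m p`_k) v * (r ^+ k * cos (k%:R * phi)).
Proof.
move=> /rotevE ->; rewrite mulmx_sumr fdot_suml.
apply: eq_bigr => k _; rewrite mulmxA.
have -> : row_mx v 0 *m dbl p`_k = row_mx (v *m p`_k) 0.
  by rewrite /dbl mul_row_block !mul0mx mulmx0 !addr0.
rewrite /rotmx mulmxDr mul_mx_scalar -scalemxAr fdotDl !fdotZl !fdot_row_mx.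
rewrite /rotJ mul_row_block !mulmx0 mul0mx !addr0 !fdot_row_mx fdot0r mulmxN.
by rewrite [fdot (v *m _) v]fdotC (fdotC 0 v) !fdot0r !addr0 mulr0 addr0 mulrC.
Qed.

(* (1 + H z^e / m)^m, a polynomial in z approximating exp(z^e H); only odd [e]
   are used, so that on the imaginary axis it is a function of a
   skew-symmetric matrix. *)
Definition lin_factor m (q : nat * M) : {poly M} :=
  (1 + (m.+1%:R^-1 *: q.2)%:P * 'X^(q.1)) ^+ m.+1.

Lemma rotev_lin_factor r phi m q : rotev r phi (lin_factor m q) =
  (1 + m.+1%:R^-1 *: (dbl q.2 *m rotmx (r ^+ q.1) (q.1%:R * phi))) ^+ m.+1.
Proof.
rewrite /rotev /lin_factor rmorphXn rmorphD rmorph1 rmorphM rmorphXn/=.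
rewrite horner_morphC horner_morphX rotmxX/=.
by rewrite dblZ mulmxE_ring -scalemxAl.
Qed.

Definition lin_prod m (s : seq (nat * M)) : {poly M} := \prod_(q <- s) lin_factor m q.

(** The m + 1 factors each contribute H / (m + 1), so value and derivative at 0 are those of the
    exponential for every m. *)
Lemma coef01_lin_factor m q : (0 < q.1)%N ->
  (lin_factor m q)`_0 = 1 /\ (lin_factor m q)`_1 = if q.1 == 1%N then q.2 else 0.
Proof.
move=> q0; rewrite /lin_factor; set a := m.+1%:R^-1 *: q.2.
pose c : M := if q.1 == 1%N then a else 0.
have h k : ((1 + a%:P * 'X^(q.1)) ^+ k)`_0 = 1 /\
    ((1 + a%:P * 'X^(q.1)) ^+ k)`_1 = c *+ k.
  elim: k => [|k [IH0 IH1]]; first by rewrite expr0 !coef1.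
  rewrite exprS !coefM !big_ord_recl !big_ord0 /= !addr0 IH0 IH1.
  rewrite !coefD !coef1 !coefCM !coefXn /=.
  rewrite (_ : (0 == q.1)%N = false); last by apply/negbTE; rewrite eq_sym -lt0n.
  rewrite mulr0 addr0 !mul1r add0r mulr1; split=> //.
  rewrite mulrS addrC; congr (_ + _); rewrite /c eq_sym.
  by case: ifP; rewrite ?mulr1 ?mulr0.
have [-> ->] := h m.+1; split=> //; rewrite /c; case: ifP => _; last by rewrite mul0rn.
by rewrite /a -scaler_nat scalerA mulfV ?scale1r.
Qed.

Lemma coef01_lin_prod m s : all (fun q => (0 < q.1)%N) s ->
  (lin_prod m s)`_0 = 1 /\
  (lin_prod m s)`_1 = \sum_(q <- s | q.1 == 1%N) q.2.
Proof.
rewrite /lin_prod; elim: s => [|q s IH] /=; first by rewrite !big_nil !coef1.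
move=> /andP[q0 /IH[IH0 IH1]]; have [h0 h1] := coef01_lin_factor m q0.
rewrite !big_cons !coefM !big_ord_recl !big_ord0 /= !addr0 h0 h1 IH0 IH1.
by rewrite !mul1r mulr1 addrC; case: ifP => _; rewrite ?add0r.
Qed.

End rotation.

Lemma Rint_dominated_cvg (R : realType) (d : measure_display) (T : measurableType d)
    (mu : {measure set T -> \bar R}) (f_ : nat -> T -> R) (f : T -> R) (M : R) :
  mu setT = 1%E -> (forall m, bmfun (f_ m)) -> bmfun f ->
  (forall m x, `|f_ m x| <= M) -> (forall x, f_ ^~ x @ \oo --> f x) ->
  (fun m => \int[mu]_x f_ m x) @ \oo --> \int[mu]_x f x.
Proof.
move=> mu1 bf_ bf fM f_f.
have [] := @dominated_convergence _ _ _ mu setT measurableT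
  (fun m x => (f_ m x)%:E) (EFin \o f) (EFin \o (fun=> M)).
- by move=> m; apply/measurable_EFinP; exact: (bf_ m).1.
- by apply/measurable_EFinP; exact: bf.1.
- by apply: aeW => x _ /=; apply: cvg_EFin; [exact: nearW|exact: f_f].
- exact: (bmfun_integrable mu1 (bmfun_cst M)).
- by apply: aeW => x m _; rewrite lee_fin.
move=> _ _ /=; rewrite (bmfun_fineK mu1 bf).
under eq_fun do rewrite (bmfun_fineK mu1 (bf_ _)).
by move/fine_cvgP => [].
Qed.

Lemma cos_odd_pihalf (R : realType) (e : nat) : odd e ->
  cos (e%:R * (pi / 2)) = 0 :> R.
Proof.
elim/ltn_ind: e => -[//|[|e]] IH.
  by rewrite mul1r cos_pihalf.
by move=> /= /negPn oe; rewrite (sin_cos_natpihalf e).2 IH// oppr0.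
Qed.

(** * The mean value inequality on the half disc *)

Section half_disc.
Context {R : realType} {n : nat}.
Local Notation M := 'M[R]_n.+1.
Local Notation M2 := 'M[R]_(n.+1 + n.+1).
Implicit Types s : seq (nat * M).

(** Measures how far the powers (1 + K/m)^m of skew matrices are from being orthogonal on the
    imaginary axis; the excess is of order [skew_mass] / m. *)
Definition skew_mass s : R := \sum_(q <- s) fdot (rotJ *m dbl q.2) (rotJ *m dbl q.2).

Lemma skew_mass_ge0 s : 0 <= skew_mass s.
Proof. by apply: sumr_ge0 => q _; exact: fdot_sq_ge0. Qed.

(** For odd e the number (i y)^e is imaginary, so each factor is a power as in [skew_pow_le]. Since
    y^e <= y, the exponent carries y^2, which makes it integrable against 1/y^2 - 1. *)
Lemma rotev_pihalf_le m s (W : 'rV[R]_(n.+1 + n.+1)) y : 0 <= y <= 1 ->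
  (forall q, q \in s -> odd q.1 /\ q.2 \is symmetricmx) ->
  fdot (W *m rotev y (pi / 2) (lin_prod m s)) (W *m rotev y (pi / 2) (lin_prod m s)) <=
  expR (y ^+ 2 * skew_mass s / m.+1%:R) * fdot W W.
Proof.
move=> /andP[y0 y1]; elim: s W => [|q s IH] W hs.
  by rewrite /lin_prod /skew_mass !big_nil rotev1 mulmx1 mulr0 mul0r expR0 mul1r.
have [oq sq] := hs q (mem_head _ _).
rewrite /lin_prod big_cons rotevM mulmxA.
apply: (le_trans (IH _ _)).
  by move=> q' q's; apply: hs; rewrite inE q's orbT.
rewrite rotev_lin_factor dbl_rotmx cos_odd_pihalf// mulr0 scale0r add0r.
set K := (_ * _) *: _.
have skK : K^T = - K by rewrite /K linearZ/= rotJ_dbl_skew// scalerN.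
rewrite {2}/skew_mass big_cons -/(skew_mass s) mulrDr mulrDl.
rewrite [X in _ <= expR X * _]addrC expRD -[leRHS]mulrA ler_wpM2l ?expR_ge0//.
apply: (le_trans (skew_pow_le skK _ _)).
rewrite ler_wpM2r ?fdot_sq_ge0// ler_expR ler_wpM2r ?invr_ge0//.
rewrite /K fdotZl fdotZr mulrA ler_wpM2r ?fdot_sq_ge0// -expr2 exprMn.
apply: (@le_trans _ _ ((y ^+ q.1) ^+ 2)).
  rewrite ler_piMr ?sqr_ge0// sin2cos2 lerBlDr lerDl sqr_ge0//.
rewrite lerXn2r ?nnegrE ?exprn_ge0//.
case: (q.1) oq => // e _; rewrite exprS ler_piMr// exprn_ile1//.
Qed.

Lemma fnorm_rotev_lin_prod_le s :
  exists C, forall m phi, fnorm (rotev 1 phi (lin_prod m s)) <= C.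
Proof.
elim: s => [|q s [C IH]].
  by exists (fnorm (1%:M : M2)) => m phi; rewrite /lin_prod big_nil rotev1.
exists (expR (fnorm (dbl q.2) + fnorm (rotJ *m dbl q.2)) * fnorm (1%:M : M2) * C) => m phi.
rewrite /lin_prod big_cons rotevM; apply: (le_trans (fnormM _ _)).
apply: ler_pM; rewrite ?fnorm_ge0//; last exact: IH.
rewrite rotev_lin_factor; apply: (le_trans (fnorm_addid_pow_expR _ _)).
rewrite ler_wpM2r ?fnorm_ge0// ler_expR dbl_rotmx expr1n !mul1r.
apply: (le_trans (ler_fnormD _ _)); rewrite !fnormZ.
by apply: lerD; rewrite ler_piMl ?fnorm_ge0// ler_norml ?cos_geN1 ?cos_le1 ?sin_geN1 ?sin_le1.
Qed.

(* exp(z^e H) at z = e^(i phi), split into its Hermitian and unitary parts. *)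
Definition half_plane_factor (phi : R) (q : nat * M) : M2 :=
  expmx (cos (q.1%:R * phi) *: dbl q.2) *m
  expmx (sin (q.1%:R * phi) *: (rotJ *m dbl q.2)).

Definition half_plane_prod s phi : M2 := \prod_(q <- s) half_plane_factor phi q.

Lemma rotev_lin_prod_cvg s phi :
  mxcvg (fun m => rotev 1 phi (lin_prod m s)) (half_plane_prod s phi).
Proof.
elim: s => [|q s IH].
  rewrite (_ : (fun m => _) = fun=> 1%:M).
    by rewrite /half_plane_prod big_nil; exact: (@mxcvg_cst _ _ _ 1%:M).
  by apply/funext => m; rewrite /lin_prod big_nil rotev1.
rewrite (_ : (fun m => _) = fun m => rotev 1 phi (lin_factor m q) *m
    rotev 1 phi (lin_prod m s)); last first.
  by apply/funext => m; rewrite /lin_prod big_cons rotevM.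
rewrite /half_plane_prod big_cons; apply: mxcvg_mul IH.
rewrite (_ : (fun m => _) = fun m =>
    (1 + m.+1%:R^-1 *: (cos (q.1%:R * phi) *: dbl q.2 +
      sin (q.1%:R * phi) *: (rotJ *m dbl q.2))) ^+ m.+1); last first.
  by apply/funext => m; rewrite rotev_lin_factor dbl_rotmx expr1n !mul1r.
apply: comm_pow_cvg; rewrite -!scalemxAl -!scalemxAr scalerA mulrC -scalerA.
by rewrite mulmxA -rotJ_dbl.
Qed.

Lemma bmx_rotev_lin_prod m s : bmx (fun phi => rotev 1 phi (lin_prod m s)).
Proof.
elim: s => [|q s IH].
  by rewrite /lin_prod; under eq_fun do rewrite big_nil rotev1; exact: bmx_cst.
rewrite (_ : (fun phi => _) = fun phi => rotev 1 phi (lin_factor m q) *m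
    rotev 1 phi (lin_prod m s)); last first.
  by apply/funext => phi; rewrite /lin_prod big_cons rotevM.
apply: bmxM => //; under eq_fun do rewrite rotev_lin_factor dbl_rotmx expr1n !mul1r.
apply: bmx_exp; apply: bmxD; first exact: bmx_cst.
apply: bmxZ; apply: bmxD => i j; under eq_fun do rewrite mxE mulrC; apply: bmfunZ.
  exact: bmfun_cos.
exact: bmfun_sin.
Qed.

Lemma bmx_half_plane_prod s : bmx (half_plane_prod s).
Proof.
rewrite /half_plane_prod; elim: s => [|q s IH].
  by under eq_fun do rewrite big_nil; exact: bmx_cst.
under eq_fun do rewrite big_cons; apply: bmxM => //.
apply: bmxM; apply: bmx_expmx => i j; under eq_fun do rewrite mxE mulrC; apply: bmfunZ.
  exact: bmfun_cos.
exact: bmfun_sin.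
Qed.

Let hc1 : @half_circle R setT = 1%E := probability_setT half_circle.
Let w := @half_circle_weight R.
Let bw : bmfun w := bmfun_half_circle_weight.

Section lower_bound.
Variables (s : seq (nat * M)) (v : 'rV[R]_n.+1).
Hypotheses (hs : forall q, q \in s -> odd q.1 /\ q.2 \is symmetricmx)
  (v1 : fdot v v = 1) (hv : 0 <= fdot (v *m \sum_(q <- s | q.1 == 1%N) q.2) v).

(** The square root of the excess factor of [rotev_pihalf_le] at y = 1, minus 1. *)
Let eps m : R := expR (skew_mass s / (2 * m.+1%:R)) - 1.

(* The mean value of Re q over the half circle is controlled by q(0) = 1,
   q'(0) >= 0 and |q| <= 1 + O(1/m) on the imaginary axis; then
   |q|^2 >= (Re q)^2 >= 2 Re q - 1. *)
Lemma rotev_lin_prod_ge m :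
  1 - 2 * (eps m / 3) <= \int[half_circle]_phi
    (w phi * (2^-1 * fdot (rotev 1 phi (lin_prod m s)) (rotev 1 phi (lin_prod m s)))).
Proof.
set p := lin_prod m s; pose N := size p; pose c k := fdot (v *m p`_k) v.
have hN : (size p <= N.+2)%N by rewrite ltnW// ltnW.
pose V : 'rV[R]_(n.+1 + n.+1) := row_mx v 0.
have V1 : fdot V V = 1 by rewrite fdot_row_mx fdot0r addr0.
have [p0 p1] : p`_0 = 1 /\ p`_1 = \sum_(q <- s | q.1 == 1%N) q.2.
  by apply: coef01_lin_prod; apply/allP => q /hs[]; case: (q.1).
have c0 : c 0%N = 1 by rewrite /c p0 mulmx1.
have c1 : 0 <= c 1%N by rewrite /c p1.
pose re r phi := fdot (V *m rotev r phi p) V.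
have reE r phi : re r phi = 1 + (c 1%N * (r * cos phi) +
    \sum_(k < N) c k.+2 * (r ^+ k.+2 * cos (k.+2%:R * phi))).
  rewrite /re (fdot_rotev v r phi hN) !big_ord_recl /= -/(c 0%N) -/(c 1%N).
  by rewrite c0 mul0r cos0 expr0 expr1 !mul1r.
pose t : R := skew_mass s / (2 * m.+1%:R).
have t0 : 0 <= t by rewrite divr_ge0 ?mulr_ge0 ?skew_mass_ge0.
have moment y : 0 <= y <= 1 ->
    \sum_(k < N) c k.+2 * cos (k.+2%:R * (pi / 2)) * y ^+ k.+2 <= eps m * y ^+ 2.
  move=> y01; have /andP[y0 y1] := y01.
  have -> : \sum_(k < N) c k.+2 * cos (k.+2%:R * (pi / 2)) * y ^+ k.+2 = re y (pi / 2) - 1.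
    rewrite reE cos_pihalf !mulr0 add0r addrAC subrr add0r.
    by apply: eq_bigr => k _; ring.
  have re2 : re y (pi / 2) ^+ 2 <= expR (y ^+ 2 * t) ^+ 2.
    apply: (le_trans (fdot_cauchy_schwarz _ _)); rewrite V1 mulr1.
    apply: (le_trans (rotev_pihalf_le _ _ y01 hs)); rewrite V1 mulr1 -expRM_natl ler_expR.
    rewrite /t le_eqVlt; apply/orP; left; apply/eqP; field.
    by rewrite gt_eqF// ltr_wpDr.
  have re1 : re y (pi / 2) <= expR (y ^+ 2 * t).
    apply: le_trans (ler_norm _) _.
    rewrite -(@ler_pXn2r _ 2) ?nnegrE ?normr_ge0 ?expR_ge0//.
    by rewrite real_normK ?num_real.
  have [tz|tz] := eqVneq t 0.
    by rewrite /eps -/t tz expR0 subrr mul0r; move: re1; rewrite tz mulr0 expR0; lra.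
  have tp : 0 < t by rewrite lt_neqAle eq_sym tz.
  (* By convexity exp (y^2 t) - 1 <= y^2 (exp t - 1), the form required by [half_disc_moment_ge]. *)
  have := @expR_chord R 0 t (y ^+ 2 * t) tp.
  rewrite mulr_ge0 ?sqr_ge0//= ler_piMl ?exprn_ile1// => /(_ isT).
  rewrite subr0 mul0r subr0 expR0 mulr1 divff ?gt_eqF// /eps -/t => h.
  have e : (expR t - 1) / t * (y ^+ 2 * t) = (expR t - 1) * y ^+ 2.
    by field; rewrite gt_eqF.
  by move: h; rewrite e; lra.
have tail := half_disc_moment_ge moment.
have bcos k : bmfun (fun phi => w phi * cos (k%:R * phi)) by exact/bmfunM/bmfun_cos.
have bre : bmfun (fun phi => re 1 phi).
  by apply: bmfun_fdot; [apply: bmxM; [exact: bmx_cst|exact: bmx_rotev_lin_prod]|exact: bmx_cst].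
have int_re : 1 - eps m / 3 <= \int[half_circle]_phi (w phi * re 1 phi).
  have -> : \int[half_circle]_phi (w phi * re 1 phi) =
      \int[half_circle]_phi (\sum_(k < N.+2) c k * (w phi * cos (k%:R * phi))).
    apply: eq_Rintegral => phi _; rewrite /re (fdot_rotev v 1 phi hN) mulr_sumr.
    by apply: eq_bigr => k _; rewrite expr1n mul1r -/(c k); ring.
  rewrite (Rint_sum hc1); last by move=> k; exact: bmfunZ (bcos k).
  rewrite (eq_bigr (fun k : 'I_N.+2 => c k * (if k == 1%N :> nat then pi / 4 else
      cos (k%:R * (pi / 2)) / (1 - k%:R ^+ 2)))); last first.
    by move=> k _; rewrite (RintZ hc1 _ (bcos k)); congr (_ * _); exact: half_circle_moment.
  rewrite !big_ord_recl /= c0 mul0r cos0 expr0n subr0 divr1 !mul1r.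
  (* The moment of order 1 is pi/4 > 0, so q'(0) >= 0 allows the linear term to be dropped. *)
  have := mulr_ge0 c1 (divr_ge0 (pi_ge0 R) (ler0n R 4)).
  rewrite /bump /= in tail *.
  by move: tail; lra.
have half phi : 2 * re 1 phi - 1 <= 2^-1 * fdot (rotev 1 phi p) (rotev 1 phi p).
  have h1 := comm_rotJ_half (rotev_rotJ 1 phi p) v1.
  have := fdot_cauchy_schwarz (V *m rotev 1 phi p) V.
  rewrite V1 mulr1 -/(re 1 phi) -/V in h1 *.
  by have := sqr_ge0 (re 1 phi - 1); lra.
have bX : bmx (fun phi => rotev 1 phi p) by exact: bmx_rotev_lin_prod.
apply: (@le_trans _ _ (\int[half_circle]_phi (2 * (w phi * re 1 phi) - w phi))).
  rewrite (RintB hc1); [|by apply: bmfunZ; exact: bmfunM|exact: bw].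
  rewrite (RintZ hc1); last exact: bmfunM.
  by rewrite half_circle_weight_int; lra.
apply: (le_Rint hc1).
- by apply: bmfunB => //; apply: bmfunZ; exact: bmfunM.
- by apply: bmfunM => //; apply: bmfunZ; exact: bmfun_fdot.
- move=> phi; have := ler_wpM2l (half_circle_weight_ge0 phi) (half phi).
  by rewrite -/w mulrBr mulr1 mulrCA.
Qed.

Theorem half_plane_prod_ge :
  1 <= \int[half_circle]_phi
    (w phi * (2^-1 * fdot (half_plane_prod s phi) (half_plane_prod s phi))).
Proof.
pose X m phi := rotev 1 phi (lin_prod m s).
have [C hC] := fnorm_rotev_lin_prod_le s.
have [_ [Mw hMw]] := bw.
have Xcvg : (fun m => \int[half_circle]_phi (w phi * (2^-1 * fdot (X m phi) (X m phi))))
    @ \oo --> \int[half_circle]_phi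
      (w phi * (2^-1 * fdot (half_plane_prod s phi) (half_plane_prod s phi))).
  apply: (@Rint_dominated_cvg _ _ _ _ _ _ (Mw * (2^-1 * C ^+ 2))) => //.
  - move=> m; apply: bmfunM => //; apply: bmfunZ; apply: bmfun_fdot; exact: bmx_rotev_lin_prod.
  - apply: bmfunM => //; apply: bmfunZ; apply: bmfun_fdot; exact: bmx_half_plane_prod.
  - move=> m phi; rewrite normrM; apply: ler_pM => //.
    rewrite normrM ger0_norm ?invr_ge0// ler_wpM2l ?invr_ge0// ger0_norm ?fdot_sq_ge0//.
    have C0 := le_trans (fnorm_ge0 _) (hC m phi).
    by rewrite -sqr_fnorm; apply: lerXn2r; rewrite ?nnegrE ?fnorm_ge0//; exact: hC.
  - move=> phi; apply: cvgMr; apply: cvgMr.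
    by apply: mxcvg_fdot; exact: rotev_lin_prod_cvg.
have ecvg : (fun m => 1 - 2 * (eps m / 3)) @ \oo --> (1 : R).
  rewrite -[X in _ --> X](_ : 1 - 2 * ((expR 0 - 1) / 3) = 1); last first.
    by rewrite expR0 subrr mul0r mulr0 subr0.
  apply: cvgB; first exact: cvg_cst.
  apply: cvgMr; apply: cvgMl; apply: cvgB; last exact: cvg_cst.
  apply: continuous_cvg; first exact: continuous_expR.
  have := @cvg_harmonicM R (skew_mass s / 2).
  by apply: cvg_trans; apply: near_eq_cvg; apply: nearW => m; rewrite invfM mulrA.
by apply: (ler_cvg_to ecvg Xcvg); apply: nearW => m; exact: rotev_lin_prod_ge.
Qed.

End lower_bound.
End half_disc.

(** * The tail bound *)

Lemma expmx_scalar (R : realType) n (c : R) : expmx (c%:M : 'M[R]_n) = (expR c)%:M.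
Proof.
have := @expmx_diag_conj R n 1%:M (const_mx c).
by rewrite trmx1 mulmx1 !mul1mx !mulmx1 map_const_mx !diag_const_mx => /(_ erefl).
Qed.

Lemma expmx_comm2 (R : realType) n (A B : 'M[R]_n) : A *m B = B *m A ->
  expmx A *m expmx B = expmx B *m expmx A.
Proof. by move=> /expmx_comm/esym h; apply/esym; exact: expmx_comm. Qed.

Lemma symmul1 (R : realType) n (F : 'M[R]_n) : symmul F 1%:M = F.
Proof.
by rewrite /symmul mulmx1 mul1mx scalerDr -scalerDl (_ : 2^-1 + 2^-1 = 1 :> R) ?scale1r//; lra.
Qed.

Lemma loewner_fdot_le (R : realType) n (F : 'M[R]_n) (a b : R) :
  F \is symmetricmx -> loewner_le a%:M F -> loewner_le F b%:M ->
  fdot F F <= (`|a| + `|b|) ^+ 2 * fdot (1%:M : 'M[R]_n) 1%:M.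
Proof.
move=> Fs Fa Fb; have [d [g [hd gg _ FF _]]] := spectral_quadratic 1%:M Fs Fa Fb.
rewrite symmul1 in FF; rewrite FF gg mulr_sumr; apply: ler_sum => i _.
rewrite mulr_sumr; apply: ler_sum => j _; rewrite ler_wpM2r ?sqr_ge0//.
rewrite -(real_normK (num_real _)) lerXn2r ?nnegrE ?addr_ge0//.
have := hd i; have := hd j; have := ler_norm b; have := ler_norm (- a).
rewrite normrN ler_norml => h1 h2 /andP[h3 h4] /andP[h5 h6].
have := normr_ge0 a; have := normr_ge0 b.
by move=> h7 h8; apply/andP; split; lra.
Qed.

Lemma loewner_scale (R : realType) n (c : R) (A B : 'M[R]_n) : 0 <= c ->
  loewner_le A B -> loewner_le (c *: A) (c *: B).
Proof.
move=> c0 [s p]; rewrite /loewner_le -scalerBr; split.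
  by move: s; rewrite !symmetricmx_trmx linearZ/= => /eqP ->.
by move=> v; rewrite -scalemxAr -scalemxAl mxE mulr_ge0.
Qed.

Lemma prod_expR (R : realType) n (f : 'I_n -> R) :
  \prod_i expR (f i) = expR (\sum_i f i).
Proof. by rewrite (big_morph expR (@expRD R) (@expR0 R)). Qed.

Section matrix_functions.
Context {R : realType} {d : measure_display} {T : measurableType d} {n : nat}.

Lemma loewner_bmx (F : T -> 'M[R]_n) (a b : R) :
  (forall i k, measurable_fun setT (fun x => F x i k)) ->
  (forall x, F x \is symmetricmx) ->
  (forall x, loewner_le a%:M (F x)) -> (forall x, loewner_le (F x) b%:M) -> bmx F.
Proof.
move=> mF Fs Fa Fb i k; split; first exact: mF.
exists (fnorm ((`|a| + `|b|) *: (1%:M : 'M[R]_n))) => x.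
apply: (le_trans (fnorm_entry _ _ _)); rewrite /fnorm ler_wsqrtr//.
by rewrite fdotZl fdotZr mulrA -expr2 loewner_fdot_le.
Qed.

Lemma mxint_expectation0 (mu : probability T R) (F : T -> 'M[R]_n) :
  (forall i k, ('E_mu[fun x => F x i k] = 0)%E) -> mxint mu F = 0.
Proof.
by move=> h; apply/matrixP => i k; rewrite !mxE /Rintegral; have := h i k; rewrite unlock => ->.
Qed.

Lemma bmx_dbl (F : T -> 'M[R]_n) : bmx F -> bmx (fun x => dbl (F x)).
Proof.
move=> bF i j; rewrite /dbl; under eq_fun do rewrite !mxE.
case: (fintype.split i) => i'; under eq_fun do rewrite !mxE.
  by case: (fintype.split j) => j'; [exact: bF|under eq_fun do rewrite mxE; exact: bmfun_cst].
by case: (fintype.split j) => j'; [under eq_fun do rewrite mxE; exact: bmfun_cst|exact: bF].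
Qed.

Lemma mxint_dbl (mu : probability T R) (F : T -> 'M[R]_n) :
  mxint mu (fun x => dbl (F x)) = dbl (mxint mu F).
Proof.
have h0 : \int[mu]_x (0 : R) = 0 by exact: (Rint_cst (probability_setT mu)).
apply/matrixP => i j; rewrite /dbl !mxE; under eq_Rintegral do rewrite !mxE.
case: (fintype.split i) => i'; under eq_Rintegral do rewrite !mxE; rewrite !mxE.
  by case: (fintype.split j) => j'; rewrite ?mxE//; under eq_Rintegral do rewrite mxE.
by case: (fintype.split j) => j'; rewrite ?mxE//; under eq_Rintegral do rewrite mxE.
Qed.

Lemma mxintZ m p (mu : probability T R) (c : R) (F : T -> 'M[R]_(m, p)) : bmx F ->
  mxint mu (fun x => c *: F x) = c *: mxint mu F.
Proof.
move=> bF; apply/matrixP => i j; rewrite !mxE; under eq_Rintegral do rewrite mxE.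
by rewrite (RintZ (probability_setT mu)).
Qed.

End matrix_functions.

Section scalar_factors.
Context {R : realType} {n : nat}.

Lemma half_plane_prod_cat (s1 s2 : seq (nat * 'M[R]_n.+1)) phi :
  half_plane_prod (s1 ++ s2) phi = half_plane_prod s1 phi *m half_plane_prod s2 phi.
Proof. by rewrite /half_plane_prod big_cat. Qed.

(** A scalar factor exp (c z^e) has modulus exp (c cos (e phi)) on the unit circle; its phase is the
    exponential of a skew matrix. *)
Lemma half_plane_prod_scalar_le (zs : seq (nat * R)) phi p
    (W : 'M[R]_(p, n.+1 + n.+1)) :
  let Z := half_plane_prod [seq (z.1, (z.2)%:M : 'M[R]_n.+1) | z <- zs] phi in
  fdot (W *m Z) (W *m Z) <=
  expR (2 * \sum_(z <- zs) z.2 * cos (z.1%:R * phi)) * fdot W W.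
Proof.
rewrite /half_plane_prod; elim: zs W => [|z zs IH] W /=.
  by rewrite !big_nil mulmx1 mulr0 expR0 mul1r.
rewrite !big_cons mulmxE_ring mulmxA; apply: (le_trans (IH _)).
rewrite mulrDr addrC expRD -[leRHS]mulrA ler_wpM2l ?expR_ge0// mulmxA.
apply: (le_trans (expmx_skew_le _ _)).
  by rewrite linearZ/= rotJ_dbl_skew ?scalerN// symmetricmx_trmx tr_scalar_mx.
rewrite dbl_scalar scale_scalar_mx expmx_scalar mul_mx_scalar fdotZl fdotZr mulrA.
rewrite -expRD/= (_ : _ + _ = 2 * (z.2 * cos (z.1%:R * phi)))//; ring.
Qed.

End scalar_factors.

Lemma eq_Rint_fdot (R : realType) (d : measure_display) (T : measurableType d)
    (mu : {measure set T -> \bar R}) m n (X Y : T -> 'M[R]_(m, n)) : X =1 Y ->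
  \int[mu]_x fdot (X x) (X x) = \int[mu]_x fdot (Y x) (Y x).
Proof. by move=> XY; apply: eq_Rintegral => x _; rewrite XY. Qed.

Section chain_bounds.
Context {R : realType} {dT : measure_display} {T : measurableType dT}.
Variables (P : R.-pker T ~> T) (mu : probability T R).
Hypotheses (hstat : stationary P mu) (hgap : lambda P mu < 1).
Context {dO : measure_display} {Omega : measurableType dO} {Pr : probability Omega R}
  {n d : nat}.
Variable s : 'I_n.+1 -> {RV Pr >-> T}.
Hypothesis hs : markov_chain P mu s.
Variables (F : 'I_n.+1 -> T -> 'M[R]_d.+1) (a b : 'I_n.+1 -> R).
Hypotheses (bF : forall j, bmx (F j)) (Fsym : forall j x, F j x \is symmetricmx)
  (Fmean : forall j, mxint mu (F j) = 0)
  (Fa : forall j x, loewner_le (a j)%:M (F j x))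
  (Fb : forall j x, loewner_le (F j x) (b j)%:M).

Let Pr1 : Pr setT = 1%E := probability_setT Pr.
Let mu1 : mu setT = 1%E := probability_setT mu.
Let hc1 : @half_circle R setT = 1%E := probability_setT half_circle.
Let al := alpha (lambda P mu).
Let sigma2 := \sum_(j < n.+1) (b j - a j) ^+ 2.

Lemma sym_scale m (c : R) (A : 'M[R]_m) : A \is symmetricmx -> c *: A \is symmetricmx.
Proof. by rewrite !symmetricmx_trmx linearZ/= => /eqP ->. Qed.

Lemma exp_product_bound (theta : R) : 0 < theta ->
  \int[Pr]_w fdot (mxprod (fun j => expmx ((theta / 2) *: F j (s j w))))
                  (mxprod (fun j => expmx ((theta / 2) *: F j (s j w)))) <=
  d.+1%:R * expR (theta ^+ 2 / 2 * al * (sigma2 / 4)).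
Proof.
move=> t0.
have := @matrix_chain_bound _ _ _ P mu d.+1 hstat hgap isT _ _ _ _ s hs
  (fun j x => theta *: F j x) (fun _ _ => 1%:M) (fun j => theta * a j) (fun j => theta * b j).
rewrite prod_expR (_ : \sum_i _ = theta ^+ 2 / 2 * al * (sigma2 / 4)); last first.
  rewrite /sigma2 mulr_suml mulr_sumr; apply: eq_bigr => j _.
  by rewrite /al; move: (alpha _) => k; field.
have E w : mxprod (fun j => 1%:M *m expmx (2^-1 *: (theta *: F j (s j w)))) =
    mxprod (fun j => expmx ((theta / 2) *: F j (s j w))).
  by apply: eq_bigr => j _; rewrite mul1mx scalerA mulrC.
rewrite (eq_Rint_fdot Pr E).
apply.
- by move=> j; exact: bmxZ.
- by move=> j; exact: bmx_cst.
- by move=> j x; exact: sym_scale.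
- by move=> j; rewrite mxintZ// Fmean scaler0.
- by move=> j x; rewrite -scale_scalar_mx; apply: loewner_scale => //; exact: ltW.
- by move=> j x; rewrite -scale_scalar_mx; apply: loewner_scale => //; exact: ltW.
- by move=> j x; rewrite mul1mx mulmx1.
- by move=> j x W; rewrite trmx1 mulmx1.
Qed.

Let A theta phi j x : 'M[R]_(d.+1 + d.+1) :=
  half_plane_factor phi (1%N, (theta / 2) *: F j x).

(** [matrix_chain_bound] is applied to theta cos phi F_j, where cos phi >= 0 preserves the Loewner
    bounds, and to the exponential of the skew part as the contraction [U]. *)
Lemma half_plane_product_bound (theta phi : R) : 0 < theta -> 0 <= cos phi ->
  \int[Pr]_w fdot (mxprod (fun j => A theta phi j (s j w)))
                  (mxprod (fun j => A theta phi j (s j w))) <=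
  (d.+1 + d.+1)%:R * expR (al * sigma2 * theta ^+ 2 / 8 * cos phi ^+ 2).
Proof.
move=> t0 c0; pose c := theta * cos phi; have cc : 0 <= c by rewrite mulr_ge0// ltW.
pose U j x := expmx ((theta / 2 * sin phi) *: (rotJ *m dbl (F j x))).
have comm j x k k' : (k *: (rotJ *m dbl (F j x))) *m (k' *: dbl (F j x)) =
    (k' *: dbl (F j x)) *m (k *: (rotJ *m dbl (F j x))).
  rewrite -!scalemxAl -!scalemxAr scalerA mulrC -scalerA.
  by rewrite [in RHS]mulmxA -rotJ_dbl.
have h := @matrix_chain_bound _ _ _ P mu (d.+1 + d.+1) hstat hgap isT _ _ _ _ s hs
  (fun j x => c *: dbl (F j x)) U (fun j => c * a j) (fun j => c * b j).
rewrite prod_expR (_ : \sum_i _ = al * sigma2 * theta ^+ 2 / 8 * cos phi ^+ 2) in h; last first.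
  transitivity (\sum_(j < n.+1) (al * theta ^+ 2 / 8 * cos phi ^+ 2) * (b j - a j) ^+ 2).
    by apply: eq_bigr => j _; rewrite /al /c; move: (alpha _) => k; ring.
  by rewrite -mulr_sumr -/sigma2; ring.
have E w : mxprod (fun j => U j (s j w) *m expmx (2^-1 *: (c *: dbl (F j (s j w))))) =
    mxprod (fun j => A theta phi j (s j w)).
  apply: eq_bigr => j _; rewrite /A /half_plane_factor /= mul1r !dblZ -!scalemxAr !scalerA.
  have -> : 2^-1 * c = cos phi * (theta / 2) by rewrite /c; field.
  by rewrite /U (mulrC _ (sin phi)); apply: expmx_comm2; exact: comm.
rewrite (eq_Rint_fdot Pr E) in h.
have bdF j : bmx (fun x => dbl (F j x)) by exact: bmx_dbl.
apply: h.
- by move=> j; exact: bmxZ.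
- move=> j; apply: bmx_expmx; apply: bmxZ; apply: bmxM => //; exact: bmx_cst.
- by move=> j x; apply: sym_scale; exact: dbl_sym.
- by move=> j; rewrite mxintZ// mxint_dbl Fmean (_ : dbl 0 = 0) ?scaler0// /dbl block_mx0.
- move=> j x; rewrite -scale_scalar_mx; apply: loewner_scale => //.
  by rewrite -dbl_scalar; exact: dbl_loewner.
- move=> j x; rewrite -scale_scalar_mx; apply: loewner_scale => //.
  by rewrite -dbl_scalar; exact: dbl_loewner.
- by move=> j x; apply: expmx_comm; exact: comm.
- move=> j x W; rewrite /U expmx_tr; apply: expmx_skew_le.
  by rewrite linearZ/= rotJ_dbl_skew// scalerN linearN/= linearZ/= rotJ_dbl_skew// scalerN.
Qed.

Let bdF j : bmx (fun x => dbl (F j x)) := bmx_dbl (bF j).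

Lemma measurable_lambda_max (t : R) :
  measurable [set w | t <= lambda_max (\sum_(j < n.+1) F j (s j w))].
Proof.
pose S w := \sum_(j < n.+1) F j (s j w).
have bS : bmx S.
  move=> i k; rewrite /S; under eq_fun do rewrite summxE.
  by apply: bmfun_sum => j; exact: (bmfun_rv s j (bF j i k)).
have Ssym w : S w \is symmetricmx.
  rewrite symmetricmx_trmx /S linear_sum /=; apply/eqP; apply: eq_bigr => j _.
  by apply/eqP; rewrite -symmetricmx_trmx.
rewrite (_ : [set w | _] = \bigcap_m [set w | 1 <= \tr (expmx (m%:R *: (S w - t%:M)))]).
  apply: bigcap_measurable => // m _.
  have bX : bmx (fun w => expmx (m%:R *: (S w - t%:M))).
    by apply: bmx_expmx; apply: bmxZ; apply: bmxB => //; exact: bmx_cst.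
  have mt : measurable_fun setT (fun w => \tr (expmx (m%:R *: (S w - t%:M)))).
    by apply: (bmfun_sum _ (fun i => bX i i)).1.
  rewrite -[X in measurable X]setTI (_ : [set w | _] =
    (fun w => \tr (expmx (m%:R *: (S w - t%:M)))) @^-1` `[1, +oo[); first exact: mt.
  by apply/seteqP; split => w; rewrite /= in_itv/= andbT.
apply/seteqP; split => w /=.
  by move=> /(lambda_max_le_expmx_trace t (ltn0Sn d) (Ssym w)) h m _; exact: h.
by move=> h; apply/(lambda_max_le_expmx_trace t (ltn0Sn d) (Ssym w)) => m; exact: h.
Qed.

End chain_bounds.

Lemma bmfun_comp (R : realType) d1 d2 (T1 : measurableType d1) (T2 : measurableType d2)
    (f : T2 -> R) (g : T1 -> T2) : measurable_fun setT g -> bmfun f -> bmfun (fun x => f (g x)).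
Proof.
by move=> mg [mf [M fM]]; split; [exact: measurableT_comp|exists M => x; exact: fM].
Qed.

Lemma bmx_mxprod (R : realType) d (T : measurableType d) D n (A : 'I_n -> T -> 'M[R]_D) :
  (forall j, bmx (A j)) -> bmx (fun x => mxprod (fun j => A j x)).
Proof.
rewrite /mxprod; elim: n A => [|n IH] A bA.
  by under eq_fun do rewrite big_ord0; exact: bmx_cst.
by under eq_fun do rewrite big_ord_recr; apply: bmxM => //; exact: IH.
Qed.

Lemma half_plane_prod_enum (R : realType) d n (H : 'I_n -> 'M[R]_d.+1) phi :
  half_plane_prod [seq (1%N, H j) | j <- enum 'I_n] phi =
  mxprod (fun j => half_plane_factor phi (1%N, H j)).
Proof. by rewrite /half_plane_prod big_map enumT /mxprod [index_enum _]unlock. Qed.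

Section tail.
Context {R : realType} {d : nat}.

Lemma rayleigh_top (S : 'M[R]_d.+1) : S \is symmetricmx ->
  exists v : 'rV[R]_d.+1, fdot v v = 1 /\ fdot (v *m S) v = lambda_max S.
Proof.
move=> /(lambda_max_spectral (ltn0Sn d))[Q [e [k [QQ SE _ ->]]]].
have vv : fdot (row k Q) (row k Q) = 1.
  transitivity ((Q *m Q^T) k k); last by rewrite QQ mxE eqxx.
  by rewrite fdotE big_ord1 mxE; apply: eq_bigr => j _; rewrite !mxE.
exists (row k Q); split=> //.
have -> : row k Q *m S = e 0 k *: row k Q.
  rewrite SE !mulmxA -row_mul QQ row1 -rowE row_diag_mx -scalemxAl -rowE.
  by [].
by rewrite fdotZl vv mulr1.
Qed.

(* The terms of - tau p(z) for p = 3/4 z + 1/4 sum_k (-1)^k (1 - k/N) z^(2k+1).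
   Then p'(0) = 1 and, on the half circle, (cos phi)^2 - 2 Re p is at most
   - 3/4 + 1 / (4 N (cos phi)^2), see [cesaro_cos_weight]. *)
Definition cesaro_seq (tau : R) (N : nat) : seq (nat * R) :=
  (1%N, - tau * (3 / 4)) ::
  map (fun k : 'I_N =>
    (k.*2.+1, - tau * (4^-1 * ((-1) ^+ k * (1 - k%:R / N%:R))))) (enum 'I_N).

Lemma cesaro_seq_sum tau N phi :
  \sum_(z <- cesaro_seq tau N) z.2 * cos (z.1%:R * phi) =
  - tau * (3 / 4 * cos phi + 4^-1 * cesaro_cos N phi).
Proof.
rewrite /cesaro_seq big_cons big_map big_enum /= mul1r mulrDr; congr (_ + _); first by ring.
rewrite /cesaro_cos !mulr_sumr; apply: eq_bigr => k _ /=.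
by rewrite !mulrA.
Qed.

Lemma cesaro_seq_lin tau N : (0 < N)%N ->
  \sum_(z <- cesaro_seq tau N | z.1 == 1%N) (z.2)%:M = (- tau)%:M :> 'M[R]_d.+1.
Proof.
case: N => // N _; rewrite /cesaro_seq big_cons big_map big_enum_cond /=.
rewrite (bigD1 ord0) //= big1; last first.
  by move=> k; rewrite eqSS double_eq0 => /andP[/eqP k0]; case/eqP; apply: val_inj.
rewrite addr0 -raddfD/=; congr (_%:M); rewrite expr0 mul0r subr0; by field.
Qed.

Lemma odd_cesaro_seq tau N z : z \in cesaro_seq tau N -> odd z.1.
Proof.
by rewrite inE => /orP[/eqP ->//|/mapP[k _ ->]] /=; rewrite odd_double.
Qed.

End tail.

(** * From the mean value inequality to the tail probability *)

Section chain_tail.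
Context {R : realType} {dT : measure_display} {T : measurableType dT}.
Variables (P : R.-pker T ~> T) (mu : probability T R).
Hypotheses (hstat : stationary P mu) (hgap : lambda P mu < 1).
Context {dO : measure_display} {Omega : measurableType dO} {Pr : probability Omega R}
  {n d : nat}.
Variable s : 'I_n.+1 -> {RV Pr >-> T}.
Hypothesis hs : markov_chain P mu s.
Variables (F : 'I_n.+1 -> T -> 'M[R]_d.+1) (a b : 'I_n.+1 -> R).
Hypotheses (bF : forall j, bmx (F j)) (Fsym : forall j x, F j x \is symmetricmx)
  (Fmean : forall j, mxint mu (F j) = 0)
  (Fa : forall j x, loewner_le (a j)%:M (F j x))
  (Fb : forall j x, loewner_le (F j x) (b j)%:M).

Let Pr1 : Pr setT = 1%E := probability_setT Pr.
Let hc1 : @half_circle R setT = 1%E := probability_setT half_circle.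
Let c := alpha (lambda P mu) * \sum_(j < n.+1) (b j - a j) ^+ 2.
Let S w := \sum_(j < n.+1) F j (s j w).
Let event t := [set w | t <= lambda_max (S w)].
Let om := @half_circle_weight R.

Let Ssym w : S w \is symmetricmx.
Proof.
rewrite symmetricmx_trmx /S linear_sum /=; apply/eqP; apply: eq_bigr => j _.
by apply/eqP; rewrite -symmetricmx_trmx.
Qed.

Let X theta (p : Omega * R) := mxprod (fun j =>
  half_plane_factor p.2 (1%N, (theta / 2) *: F j (s j p.1))).

Let E tau N phi : R := expR (2 * (- tau * (3 / 4 * cos phi + 4^-1 * cesaro_cos N phi))).

(** Integrated over phi, [g] dominates the indicator of the event; integrated over w, it is
    controlled by the moment bound. The proof compares the two orders of integration. *)
Let g theta tau N (p : Omega * R) : R :=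
  om p.2 * (2^-1 * (E tau N p.2 * fdot (X theta p) (X theta p))).

Let bX theta : bmx (X theta).
Proof.
apply: bmx_mxprod => j.
have b1 i k : bmfun (fun p : Omega * R => F j (s j p.1) i k).
  exact: (bmfun_comp (@measurable_fst _ _ _ _) (bmfun_rv s j (bF j i k))).
have bd : bmx (fun p : Omega * R => dbl ((theta / 2) *: F j (s j p.1))).
  by apply: bmx_dbl; apply: bmxZ.
apply: bmxM; apply: bmx_expmx => i k; under eq_fun do rewrite mxE; apply: bmfunM.
- exact: (bmfun_comp (@measurable_snd _ _ _ _) (bmfun_cos 1%:R)).
- exact: bd.
- exact: (bmfun_comp (@measurable_snd _ _ _ _) (bmfun_sin 1%:R)).
- by apply: bmxM => //; exact: bmx_cst.
Qed.

Let bE tau N : bmfun (E tau N).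
Proof.
have bc : bmfun (fun phi : R => 2 * (- tau * (3 / 4 * cos phi + 4^-1 * cesaro_cos N phi))).
  apply: bmfunZ; apply: bmfunZ; apply: bmfunD; apply: bmfunZ.
    have := @bmfun_cos R 1.
    by rewrite (_ : (fun phi : R => cos (1 * phi)) = cos)//; apply/funext => x; rewrite mul1r.
  rewrite /cesaro_cos; apply: bmfun_sum => k; apply: bmfunZ; exact: bmfun_cos.
have [mc [M hM]] := bc; split; first exact: measurableT_comp.
by exists (expR M) => x; rewrite ger0_norm ?expR_ge0// ler_expR (le_trans (ler_norm _))//.
Qed.

Let bg theta tau N : bmfun (g theta tau N).
Proof.
apply: bmfunM; first exact: (bmfun_comp (@measurable_snd _ _ _ _) bmfun_half_circle_weight).
apply: bmfunZ; apply: bmfunM; last exact: bmfun_fdot.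
exact: (bmfun_comp (@measurable_snd _ _ _ _) (bE tau N)).
Qed.

Let g_ge0 theta tau N p : 0 <= g theta tau N p.
Proof.
rewrite mulr_ge0 ?half_circle_weight_ge0// mulr_ge0 ?invr_ge0//.
by rewrite mulr_ge0 ?expR_ge0// fdot_sq_ge0.
Qed.

Let bg2 theta tau N w : bmfun (fun phi : R => g theta tau N (w, phi)).
Proof.
apply: (bmfun_comp _ (bg theta tau N)); apply: measurable_fun_pair => //.
Qed.

Let bg1 theta tau N phi : bmfun (fun w : Omega => g theta tau N (w, phi)).
Proof.
apply: (bmfun_comp _ (bg theta tau N)); apply: measurable_fun_pair => //.
Qed.

(** The matrix factors are followed by the scalar ones for exp (- tau p). With v a unit top
    eigenvector, q'(0) = theta/2 lambda_max S - tau, which is nonnegative on the event as tau =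
    theta t / 2. *)
Lemma event_indicator_le theta t N w : 0 < theta -> (0 < N)%N -> event t w ->
  1 <= \int[half_circle]_phi g theta (theta * t / 2) N (w, phi).
Proof.
move=> t0 N0 ev; set tau := theta * t / 2.
have [v [v1 vS]] := rayleigh_top (Ssym w).
pose sF := [seq (1%N, (theta / 2) *: F j (s j w)) | j <- enum 'I_n.+1].
pose sZ := [seq (z.1, (z.2)%:M : 'M[R]_d.+1) | z <- cesaro_seq tau N].
have := @half_plane_prod_ge R d (sF ++ sZ) v.
have h1 q : q \in sF ++ sZ -> odd q.1 /\ q.2 \is symmetricmx.
  rewrite mem_cat => /orP[/mapP[j _ ->]|/mapP[z zZ ->]] /=.
    by split=> //; exact: sym_scale.
  by rewrite symmetricmx_trmx tr_scalar_mx (odd_cesaro_seq zZ).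
have h2 : 0 <= fdot (v *m \sum_(q <- sF ++ sZ | q.1 == 1%N) q.2) v.
  have sFE : \sum_(q <- sF | q.1 == 1%N) q.2 = (theta / 2) *: S w.
    by rewrite /sF big_map big_enum_cond /= /S scaler_sumr.
  have sZE : \sum_(q <- sZ | q.1 == 1%N) q.2 = (- tau)%:M.
    by rewrite /sZ big_map cesaro_seq_lin.
  rewrite big_cat /= sFE sZE mulmxDr mul_mx_scalar -scalemxAr.
  rewrite fdotDl !fdotZl v1 vS mulr1 /tau.
  have := ler_wpM2l (ltW t0) ev; rewrite /=; lra.
move=> /(_ h1 v1 h2) h; apply: (le_trans h).
apply: (le_Rint hc1).
- apply: bmfunM; first exact: bmfun_half_circle_weight.
  by apply: bmfunZ; apply: bmfun_fdot; exact: bmx_half_plane_prod.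
- exact: bg2.
move=> phi; rewrite /g ler_wpM2l ?half_circle_weight_ge0// ler_wpM2l ?invr_ge0//.
rewrite half_plane_prod_cat; apply: (le_trans (half_plane_prod_scalar_le _ _ _)).
by rewrite cesaro_seq_sum /E /X /sF half_plane_prod_enum.
Qed.

(** The condition c theta <= 4 t means c theta^2 / 8 <= tau. Where cos phi >= eta the exponent is
    close to - 3 tau / 4; where cos phi < eta it is at most 0 and the weight is below pi/2 eta. *)
Lemma integral_g_le theta t N eta phi : 0 < theta -> 0 < t -> (0 < N)%N -> 0 < eta ->
  c * theta <= 4 * t ->
  \int[Pr]_w g theta (theta * t / 2) N (w, phi) <=
  d.+1%:R * (om phi * expR (theta * t / 2 * (- (3 / 4) + (4 * N%:R * eta ^+ 2)^-1)) +
             pi / 2 * eta).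
Proof.
move=> th0 t0 N0 eta0 hc; set tau := theta * t / 2.
have tau0 : 0 < tau by rewrite divr_gt0// mulr_gt0.
have rhs0 : 0 <= pi / 2 * eta by rewrite mulr_ge0 ?divr_ge0 ?pi_ge0 ?(ltW eta0).
have om0 : 0 <= om phi by exact: half_circle_weight_ge0.
have bXX : bmfun (fun w => fdot (X theta (w, phi)) (X theta (w, phi))).
  apply: bmfun_fdot => i k; apply: (bmfun_comp _ (bX theta i k)).
    exact: measurable_fun_pair.
  exact: measurable_fun_pair.
have -> : \int[Pr]_w g theta tau N (w, phi) =
    om phi * (2^-1 * E tau N phi) * \int[Pr]_w fdot (X theta (w, phi)) (X theta (w, phi)).
  by rewrite -(RintZ Pr1)//; apply: eq_Rintegral => w _; rewrite /g /= !mulrA.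
have [cphi|cphi] := leP (cos phi) 0.
  have -> : om phi = 0.
    apply/eqP; rewrite eq_le om0 andbT /om half_circle_weightE; case: ifP => // _.
    by rewrite mulr_ge0_le0// divr_ge0// pi_ge0.
  by rewrite !mul0r add0r mulr_ge0.
have hX := half_plane_product_bound hstat hgap hs bF Fsym Fmean Fa Fb th0 (ltW cphi).
have le1 : E tau N phi * expR (c * theta ^+ 2 / 8 * cos phi ^+ 2) <=
    expR (tau * Num.min 0 (- (3 / 4) + (4 * N%:R * cos phi ^+ 2)^-1)).
  rewrite /E -expRD ler_expR.
  apply: (@le_trans _ _ (tau * (cos phi ^+ 2 -
      2 * (3 / 4 * cos phi + 4^-1 * cesaro_cos N phi)))).
    have : c * theta ^+ 2 / 8 * cos phi ^+ 2 <= tau * cos phi ^+ 2.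
      rewrite ler_wpM2r ?sqr_ge0// /tau expr2 mulrA.
      by have := ler_wpM2r (ltW th0) hc; lra.
    by rewrite mulrBr; lra.
  by rewrite ler_wpM2l ?(ltW tau0)//; exact: cesaro_cos_weight.
apply: (@le_trans _ _ (d.+1%:R * (om phi *
    expR (tau * Num.min 0 (- (3 / 4) + (4 * N%:R * cos phi ^+ 2)^-1))))).
  (* The factor 2^-1 inherited from [comm_rotJ_half] cancels the doubled dimension in [hX]. *)
  have := ler_wpM2l (mulr_ge0 om0 (mulr_ge0 _ (expR_ge0 _))) hX.
  move=> /(_ 2^-1 _) h; apply: (le_trans (h _ _)) => //.
  have := ler_wpM2l om0 le1; rewrite natrD.
  set Ex := expR (c * _ / _ * _); set E' := E _ _ _ => h1.
  rewrite -/c; have := ler_wpM2l (ler0n R d.+1) h1.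
  rewrite (_ : om phi * (2^-1 * E') * ((d.+1%:R + d.+1%:R) * Ex) =
    d.+1%:R * (om phi * (E' * Ex)))//; by field.
rewrite ler_wpM2l//; have [ce|ce] := leP eta (cos phi).
  rewrite -[leLHS]addr0 lerD// ler_wpM2l// ler_expR ler_wpM2l ?(ltW tau0)//.
  rewrite ge_min; apply/orP; right; rewrite lerD2l lef_pV2 ?posrE ?mulr_gt0 ?ltr0n ?exprn_gt0//.
  by rewrite ler_wpM2l// lerXn2r ?nnegrE ?(ltW eta0) ?(ltW cphi).
rewrite -[leLHS]add0r lerD//; first by rewrite mulr_ge0 ?expR_ge0.
apply: (@le_trans _ _ (om phi * 1)).
  rewrite ler_wpM2l// -expR0 ler_expR pmulr_rle0// ge_min lexx//.
rewrite mulr1 /om half_circle_weightE; case: ifP => // _.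
by rewrite ler_wpM2l ?divr_ge0 ?pi_ge0// ltW.
Qed.

Lemma tail_bound_cesaro theta t N eta : 0 < theta -> 0 < t -> (0 < N)%N -> 0 < eta ->
  c * theta <= 4 * t ->
  (Pr (event t) <= (d.+1%:R * (expR (theta * t / 2 * (- (3 / 4) + (4 * N%:R * eta ^+ 2)^-1)) +
             pi / 2 * eta))%:E)%E.
Proof.
move=> th0 t0 N0 eta0 hc; set tau := theta * t / 2.
have mE : measurable (event t) by exact: measurable_lambda_max.
have mg : measurable_fun setT (fun p : Omega * R => (g theta tau N p)%:E).
  by apply/measurable_EFinP; exact: (bg theta tau N).1.
have g0 p : (0 <= (g theta tau N p)%:E)%E by rewrite lee_fin.
apply: (@le_trans _ _ (\int[Pr]_w \int[half_circle]_phi (g theta tau N (w, phi))%:E)%E).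
  rewrite -(setIT (event t)) -integral_indic//.
  apply: ge0_le_integral => //.
  - by apply/measurable_EFinP; exact: measurable_indic.
  - exact: (measurable_fun_fubini_tonelli_F (m2 := half_circle) _ mg g0).
  move=> w _; rewrite (bmfun_fineK hc1 (bg2 _ _ _ _)) lee_fin indicE.
  have [|_] := boolP (w \in event t); last first.
    by apply: (Rint_ge0 half_circle) => phi; exact: g_ge0.
  by rewrite inE => ev; exact: event_indicator_le.
rewrite (fubini_tonelli (m1 := Pr) (m2 := half_circle) _ mg g0).
have bG : bmfun (fun phi => d.+1%:R * (om phi *
    expR (tau * (- (3 / 4) + (4 * N%:R * eta ^+ 2)^-1)) + pi / 2 * eta)).
  apply: bmfunZ; apply: bmfunD; last exact: bmfun_cst.
  by apply: bmfunM; [exact: bmfun_half_circle_weight|exact: bmfun_cst].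
apply: (@le_trans _ _ (\int[half_circle]_phi (d.+1%:R * (om phi *
    expR (tau * (- (3 / 4) + (4 * N%:R * eta ^+ 2)^-1)) + pi / 2 * eta))%:E)%E).
  apply: ge0_le_integral => //.
  - by move=> phi _; apply: integral_ge0.
  - exact: (measurable_fun_fubini_tonelli_G (m1 := Pr) _ mg g0).
  - by apply/measurable_EFinP; exact: bG.1.
  move=> phi _; rewrite (bmfun_fineK Pr1 (bg1 _ _ _ _)) lee_fin.
  exact: integral_g_le.
rewrite (bmfun_fineK hc1 bG) lee_fin (RintZ hc1); last first.
  apply: bmfunD; last exact: bmfun_cst.
  by apply: bmfunM; [exact: bmfun_half_circle_weight|exact: bmfun_cst].
rewrite (RintD hc1); last 2 first.
- by apply: bmfunM; [exact: bmfun_half_circle_weight|exact: bmfun_cst].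
- exact: bmfun_cst.
rewrite (Rint_cst hc1); under eq_Rintegral do rewrite mulrC.
by rewrite (RintZ hc1) ?half_circle_weight_int ?mulr1//; exact: bmfun_half_circle_weight.
Qed.

(** N tends to infinity for fixed eta = 1/(m+1), and m only afterwards, since 1 / (N eta^2) has to
    vanish before eta does. *)
Lemma tail_bound theta t : 0 < theta -> 0 < t -> c * theta <= 4 * t ->
  (Pr (event t) <= (d.+1%:R * expR (- (3 / 8 * theta * t)))%:E)%E.
Proof.
move=> th0 t0 hc.
have mE : measurable (event t) by exact: measurable_lambda_max.
have PrE : Pr (event t) = (fine (Pr (event t)))%:E.
  by rewrite fineK// fin_num_measure.
rewrite PrE lee_fin; set p := fine _.
have bnd (N m : nat) : p <= d.+1%:R * (expR (theta * t / 2 * (- (3 / 4) +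
    (4 * N.+1%:R * m.+1%:R^-1 ^+ 2)^-1)) + pi / 2 * m.+1%:R^-1).
  by rewrite -lee_fin -PrE; apply: tail_bound_cesaro => //; rewrite invr_gt0.
have bnd2 (m : nat) : p <= d.+1%:R * (expR (theta * t / 2 * (- (3 / 4))) +
    pi / 2 * m.+1%:R^-1).
  have cp : (fun _ : nat => p) @ \oo --> p by exact: cvg_cst.
  suff h : (fun N : nat => d.+1%:R * (expR (theta * t / 2 * (- (3 / 4) +
    (4 * N.+1%:R * m.+1%:R^-1 ^+ 2)^-1)) + pi / 2 * m.+1%:R^-1)) @ \oo -->
    d.+1%:R * (expR (theta * t / 2 * (- (3 / 4) + 0)) + pi / 2 * m.+1%:R^-1).
    by rewrite addr0 in h; apply: (ler_cvg_to cp h); apply: nearW => N; exact: bnd.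
  apply: cvgMr; apply: cvgD; last exact: cvg_cst.
  apply: continuous_cvg; first exact: continuous_expR.
  apply: cvgMr; apply: cvgD; first exact: cvg_cst.
  have := @cvg_harmonicM R (4 * m.+1%:R^-1 ^+ 2)^-1.
  by apply: cvg_trans; apply: near_eq_cvg; apply: nearW => N; rewrite -invfM mulrAC.
have cp : (fun _ : nat => p) @ \oo --> p by exact: cvg_cst.
suff h : (fun m : nat => d.+1%:R * (expR (theta * t / 2 * (- (3 / 4))) +
    pi / 2 * m.+1%:R^-1)) @ \oo --> d.+1%:R * (expR (theta * t / 2 * (- (3 / 4))) + 0).
  rewrite addr0 in h.
  have -> : - (3 / 8 * theta * t) = theta * t / 2 * (- (3 / 4)) by field.
  by apply: (ler_cvg_to cp h); apply: nearW => m; exact: bnd2.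
apply: cvgMr; apply: cvgD; first exact: cvg_cst.
exact: cvg_harmonicM.
Qed.

End chain_tail.

Lemma natr_le_powR (R : realType) (d : nat) (e : R) : (0 < d)%N -> 1 <= e ->
  d%:R <= d%:R `^ e.
Proof.
move=> d0 e1; have d1 : 1 <= d%:R :> R by rewrite ler1n.
by rewrite -[leLHS](@powRr1 R)// ler_powR.
Qed.

(* In the second bound the quotient is taken in the extended reals, where
   0^-1 = +oo and expeR -oo = 0, so that the degenerate case in which
   b_j = a_j for every j gives the bound 0, the value of exp(-t^2 / 0). *)
Theorem theorem2p5 (R : realType) (dT : measure_display)
    (T : measurableType dT) (P : R.-pker T ~> T) (mu : probability T R)
    (hstat : stationary P mu) (hgap : lambda P mu < 1)
    (dO : measure_display) (Omega : measurableType dO)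
    (Pr : probability Omega R)
    (n d : nat) (hn : (0 < n)%N) (hd : (0 < d)%N)
    (s : 'I_n -> {RV Pr >-> T}) (hs : markov_chain P mu s)
    (F : 'I_n -> T -> 'M[R]_d) (a b : 'I_n -> R)
    (hFmeas : forall j i k, measurable_fun [set: T] (fun x => F j x i k))
    (hFsym : forall j x, F j x \is symmetricmx)
    (hFmean : forall j i k, ('E_mu[fun x => F j x i k] = 0)%E)
    (hFlb : forall j x, loewner_le (a j)%:M (F j x))
    (hFub : forall j x, loewner_le (F j x) (b j)%:M) :
  (forall theta : R, 0 < theta ->
     ('E_Pr[fun w => (frobenius_norm
               (\prod_(j < n) expmx ((theta / 2) *: F j (s j w))) ^+ 2)%R]
      <= (d%:R * expR (theta ^+ 2 / 2 * alpha (lambda P mu)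
                       * ((\sum_(j < n) (b j - a j) ^+ 2) / 4)))%:E)%E) /\
  (forall t : R, 0 < t ->
     (Pr [set w | (t <= lambda_max (\sum_(j < n) F j (s j w)))%R]
      <= (d%:R `^ (2 - pi / 4))%:E
         * expeR (- ((t ^+ 2 / (8 / pi ^+ 2))%:E
                     / (alpha (lambda P mu)
                        * \sum_(j < n) (b j - a j) ^+ 2)%:E)))%E).
Proof.
have bF j : bmx (F j) by exact: loewner_bmx (hFmeas j) (hFsym j) (hFlb j) (hFub j).
have F0 j : mxint mu (F j) = 0 by exact: mxint_expectation0.
case: n hn s hs F a b hFmeas hFsym hFmean hFlb hFub bF F0 => // n _ s hs.
case: d hd => // d _ F a b _ hFsym _ hFlb hFub bF F0.
split=> [theta th0|t t0].
  pose X w := mxprod (fun j => expmx ((theta / 2) *: F j (s j w))).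
  have bX : bmx X.
    apply: bmx_mxprod => j; apply: bmx_expmx; apply: bmxZ => i k.
    exact: (bmfun_rv s j (bF j i k)).
  rewrite unlock (eq_integral (fun w => (fdot (X w) (X w))%:E)); last first.
    by move=> w _; rewrite /= sqr_frobenius_norm.
  rewrite (bmfun_fineK (probability_setT Pr)); last exact: bmfun_fdot.
  rewrite lee_fin; exact: exp_product_bound.
set c := alpha (lambda P mu) * \sum_(j < n.+1) (b j - a j) ^+ 2.
have l0 := lambda_ge0 hstat.
have al0 : 0 < alpha (lambda P mu) by rewrite /alpha divr_gt0 ?subr_gt0//; lra.
have c0 : 0 <= c.
  by apply: mulr_ge0; [exact: ltW|apply: sumr_ge0 => j _; exact: sqr_ge0].
set p := Pr _; set K := (d.+1%:R : R) `^ _.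
(* 2 - pi/4 >= 1 because pi <= 4, so the power of the dimension absorbs the factor d. *)
have dK : d.+1%:R <= K.
  apply: natr_le_powR => //; suff : pi <= 4 :> R by lra.
  rewrite -(@ler_pXn2r _ 2) ?nnegrE ?pi_ge0//.
  by apply: le_trans (pi_sqr_le12) _; rewrite -natrX ler_nat.
have bnd theta : 0 < theta -> c * theta <= 4 * t ->
    (p <= (d.+1%:R * expR (- (3 / 8 * theta * t)))%:E)%E.
  by move=> th0 hc; exact: (tail_bound hstat hgap hs bF hFsym F0 hFlb hFub).
(* For c = 0 every theta > 0 is admissible; theta = (m+1) t and exp (- x) <= 1/x drive the
   probability to 0. *)
have [cz|cn] := eqVneq c 0.
  suff : (p <= 0%E)%E.
    move=> /le_trans; apply; apply: mule_ge0; first by rewrite lee_fin powR_ge0.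
    exact: expeR_ge0.
  have p_fin : p = (fine p)%:E.
    rewrite fineK// fin_num_measure//; exact: measurable_lambda_max.
  rewrite p_fin lee_fin.
  have cp : (fun _ : nat => fine p) @ \oo --> fine p by exact: cvg_cst.
  suff h : (fun m : nat => 8 / (3 * t ^+ 2) * d.+1%:R / m.+1%:R) @ \oo --> (0 : R).
    apply: (ler_cvg_to cp h); apply: nearW => m.
    have m0 : 0 < m.+1%:R :> R by [].
    have := bnd (m.+1%:R * t) (mulr_gt0 m0 t0); rewrite cz mul0r.
    move=> /(_ (mulr_ge0 (ler0n _ _) (ltW t0))); rewrite p_fin lee_fin => /le_trans; apply.
    set x := 3 / 8 * _ * t.
    have x0 : 0 < x by rewrite !mulr_gt0.
    have hx : expR (- x) <= x^-1.
      rewrite expRN lef_pV2 ?posrE ?expR_gt0//; have := expR_ge1Dx x; lra.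
    rewrite (_ : 8 / _ * _ / _ = d.+1%:R * x^-1); last first.
      by rewrite /x; field; rewrite ?gt_eqF// ltr_wpDr.
    by rewrite ler_wpM2l.
  exact: cvg_harmonicM.
have cgt : 0 < c by rewrite lt_neqAle eq_sym cn.
(* The largest admissible theta. It turns 3/8 theta t into 12 t^2 / (8 c), to be compared with pi^2
   t^2 / (8 c). *)
have th0 : 0 < 4 * t / c by rewrite divr_gt0// mulr_gt0.
have := bnd _ th0; rewrite [c * _]mulrC divfK// => /(_ (lexx _)) /le_trans; apply.
have -> : ((t ^+ 2 / (8 / pi ^+ 2))%:E / c%:E = (t ^+ 2 / (8 / pi ^+ 2) / c)%:E)%E.
  by rewrite inver (negbTE cn).
rewrite -EFinN /= -EFinM lee_fin.
apply: ler_pM => //; rewrite ?expR_ge0// ler_expR lerN2.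
rewrite invf_div -/c; have ci0 : 0 <= c^-1 by rewrite invr_ge0 ltW.
have h := ler_wpM2r ci0 (ler_wpM2l (sqr_ge0 t) (@pi_sqr_le12 R)).
rewrite (_ : 3 / 8 * _ * t = t ^+ 2 * 12 / c / 8); last by field.
rewrite (_ : t ^+ 2 * _ / c = t ^+ 2 * pi ^+ 2 / c / 8); last by field.
lra.
Qed.
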